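(* Let $\mathcal{X}$ be Polish and $\mathcal{H}\subseteq\{0,1\}^{\mathcal{X}}$ a measurable concept class that does not have an infinite VCL tree. Then $\mathcal{H}$ is learnable at rate $\frac1n$: there is a learning algorithm such that for every realizable $P$ there exists $C>0$ with $\mathbf{E}[\mathrm{er}_P(\hat h_n)]\le\frac Cn$ for all $n$.
   Context: $\mathcal{H}$ measurable: there is a Polish $\Theta$ and Borel $\mathsf{h}:\Theta\times\mathcal{X}\to\{0,1\}$ with $\mathcal{H}=\{\mathsf{h}(\theta,\cdot)\}$. $\mathrm{er}_P(h)=P\{(x,y):h(x)\ne y\}$; $P$ on $\mathcal{X}\times\{0,1\}$ realizable if $\inf_{h\in\mathcal{H}}\mathrm{er}_P(h)=0$. A learning algorithm is a sequence of universally measurable maps $H_n:(\mathcal{X}\times\{0,1\})^n\times\mathcal{X}\to\{0,1\}$ with $\hat h_n(x)=H_n((X_1,Y_1),\ldots,(X_n,Y_n),x)$ for i.i.d. $(X_i,Y_i)\sim P$. VCL tree of depth $d\le\infty$: a collection $\{x_{\mathbf u}\in\mathcal{X}^{k+1}:0\le k<d,\ \mathbf u\in\{0,1\}^1\times\cdots\times\{0,1\}^k\}$ such that for every $n<d$ and $\mathbf y\in\{0,1\}^1\times\cdots\times\{0,1\}^{n+1}$ there is $h\in\mathcal{H}$ with $h(x^i_{\mathbf y_{\le k}})=y^i_{k+1}$ for all $0\le i\le k$, $0\le k\le n$, where $\mathbf y_{\le k}=(y^0_1,(y^0_2,y^1_2),\ldots,(y^0_k,\ldots,y^{k-1}_k))$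 and $x_{\mathbf y_{\le k}}=(x^0_{\mathbf y_{\le k}},\ldots,x^k_{\mathbf y_{\le k}})$. Infinite: $d=\infty$. *)

(* Defs.v *)
From HB Require Import structures.
From mathcomp Require Import all_boot all_order all_algebra.
From mathcomp Require Import all_classical all_reals all_analysis.
Set Implicit Arguments. Unset Strict Implicit. Unset Printing Implicit Defensive.
Import Order.TTheory GRing.Theory Num.Theory.
Import numFieldNormedType.Exports.
Local Open Scope classical_set_scope.
Local Open Scope ring_scope.

Notation borel X := (g_sigma_algebraType (@open X)).

Definition polish (R : realType) (X : topologicalType) : Prop :=
  (exists D : set X, countable D /\ dense D) /\
  exists dist : X -> X -> R,
    [/\ (forall x y, 0 <= dist x y),
        (forall x y, dist x y = 0 <-> x = y),
        (forall x y, dist x y = dist y x) /\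
        (forall x y z, dist x z <= dist x y + dist y z),
        (forall A : set X, open A <->
           (forall x, A x -> exists2 e : R, 0 < e & forall y, dist x y < e -> A y)) &
        (forall u : nat -> X,
           (forall e : R, 0 < e -> exists N : nat, forall m n : nat,
               (N <= m)%N -> (N <= n)%N -> dist (u m) (u n) < e) ->
           exists l : X, u @ \oo --> l)].

Definition measurable_class (R : realType) (X : topologicalType)
    (H : set (X -> bool)) : Prop :=
  exists (Theta : topologicalType), polish R Theta /\
  exists h : Theta -> X -> bool,
    <<s [set S : set (Theta * X) | exists A B,
           [/\ <<s @open Theta >> A, <<s @open X >> B & S = A `*` B]] >>
      [set p : Theta * X | h p.1 p.2] /\
    H = range h.

(* Infinite VCL tree.  A node at depth k is indexed by
   u = (u_1, ..., u_k) with u_j in {0,1}^j, encoded as a list of k bit-lists;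
   x u i is the point x^i_u (only 0 <= i <= k = size u is meaningful).
   A branch y = (y_1, y_2, ...) with y_{j} in {0,1}^j is encoded as
   y : nat -> seq bool with y k = y_{k+1} (of size k+1); then
   y_{<= k} = mkseq y k. *)
Definition infinite_VCL_tree (X : Type) (H : set (X -> bool))
    (x : seq (seq bool) -> nat -> X) : Prop :=
  forall (n : nat) (y : nat -> seq bool),
    (forall k, (k <= n)%N -> size (y k) = k.+1) ->
    exists2 h, H h &
      forall k i, (k <= n)%N -> (i <= k)%N ->
        h (x (mkseq y k) i) = nth false (y k) i.

Definition has_infinite_VCL_tree (X : Type) (H : set (X -> bool)) : Prop :=
  exists x, infinite_VCL_tree H x.

Definition univ_measurable_set (R : realType) d (T : measurableType d)
    (A : set T) : Prop :=
  forall P : probability T R,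
    exists B1 B2 : set T, [/\ measurable B1, measurable B2,
      B1 `<=` A, A `<=` B2 & P (B2 `\` B1) = 0%E].

Definition univ_measurable_bool (R : realType) d (T : measurableType d)
    (f : T -> bool) : Prop :=
  univ_measurable_set R (f @^-1` [set true]).

Definition learner (X : ptopologicalType) :=
  forall n : nat, n.-tuple (borel X * bool)%type -> borel X -> bool.

Definition learner_univ_measurable (R : realType) (X : ptopologicalType)
    (L : learner X) : Prop :=
  forall n : nat,
    univ_measurable_bool R
      (fun p : (n.-tuple (borel X * bool)%type * borel X)%type => L n p.1 p.2).

(* er_P(h) = P{(x,y) : h x <> y}, written as the integral of the indicator
   (this agrees with the completed measure for universally measurable h). *)
Definition er (R : realType) (X : ptopologicalType)
    (P : probability (borel X * bool)%type R) (h : borel X -> bool) : \bar R :=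
  (\int[P]_z ((h z.1 != z.2)%:R : R)%:E)%E.

Definition realizable (R : realType) (X : ptopologicalType)
    (P : probability (borel X * bool)%type R) (H : set (X -> bool)) : Prop :=
  ereal_inf [set er P h | h in H] = 0%E.

Fixpoint iid_expect (R : realType) d (Z : measurableType d)
    (P : probability Z R) (n : nat) : (n.-tuple Z -> \bar R) -> \bar R :=
  match n return (n.-tuple Z -> \bar R) -> \bar R with
  | 0 => fun f => f [tuple]
  | n'.+1 => fun f =>
      (\int[P]_z iid_expect P (fun t : n'.-tuple Z => f (cons_tuple z t)))%E
  end.

Definition expected_error (R : realType) (X : ptopologicalType)
    (P : probability (borel X * bool)%type R) (L : learner X) (n : nat) : \bar R :=
  iid_expect P (fun t : n.-tuple (borel X * bool)%type => er P (L n t)).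

(* Main.v *)
Require Import Defs.
From HB Require Import structures.
From mathcomp Require Import all_boot all_order all_algebra.
From mathcomp Require Import all_classical all_reals all_analysis.
From mathcomp Require Import measurable_realfun ring lra zify.
Set Implicit Arguments. Unset Strict Implicit. Unset Printing Implicit Defensive.
Import Order.TTheory GRing.Theory Num.Theory.

(** The absence of an infinite VCL tree means that the tree of finite VCL trees, each coded together
    with witnesses of non-emptiness at its nodes, is well founded. Approximating these codes by finite
    sequences of integers keeps the tree well founded and makes it countable (the Kunen-Martin
    argument). The learner can therefore play the VCL game by descending along this countable
    relation: the tests it performs are memberships in analytic sets, built by recursion along the
    relation, and these are universally measurable; no ordinals are needed.

    Played against i.i.d. data, the game almost surely stops at a state whose forbidden pattern has
    probability zero; this is proved by well-founded induction on the state. Such a state at depth d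
    confines the labels of fresh data to a class shattering no d+1 points, for which the
    one-inclusion graph gives a leave-one-out predictor with at most 2d mistakes.

    The learner cuts half of its n samples into about log n batches, plays the game on each, inserts
    the test point at every position of the remaining half and takes a majority vote. With
    probability 1 - O(1/n) at least three quarters of the batches end in a state of bounded depth
    whose pattern has probability zero, and these states contribute an error O(1/n). *)

(** * The one-inclusion graph *)

Section OneInclusion.

(** The usual winning strategy follows ordinal values of positions, whose measurability is the
    obstacle. Here a position only meets the countably many tests [active w] and [pre_active w],
    indexed by lists of integers. The recursion behind them uses projections and countable
    intersections alone, so it stays analytic; complements enter only in the learner, where the
    sigma-algebra of universally measurable sets absorbs them.

    The probability that a batch ends in a good state tends to 1 without any rate, since the
    induction on states is not quantitative. The rate comes from the number m of batches: once each
    is good with probability at least 254/255, an exponential moment bounds the probability of m/4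
    bad batches by 2^-m, which is at most 1/n, while the batch length still tends to infinity. The
    threshold depends on P; it enters the constant C and not the learner.

    The expectation is an iterated integral of functions that need not be Borel. Independence,
    exchangeability and null sets are therefore all derived from Tonelli and monotone convergence
    for universally measurable functions of lists. *)

Fixpoint allb (n : nat) : seq bitseq :=
  if n is n'.+1 then [seq false :: y | y <- allb n'] ++ [seq true :: y | y <- allb n'] else [:: [::]].

Lemma mem_allb n y : (y \in allb n) = (size y == n).
Proof.
elim: n y => [|n IH] y; first by case: y.
rewrite /= mem_cat; case: y => [|b y] /=.
  by apply/negbTE; rewrite negb_or; apply/andP; split; apply/mapP => -[].
rewrite eqSS -IH; case: b; apply/orP/idP.
- by case=> /mapP[z zn] [] // ->.
- by move=> yn; right; apply: map_f.
- by case=> /mapP[z zn] [] // ->.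
- by move=> yn; left; apply: map_f.
Qed.

Lemma allb_uniq n : uniq (allb n).
Proof.
elim: n => //= n IH; rewrite cat_uniq !map_inj_uniq ?IH//= ?andbT; try by move=> ? ? [].
by apply/hasPn => _ /mapP[y _ ->]; apply/mapP => -[].
Qed.

Definition flip (i : nat) (y : bitseq) : bitseq := set_nth false y i (~~ nth false y i).

Definition vcard n (V : pred bitseq) : nat := \sum_(y <- allb n) V y.

(** The sum of all degrees: an undirected edge counts twice, once from each end, whence the factors
    2 below. *)
Definition edges n (V : pred bitseq) : nat := \sum_(y <- allb n) \sum_(i < n) (V y && V (flip i y)).

Definition unshattered n (V : pred bitseq) k :=
  forall b, size b = n -> count id b = k ->
    exists2 e : bitseq, size e = k & forall y, size y = n -> V y -> mask b y <> e.

Lemma vcardS n V : vcard n.+1 V = vcard n (V \o cons false) + vcard n (V \o cons true).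
Proof. by rewrite /vcard /= big_cat !big_map. Qed.

Lemma edgesS n V : edges n.+1 V = edges n (V \o cons false) + edges n (V \o cons true)
  + 2 * vcard n (predI (V \o cons false) (V \o cons true)).
Proof.
have E b y : \sum_(i < n.+1) (V (b :: y) && V (flip i (b :: y))) =
    (V (b :: y) && V (~~ b :: y)) + \sum_(i < n) (V (b :: y) && V (b :: flip i y)).
  by rewrite big_ord_recl.
rewrite /edges /vcard /= big_cat !big_map /= mul2n -addnn.
under eq_bigr do rewrite E.
under [X in _ + X = _]eq_bigr do rewrite E.
rewrite !big_split /=.
have -> : \sum_(y <- allb n) (V (true :: y) && V (false :: y)) =
    \sum_(y <- allb n) (V (false :: y) && V (true :: y)) by apply: eq_bigr => y _; rewrite andbC.
by rewrite addnACA addnC.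
Qed.

(** Holds pair by pair: an edge inside both sets lies inside the union and the intersection, an edge
    inside only one of them lies inside the union. *)
Lemma edges_union_inter n V0 V1 :
  edges n V0 + edges n V1 <= edges n (predU V0 V1) + edges n (predI V0 V1).
Proof.
rewrite /edges -!big_split; apply: leq_sum => y _; rewrite -!big_split; apply: leq_sum => i _ /=.
by case: (V0 y); case: (V1 y); case: (V0 (flip i y)); case: (V1 (flip i y)).
Qed.

Lemma vcard_union_inter n V0 V1 :
  vcard n V0 + vcard n V1 = vcard n (predU V0 V1) + vcard n (predI V0 V1).
Proof.
rewrite /vcard -!big_split; apply: eq_bigr => y _ /=.
by case: (V0 y); case: (V1 y).
Qed.

(* Haussler's bound on the edge density of the one-inclusion graph. *)
Lemma edge_density n V k : unshattered n V k -> edges n V + 2 * vcard n V <= 2 * k * vcard n V.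
Proof.
elim: n V k => [|n IH] V [|k] H.
- have [e /size0nil -> He] := H [::] erefl erefl.
  have := He [::] erefl; rewrite /edges /vcard /= !big_seq1 big_ord0.
  by case: (V _) => // /(_ isT).
- by rewrite /edges /vcard /= !big_seq1 big_ord0 add0n leq_mul2r; lia.
- have [e /size0nil -> He] := H (nseq n.+1 false) (size_nseq _ _) ltac:(by rewrite count_nseq).
  have V0 y : y \in allb n.+1 -> V y = false.
    rewrite mem_allb => /eqP sy; apply/negP => /(He y sy); apply.
    by rewrite mask_false.
  have -> : edges n.+1 V = 0.
    by rewrite /edges big_seq big1// => y /V0 ->; rewrite big1.
  by rewrite /vcard big_seq big1// => y /V0 ->.
rewrite edgesS vcardS; set V0 := V \o cons false; set V1 := V \o cons true.
have hU : unshattered n (predU V0 V1) k.+1.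
  move=> b sb cb; have [e se He] := H (false :: b) ltac:(by rewrite /= sb) cb.
  by exists e => // y sy /orP[] Vy; [apply: (He (false :: y))|apply: (He (true :: y))]; rewrite //= sy.
(* Above a point of the intersection both values of the first coordinate occur, so if a pattern on
   the first and k further coordinates is missing, its tail is missing on those k. *)
have hI : unshattered n (predI V0 V1) k.
  move=> b sb cb; have [[|c e] //= [se] He] := H (true :: b) ltac:(by rewrite /= sb) ltac:(by rewrite /= cb).
  exists e => // y sy /andP[v0 v1] E.
  by case: c He => He; [apply: (He (true :: y))|apply: (He (false :: y))]; rewrite //= ?sy ?E.
have := IH _ _ hU; have := IH _ _ hI.
have := edges_union_inter n V0 V1; have := vcard_union_inter n V0 V1.
move: (vcard n (predU V0 V1)) (vcard n (predI V0 V1)) (vcard n V0) (vcard n V1) => a b c d.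
move: (edges _ _) (edges _ _) (edges _ _) (edges _ _) => u v p q; nia.
Qed.

(** Absent vertices get 0, below all present ones, so a vote between a vertex and a non-vertex goes
    to the vertex. *)
Definition rank (r : seq bitseq) (y : bitseq) : nat := if y \in r then (index y r).+1 else 0.

(** Every edge is oriented towards its later end in [r], and the vote is the label of that end. *)
Definition loo_vote (r : seq bitseq) (i : nat) (y : bitseq) : bool :=
  rank r (set_nth false y i false) < rank r (set_nth false y i true).

Lemma set_nth_twice (y : bitseq) i b c : set_nth false (set_nth false y i c) i b = set_nth false y i b.
Proof.
apply: (@eq_from_nth _ false); first by rewrite !size_set_nth maxnA maxnn.
move=> j _; rewrite nth_set_nth /= [RHS]nth_set_nth /=; case: eqP => // /eqP ji.
by rewrite nth_set_nth /= (negbTE ji).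
Qed.

(** The bit under prediction is not read. This makes [loo_vote] a leave-one-out predictor and later
    permits a dummy label on the test point. *)
Lemma loo_vote_set r i y b : loo_vote r i (set_nth false y i b) = loo_vote r i y.
Proof. by rewrite /loo_vote !set_nth_twice. Qed.

Lemma set_nth_same (y : bitseq) i : i < size y -> set_nth false y i (nth false y i) = y.
Proof.
move=> iy; apply: (@eq_from_nth _ false); rewrite size_set_nth; first exact/maxn_idPr.
by move=> j _; rewrite nth_set_nth /=; case: eqP => // ->.
Qed.

(** An error means that the vote went to the other end, whose rank is then at least that of [y]; so
    that end is present and comes later. Errors at [y] are thus bounded by its outdegree. *)
Lemma loo_vote_error r i y : y \in r -> i < size y -> loo_vote r i y != nth false y i ->
  flip i y \in drop (index y r).+1 r.
Proof.
move=> yr iy err.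
have ne : flip i y != y.
  apply/eqP => /(congr1 (nth false ^~ i)); rewrite /flip nth_set_nth /= eqxx.
  by case: (nth _ _ _).
have ry : rank r y = (index y r).+1 by rewrite /rank yr.
have le : rank r y <= rank r (flip i y).
  move: err; rewrite /loo_vote /flip; have := set_nth_same iy.
  by case: (nth false y i) => E; rewrite E; [rewrite eqb_id -leqNgt|case: ltnP => // /ltnW].
have fr : flip i y \in r by move: le; rewrite ry /rank; case: ifP.
have lt : index y r < index (flip i y) r.
  rewrite ltn_neqAle; move: le; rewrite ry /rank fr ltnS => ->; rewrite andbT.
  by apply: contraNneq ne => E; rewrite -(nth_index [::] fr) -E nth_index.
rewrite -(nth_index [::] fr) -(subnKC lt) -nth_drop mem_nth// size_drop.
by rewrite ltn_sub2r// ?index_mem//; apply: leq_ltn_trans lt _; rewrite index_mem.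
Qed.

(** Averaging: if all degrees exceeded 2d, their sum would contradict [edge_density] at k = d +
    1. *)
Lemma exists_low_degree n d (vs : seq bitseq) : uniq vs -> vs != [::] ->
  (forall y, y \in vs -> size y = n) -> unshattered n (mem vs) d.+1 ->
  exists2 y, y \in vs & \sum_(i < n) (flip i y \in vs : nat) <= 2 * d.
Proof.
move=> uvs nvs szs /edge_density H; apply: contrapT => nex.
have hi y : y \in vs -> 2 * d < \sum_(i < n) (flip i y \in vs : nat).
  by move=> yv; rewrite ltnNge; apply/negP => le; apply: nex; exists y.
have P : perm_eq [seq y <- allb n | y \in vs] vs.
  apply: uniq_perm => //; first exact/filter_uniq/allb_uniq.
  by move=> y; rewrite mem_filter; case: (boolP (y \in vs)) => //= yv; rewrite mem_allb szs ?eqxx.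
have c1 : vcard n (mem vs) = size vs.
  rewrite -(perm_size P) /vcard size_filter -sum1_count [RHS]big_mkcond /=.
  by apply: eq_bigr => y _ /=; case: (y \in vs).
have c2 : size vs * (2 * d).+1 <= edges n (mem vs).
  rewrite /edges (bigID (mem vs)) /= -[X in X <= _]addn0; apply: leq_add => //.
  rewrite -big_filter (perm_big _ P) /= -sum1_size big_distrl /= big_seq [X in _ <= X]big_seq.
  by apply: leq_sum => y yv; rewrite mul1n; apply: leq_trans (hi y yv) _; rewrite yv.
have : 0 < size vs by case: (vs) nvs.
rewrite c1 in H; nia.
Qed.

(* Peeling off low-degree vertices orients the one-inclusion graph with small outdegree. *)
Lemma exists_peeling n d (vs : seq bitseq) : uniq vs ->
  (forall y, y \in vs -> size y = n) -> unshattered n (mem vs) d.+1 ->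
  exists r, vs =i r /\ forall y, y \in r ->
    \sum_(i < n) (flip i y \in drop (index y r).+1 r : nat) <= 2 * d.
Proof.
elim: {vs}(size vs) {-2}vs (erefl (size vs)) => [|m IH] vs svs uvs szs H.
  by exists [::]; split=> // y; rewrite (size0nil svs).
have [|y yv dy] := exists_low_degree uvs _ szs H; first by case: (vs) svs.
have [r [Er Hr]] := IH (rem y vs) ltac:(by rewrite size_rem// svs) (rem_uniq y uvs)
  (fun z zr => szs z (mem_rem zr))
  (fun b sb cb => let: ex_intro2 e se He := H b sb cb in
     ex_intro2 _ _ e se (fun z sz zr => He z sz (mem_rem zr))).
(* The vertex of low degree goes first: all its neighbours come later, and there are at most 2d of
   them. *)
exists (y :: r); split=> [z|z].
  by rewrite inE -Er rem_filter// mem_filter /=; case: eqP => // ->.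
have yr : y \notin r by rewrite -Er rem_filter// mem_filter /= eqxx.
rewrite inE /=; case: (eqVneq z y) => [-> _|zy /= zr].
  rewrite ?eqxx /= drop0; apply: leq_trans dy; apply: leq_sum => i _.
  by case: (boolP (_ \in r)) => //; rewrite -Er => /mem_rem ->.
by rewrite ?(eq_sym y z) ?(negbTE zy); exact: Hr.
Qed.

(** The chosen order is a function of discrete data, which form a countable type; [measurable_vote]
    relies on this. *)
Lemma exists_loo_order : exists order : nat -> nat -> seq bitseq -> seq bitseq,
  forall n d vs, uniq vs -> (forall y, y \in vs -> size y = n) -> unshattered n (mem vs) d.+1 ->
  forall y, y \in vs -> \sum_(i < n) (loo_vote (order n d vs) i y != nth false y i : nat) <= 2 * d.
Proof.
have /choice[order Ho] : forall p : nat * nat * seq bitseq, exists r, let: (n, d, vs) := p in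
    uniq vs -> (forall y, y \in vs -> size y = n) -> unshattered n (mem vs) d.+1 ->
    vs =i r /\ forall y, y \in r ->
      \sum_(i < n) (flip i y \in drop (index y r).+1 r : nat) <= 2 * d.
  move=> [[n d] vs].
  have [[u [s h]]|nh] := pselect (uniq vs /\ (forall y, y \in vs -> size y = n) /\ unshattered n (mem vs) d.+1).
    by have [r Hr] := exists_peeling u s h; exists r.
  by exists [::] => u s h; case: nh.
exists (fun n d vs => order (n, d, vs)) => n d vs u s h y yv.
have [Er Hr] := Ho (n, d, vs) u s h.
have yr : y \in order (n, d, vs) by rewrite -Er.
apply: leq_trans (Hr y yr); apply: leq_sum => i _.
case: (boolP (_ != _)) => // err; rewrite (loo_vote_error yr _ err)//.
by rewrite (s y yv).
Qed.

End OneInclusion.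

Local Open Scope classical_set_scope.
Local Open Scope ring_scope.

(** * Analytic sets *)

Definition agree (k : nat) (z z' : nat -> nat) := forall i, (i < k)%N -> z i = z' i.

Lemma agreeW k k' z z' : (k <= k')%N -> agree k' z z' -> agree k z z'.
Proof. by move=> kk' zz' i ik; apply: zz'; apply: leq_trans kk'. Qed.

Definition baire_closed (C : set (nat -> nat)) :=
  forall z, (forall k, exists2 z', C z' & agree k z z') -> C z.

Lemma bounded_on_initial (f : nat -> nat) k : exists K, forall n, (n < k)%N -> (f n < K)%N.
Proof.
exists (\max_(n < k) (f n).+1) => n nk.
exact: (leq_bigmax (Ordinal nk)).
Qed.

Lemma agree_reindex (f : nat -> nat) k :
  exists K, forall z z', agree K z z' -> agree k (z \o f) (z' \o f).
Proof.
have [K HK] := bounded_on_initial f k; exists K => z z' zz' i ik /=.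
exact/zz'/HK.
Qed.

Section PseudoMetric.
Variables (R : realType) (Y : Type) (rho : Y -> Y -> R).

Definition pmetric := [/\ forall x, rho x x = 0, forall x y, rho x y = rho y x
  & forall x y z, rho x z <= rho x y + rho y z].

Definition cont_on (C : set (nat -> nat)) (g : (nat -> nat) -> Y) :=
  forall z, C z -> forall e, 0 < e ->
    exists k, forall z', C z' -> agree k z z' -> rho (g z) (g z') < e.

(** A continuous image of a closed set of integer sequences, saturated for distance zero. The
    saturation matters because [rho] is a pseudometric: sets of m-tuples are represented by sets of
    infinite sequences, with a [rho] that sees only m coordinates. *)
Definition analytic (S : set Y) := exists C g,
  [/\ baire_closed C, cont_on C g
    & forall y, S y <-> exists2 z, C z & rho (g z) y = 0].

Hypothesis rhoP : pmetric.

Lemma rho_ge0 x y : 0 <= rho x y.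
Proof. by case: rhoP => r0 rC rT; have := rT x y x; rewrite r0 (rC y x); lra. Qed.

Lemma rho_eq0 x y : (forall e, 0 < e -> rho x y < e) -> rho x y = 0.
Proof.
move=> H; apply/eqP; rewrite eq_le rho_ge0 andbT.
by apply/ler_addgt0Pr => e e0; rewrite add0r; apply/ltW/H.
Qed.

(** Pairing of indices lets one sequence code a witness for every i. That all witnesses have the
    same image, up to distance zero, is a closed condition; [i0] selects the image that is
    returned. *)
Lemma analytic_bigcap (I : countType) (i0 : I) (S : I -> set Y) :
  (forall i, analytic (S i)) -> analytic [set y | forall i, S i y].
Proof.
have [r0 rC rT] := rhoP.
move=> /choice[C] /choice[g] H.
pose f (i : I) (n : nat) : nat := pickle (i, n).
exists [set z : nat -> nat | forall i, C i (z \o f i) /\ rho (g i (z \o f i)) (g i0 (z \o f i0)) = 0].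
exists (fun z : nat -> nat => g i0 (z \o f i0)); split.
- move=> z Hz i.
  have Ci j : C j (z \o f j).
    have [cl _ _] := H j; apply: cl => k.
    have [K HK] := agree_reindex (f j) k.
    have [z' /(_ j)[Cz' _] zz'] := Hz K.
    by exists (z' \o f j) => //; apply: HK.
  split; first exact: Ci.
  apply: rho_eq0 => e e0.
  have e3 : 0 < e / 2 by rewrite divr_gt0.
  have [_ ci _] := H i; have [_ c0 _] := H i0.
  have [k1 Hk1] := ci _ (Ci i) _ e3.
  have [k2 Hk2] := c0 _ (Ci i0) _ e3.
  have [K1 HK1] := agree_reindex (f i) k1.
  have [K2 HK2] := agree_reindex (f i0) k2.
  have [z' Cz' zz'] := Hz (maxn K1 K2).
  have [C1 C2] := Cz' i; have [C3 _] := Cz' i0.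
  have := Hk1 _ C1 (HK1 _ _ (agreeW (leq_maxl _ _) zz')).
  have := Hk2 _ C3 (HK2 _ _ (agreeW (leq_maxr _ _) zz')).
  have := rT (g i (z \o f i)) (g i (z' \o f i)) (g i0 (z \o f i0)).
  have := rT (g i (z' \o f i)) (g i0 (z' \o f i0)) (g i0 (z \o f i0)).
  rewrite (rC (g i0 (z' \o f i0))); lra.
- move=> z /(_ i0)[Cz _] e e0.
  have [_ c0 _] := H i0; have [k Hk] := c0 _ Cz _ e0.
  have [K HK] := agree_reindex (f i0) k.
  by exists K => z' /(_ i0)[Cz' _] zz'; apply: Hk => //; apply: HK.
- move=> y; split=> [Sy|[z Cz gzy] i].
    have /choice[u Hu] : forall i, exists z, C i z /\ rho (g i z) y = 0.
      move=> i; have [_ _ Hi] := H i; have [z ? ?] := (Hi y).1 (Sy i); by exists z.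
    pose z j := if @unpickle (I * nat)%type j is Some p then u p.1 p.2 else 0%N.
    have zf i : z \o f i = u i by apply: funext => n; rewrite /z /f /= pickleK.
    exists z; last by rewrite zf; have [] := Hu i0.
    move=> i; rewrite !zf; have [Ci ri] := Hu i; have [C0 r0'] := Hu i0; split=> //.
    apply/eqP; rewrite eq_le rho_ge0 andbT.
    by have := rT (g i (u i)) y (g i0 (u i0)); rewrite ri (rC y) r0' addr0.
  have [_ _ Hi] := H i; apply/Hi; have [Ci ri] := Cz i.
  exists (z \o f i) => //; apply/eqP; rewrite eq_le rho_ge0 andbT.
  by have := rT (g i (z \o f i)) (g i0 (z \o f i0)) y; rewrite ri gzy addr0.
Qed.

(** The first entry of a code selects the set, the remaining entries form the witness. *)
Lemma analytic_bigcup (S : nat -> set Y) :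
  (forall i, analytic (S i)) -> analytic (\bigcup_i S i).
Proof.
move=> /choice[C] /choice[g] H.
exists [set z : nat -> nat | C (z 0%N) (z \o succn)], (fun z : nat -> nat => g (z 0%N) (z \o succn)); split.
- move=> z Hz /=; have [cl _ _] := H (z 0%N); apply: cl => k.
  have [z' Cz' zz'] := Hz k.+1; exists (z' \o succn); first by rewrite zz'.
  by move=> i ik /=; apply: zz'.
- move=> z Cz e e0; have [_ c0 _] := H (z 0%N); have [k Hk] := c0 _ Cz _ e0.
  exists k.+1 => z' Cz' zz'; rewrite -(zz' 0%N)//; apply: Hk.
    by rewrite (zz' 0%N).
  by move=> i ik /=; apply: zz'.
- move=> y; split=> [[i _ Sy]|[z Cz gzy]].
    have [_ _ Hi] := H i; have [z Cz gz] := (Hi y).1 Sy.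
    by exists (fun j => if j is j'.+1 then z j' else i).
  exists (z 0%N) => //; have [_ _ Hi] := H (z 0%N); apply/Hi; by exists (z \o succn).
Qed.

Lemma analytic0 (y0 : Y) : analytic set0.
Proof.
exists set0, (fun=> y0); split=> //.
  by move=> z /(_ 0%N)[].
by move=> y; split=> // -[].
Qed.

End PseudoMetric.

(** This is projection: [rho'] sees the coordinates to be quantified away, and saturating for the
    coarser [rho] quantifies existentially over them. *)
Lemma analytic_saturate (R : realType) (Y : Type) (rho rho' : Y -> Y -> R) (S : set Y) :
  pmetric rho -> pmetric rho' -> (forall x y, rho x y <= rho' x y) -> analytic rho' S ->
  analytic rho [set y | exists2 y', S y' & rho y' y = 0].
Proof.
move=> [r0 rC rT] r'P rr' [C [g [cl c Sg]]]; have rP : pmetric rho by split.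
exists C, g; split=> //.
  move=> z Cz e e0; have [k Hk] := c z Cz e e0; exists k => z' Cz' zz'.
  exact: le_lt_trans (rr' _ _) (Hk _ Cz' zz').
move=> y; split=> [[y' /Sg[z Cz gz] y'y]|[z Cz gz]].
  exists z => //; apply/eqP; rewrite eq_le rho_ge0// andbT.
  by have := rT (g z) y' y; have := rr' (g z) y'; rewrite y'y gz; lra.
by exists (g z) => //; apply/Sg; exists z => //; case: r'P.
Qed.

(** * Complete separable metrics; closed, open and bianalytic sets *)

Section PolishMetric.
Variable R : realType.

Record polish_metric (X : Type) (dist : X -> X -> R) (d : nat -> X) : Prop := PolishMetric {
  pm_eq0 : forall x y, dist x y = 0 <-> x = y;
  pm_pm : pmetric dist;
  pm_dense : forall x e, 0 < e -> exists n, dist (d n) x < e;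
  pm_complete : forall u : nat -> X,
    (forall e, 0 < e -> exists N, forall m n, (N <= m)%N -> (N <= n)%N -> dist (u m) (u n) < e) ->
    exists l, forall e, 0 < e -> exists N, forall n, (N <= n)%N -> dist (u n) l < e }.

Definition mclosed (X : Type) (dist : X -> X -> R) (A : set X) :=
  forall x, (forall e, 0 < e -> exists2 a, A a & dist x a < e) -> A x.

Definition eps (n : nat) : R := n.+1%:R^-1.

Lemma eps_gt0 n : 0 < eps n. Proof. by rewrite invr_gt0. Qed.

Lemma exists_eps (e : R) : 0 < e -> exists n : nat, eps n < e.
Proof.
move=> e0; rewrite /eps; exists (Num.trunc e^-1).
rewrite -[ltRHS]invrK ltf_pV2 ?posrE ?invr_gt0//.
by rewrite truncnS_gt.
Qed.

Lemma ler_eps (m n : nat) : (m <= n)%N -> eps n <= eps m.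
Proof. rewrite /eps; by move=> mn; rewrite lef_pV2 ?posrE// ler_nat. Qed.

(** A sequence z codes x when [d (z k)] is within [eps k] of x for all k. The inequalities are not
    strict, so that codes form a closed set: the centres of a limit code are Cauchy, and their limit
    lies in A. *)
Lemma analytic_closed X (dist : X -> X -> R) d (A : set X) :
  polish_metric dist d -> mclosed dist A -> analytic dist A.
Proof.
move=> [d0 dP dD dC] clA; have [r0 rC rT] := dP.
pose C := [set z : nat -> nat | exists2 x, A x & forall k, dist (d (z k)) x <= eps k].
pose g z := if pselect (C z) is left H then s2val (cid2 H) else d 0%N.
have gA z : C z -> A (g z) by rewrite /g; case: pselect => // H _; case: cid2.
have gd z : C z -> forall k, dist (d (z k)) (g z) <= eps k.
  by rewrite /g; case: pselect => // H _; case: cid2.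
have gg k z z' : C z -> C z' -> agree k.+1 z z' -> dist (g z) (g z') <= eps k + eps k.
  move=> Cz Cz' zz'; have h1 := gd _ Cz k; have h2 := gd _ Cz' k.
  rewrite -(zz' k (ltnSn k)) in h2.
  have h3 := rT (g z) (d (z k)) (g z'); rewrite (rC (g z) (d (z k))) in h3.
  lra.
exists C, g; split.
- move=> z Hz.
  have near k : exists2 x, A x & forall j, (j <= k)%N -> dist (d (z j)) x <= eps j.
    have [z' [x Ax Hx] zz'] := Hz k.+1; exists x => // j jk; rewrite zz'//; exact: Hx.
  have dz i j : (i <= j)%N -> dist (d (z i)) (d (z j)) <= eps i + eps i.
    move=> ij; have [x Ax Hx] := near j.
    have := Hx _ ij; have := Hx _ (leqnn j); have := ler_eps ij.
    by have := rT (d (z i)) x (d (z j)); rewrite (rC x (d (z j))); lra.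
  have [l Hl] : exists l, forall e, 0 < e -> exists N, forall n, (N <= n)%N -> dist (d (z n)) l < e.
    apply: (dC (fun n => d (z n))) => e e0.
    have [N HN] := @exists_eps (e / 4) ltac:(by rewrite divr_gt0).
    exists N => m n Nm Nn; have := dz _ _ Nm; have := dz _ _ Nn.
    by have := rT (d (z m)) (d (z N)) (d (z n)); rewrite (rC (d (z m)) (d (z N))); lra.
  have dl j : dist (d (z j)) l <= eps j.
    apply/ler_addgt0Pr => e e0; have e2 : 0 < e / 3 by rewrite divr_gt0.
    have [N HN] := Hl _ e2; have [M HM] := exists_eps e2.
    set n := maxn j (maxn N M); have [x Ax Hx] := near n.
    have := HN n ltac:(by rewrite /n !leq_max leqnn orbT).
    have := Hx j ltac:(by rewrite /n !leq_max leqnn).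
    have := Hx n (leqnn n).
    have := @ler_eps M n ltac:(by rewrite /n !leq_max leqnn !orbT).
    have := rT (d (z j)) x l; have := rT x (d (z n)) l; rewrite (rC x (d (z n))); lra.
  exists l => //; apply: clA => e e0.
  have [n Hn] := @exists_eps (e / 2) ltac:(by rewrite divr_gt0).
  have [x Ax Hx] := near n; exists x => //.
  have := Hx _ (leqnn n); have := dl n; have := rT l (d (z n)) x; rewrite (rC l (d (z n))); lra.
- move=> z Cz e e0; have [k Hk] := @exists_eps (e / 2) ltac:(by rewrite divr_gt0).
  by exists k.+1 => z' Cz' zz'; have := gg _ _ _ Cz Cz' zz'; lra.
- move=> y; split=> [Ay|[z Cz /d0 <-]]; last exact: gA.
  have /choice[z Hz] : forall k : nat, exists n, dist (d n) y < eps k.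
    by move=> k; apply: dD; exact: eps_gt0.
  have Cz : C z by exists y => // k; apply/ltW/Hz.
  exists z => //; apply: rho_eq0 => // e e0.
  have [k Hk] := @exists_eps (e / 2) ltac:(by rewrite divr_gt0).
  have := gd _ Cz k; have := Hz k; have := rT (g z) (d (z k)) y; rewrite (rC (g z) (d (z k))); lra.
Qed.

Definition dist_prod (T X : Type) (dT : T -> T -> R) (dX : X -> X -> R) (p q : T * X) :=
  dT p.1 q.1 + dX p.2 q.2.

Lemma pmetric_prod (T X : Type) (dT : T -> T -> R) (dX : X -> X -> R) :
  pmetric dT -> pmetric dX -> pmetric (dist_prod dT dX).
Proof.
move=> [a b c] [a' b' c']; split.
- by move=> x; rewrite /dist_prod a a' addr0.
- by move=> x y; rewrite /dist_prod b b'.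
- move=> x y z; rewrite /dist_prod.
  by have := c x.1 y.1 z.1; have := c' x.2 y.2 z.2; lra.
Qed.

Lemma polish_metric_prod (T X : Type) (dT : T -> T -> R) (dX : X -> X -> R) sT sX :
  polish_metric dT sT -> polish_metric dX sX ->
  exists s, polish_metric (dist_prod dT dX) s.
Proof.
move=> [T0 TP TD TC] [X0 XP XD XC].
exists (fun n => if @unpickle (nat * nat)%type n is Some p then (sT p.1, sX p.2) else (sT 0%N, sX 0%N)).
have gT := rho_ge0 TP; have gX := rho_ge0 XP.
split.
- move=> [t x] [t' x']; rewrite /dist_prod /=; split=> [H|[-> ->]].
    have := gT t t'; have := gX x x' => h1 h2.
    have /T0 -> : dT t t' = 0 by lra.
    by have /X0 -> : dX x x' = 0 by lra.
  by case: TP => -> _ _; case: XP => -> _ _; rewrite addr0.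
- exact: pmetric_prod.
- move=> [t x] e e0; have e2 : 0 < e / 2 by rewrite divr_gt0.
  have [m Hm] := TD t _ e2; have [n Hn] := XD x _ e2.
  by exists (pickle (m, n)); rewrite pickleK /dist_prod /=; lra.
- move=> u Hu.
  have [l Hl] : exists l, forall e, 0 < e -> exists N, forall n, (N <= n)%N -> dT (u n).1 l < e.
    apply: (TC (fun n => (u n).1)) => e e0; have [N HN] := Hu e e0; exists N => m n Nm Nn.
    by have := HN _ _ Nm Nn; rewrite /dist_prod; have := gX (u m).2 (u n).2; lra.
  have [l' Hl'] : exists l, forall e, 0 < e -> exists N, forall n, (N <= n)%N -> dX (u n).2 l < e.
    apply: (XC (fun n => (u n).2)) => e e0; have [N HN] := Hu e e0; exists N => m n Nm Nn.
    by have := HN _ _ Nm Nn; rewrite /dist_prod; have := gT (u m).1 (u n).1; lra.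
  exists (l, l') => e e0; have e2 : 0 < e / 2 by rewrite divr_gt0.
  have [N HN] := Hl _ e2; have [M HM] := Hl' _ e2; exists (maxn N M) => n.
  rewrite geq_max => /andP[Nn Mn]; have := HN _ Nn; have := HM _ Mn.
  by rewrite /dist_prod /=; lra.
Qed.

Definition bianalytic (Y : Type) (rho : Y -> Y -> R) (G : set Y) :=
  analytic rho G /\ analytic rho (~` G).

(** The class is symmetric under complement, and countable unions and intersections preserve
    analyticity. Hence Borel sets are analytic together with their complements, which serves both
    values of a label. *)
Lemma sigma_algebra_bianalytic (Y : Type) (rho : Y -> Y -> R) d :
  polish_metric rho d -> sigma_algebra setT (bianalytic rho).
Proof.
move=> rP; have aT : analytic rho setT by apply: (analytic_closed rP).
split.
- by split; [exact: analytic0 (d 0%N)|rewrite setC0].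
- by move=> A [? ?]; rewrite setTD; split => //; rewrite setCK.
- move=> A HA; split; first by apply: analytic_bigcup => i; have [] := HA i.
  rewrite setC_bigcup.
  have -> : \bigcap_i ~` A i = [set y | forall i, (~` A i) y].
    by apply/seteqP; split=> [y H i|y H i _]; [exact: (H i I)|exact: H].
  by apply: (analytic_bigcap (pm_pm rP) 0%N) => i; have [] := HA i.
Qed.

Lemma bianalytic_open (Y Z : Type) (rho : Y -> Y -> R) (dz : Z -> Z -> R) d (p : Y -> Z) (U : set Z) :
  polish_metric rho d -> pmetric dz -> (forall x y, dz (p x) (p y) <= rho x y) ->
  (forall x, U x -> exists2 e : R, 0 < e & forall y, dz x y < e -> U y) ->
  bianalytic rho (p @^-1` U).
Proof.
move=> rP [z0 zC zT] lip oU; split; last first.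
  apply: (analytic_closed rP) => x Hx Ux.
  have [e e0 He] := oU _ Ux; have [a na xa] := Hx e e0.
  by apply: na; apply: He; apply: le_lt_trans (lip _ _) xa.
(* The open set is exhausted by the closed sets of points whose image keeps distance [eps n] from
   the complement. *)
pose F n := [set y | forall z, dz (p y) z < eps n -> U z].
have -> : p @^-1` U = \bigcup_n F n.
  apply/seteqP; split=> [y Uy|y [n _ /(_ (p y))]]; last first.
    by move=> H; apply: H; rewrite z0; exact: eps_gt0.
  have [e e0 He] := oU _ Uy; have [n Hn] := exists_eps e0.
  by exists n => // z yz; apply: He; apply: lt_trans Hn.
apply: analytic_bigcup => n; apply: (analytic_closed rP) => x Hx z xz.
have [a Fa xa] := Hx (eps n - dz (p x) z) ltac:(by rewrite subr_gt0).
apply: Fa; have := lip x a; have := zT (p a) (p x) z; rewrite (zC (p a) (p x)); lra.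
Qed.

End PolishMetric.

Lemma polish_metricP (R : realType) (X : topologicalType) (x0 : X) : polish R X ->
  exists (dist : X -> X -> R) (d : nat -> X), polish_metric dist d /\
    forall A : set X, open A <->
      (forall x, A x -> exists2 e : R, 0 < e & forall y, dist x y < e -> A y).
Proof.
move=> [[D [cD dD]] [dist [d0 deq [dC dT] dO dcomp]]].
have oball x e : open [set y | dist x y < e].
  apply/dO => y /= xy; exists (e - dist x y); first by rewrite subr_gt0.
  by move=> z yz /=; have := dT x y z; lra.
have dnear x e : 0 < e -> exists2 y, D y & dist x y < e.
  move=> e0; have [|y [xy Dy]] := dD [set y | dist x y < e] _ (oball x e).
    by exists x => /=; rewrite (deq x x).2.
  by exists y.
(* The point [x0] rules out an empty dense set, so D is the range of a sequence. *)
have [D0|[f]] := pfcard_geP cD.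
  by have [y] := dnear x0 1 ltr01; rewrite D0.
exists dist, f; split=> //; split=> //.
- by split=> [x|//|//]; apply/deq.
- move=> x e e0; have [y Dy xy] := dnear x e e0.
  by have [n _ fn] := @surj _ _ _ _ f y Dy; exists n; rewrite fn dC.
- move=> u /dcomp[l ul]; exists l => e e0.
  have Bl : nbhs l [set y | dist l y < e].
    by apply: open_nbhs_nbhs; split; [exact: oball|rewrite /= (deq l l).2].
  by have [N _ HN] := ul _ Bl; exists N => n Nn; rewrite dC; exact: HN.
Qed.

(** * Borel sets are bianalytic; analyticity of consistency with a parameter *)

Section Bianalytic.
Variable R : realType.

Lemma bianalyticI (Y : Type) (rho : Y -> Y -> R) d (A B : set Y) :
  polish_metric rho d -> bianalytic rho A -> bianalytic rho B -> bianalytic rho (A `&` B).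
Proof.
move=> rP [aA nA] [aB nB]; split.
  have -> : A `&` B = [set y | forall b : bool, (if b then A else B) y].
    by apply/seteqP; split=> [y [? ?] []//|y H]; split; [exact: (H true)|exact: (H false)].
  by apply: (analytic_bigcap (pm_pm rP) true) => -[].
have -> : ~` (A `&` B) = \bigcup_n (if n is 0%N then ~` A else ~` B).
  rewrite setCI; apply/seteqP; split=> [y [?|?]|y [[|n] _]]; [|by exists 1%N|by left|by right].
  by exists 0%N.
by apply: analytic_bigcup => -[].
Qed.

Lemma bianalytic_borel_preimage (Y : Type) (Z : topologicalType) (rho : Y -> Y -> R)
    (dz : Z -> Z -> R) d (p : Y -> Z) (A : set Z) :
  polish_metric rho d -> pmetric dz -> (forall x y, dz (p x) (p y) <= rho x y) ->
  (forall U : set Z, open U <->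
    (forall x, U x -> exists2 e : R, 0 < e & forall y, dz x y < e -> U y)) ->
  <<s @open Z >> A -> bianalytic rho (p @^-1` A).
Proof.
move=> rP zP lip oP.
have [s0 sC sU] := sigma_algebra_bianalytic rP.
pose F := [set A : set Z | bianalytic rho (p @^-1` A)].
have sF : sigma_algebra setT F.
  split; first by rewrite /F /= preimage_set0.
    by move=> B /sC; rewrite /F /= !setTD preimage_setC.
  by move=> B HB; rewrite /F /= preimage_bigcup; apply: sU => i; exact: HB.
have oF : @open Z `<=` F.
  by move=> U /oP HU; apply: (bianalytic_open rP zP lip).
by move=> /(smallest_sub sF oF).
Qed.

Lemma bianalytic_product_measurable (T X : topologicalType) (dT : T -> T -> R) (dX : X -> X -> R)
    sT sX (G : set (T * X)) :
  polish_metric dT sT -> polish_metric dX sX ->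
  (forall U : set T, open U <->
    (forall x, U x -> exists2 e : R, 0 < e & forall y, dT x y < e -> U y)) ->
  (forall U : set X, open U <->
    (forall x, U x -> exists2 e : R, 0 < e & forall y, dX x y < e -> U y)) ->
  <<s [set S : set (T * X) | exists A B,
           [/\ <<s @open T >> A, <<s @open X >> B & S = A `*` B]] >> G ->
  bianalytic (dist_prod dT dX) G.
Proof.
move=> TP XP oT oX.
have [s sP] := polish_metric_prod TP XP.
apply: (smallest_sub (sigma_algebra_bianalytic sP)) => _ [A [B [mA mB ->]]].
have -> : A `*` B = (fst @^-1` A) `&` (snd @^-1` B) by [].
apply: (bianalyticI sP).
  apply: (bianalytic_borel_preimage sP (pm_pm TP) _ oT mA) => x y.
  by rewrite lerDl rho_ge0//; exact: pm_pm XP.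
apply: (bianalytic_borel_preimage sP (pm_pm XP) _ oX mB) => x y.
by rewrite lerDr rho_ge0//; exact: pm_pm TP.
Qed.

Section Alive.
Variables (X : Type) (dX : X -> X -> R).
Hypothesis XP : pmetric dX.
Hypothesis X0 : forall x y, dX x y = 0 <-> x = y.

(** Tuples of all lengths share the type [nat -> X], at the price of a pseudometric. *)
Definition dist_upto (m : nat) (x x' : nat -> X) : R := \sum_(i < m) dX (x i) (x' i).

Lemma pmetric_upto m : pmetric (dist_upto m).
Proof.
have [a b c] := XP; split.
- by move=> x; rewrite /dist_upto big1// => i _; rewrite a.
- by move=> x y; apply: eq_bigr => i _; rewrite b.
- by move=> x y z; rewrite /dist_upto -big_split /=; apply: ler_sum => i _; exact: c.
Qed.

Lemma dist_upto_le m m' x x' : (m <= m')%N -> dist_upto m x x' <= dist_upto m' x x'.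
Proof.
move=> mm'; rewrite /dist_upto -(subnKC mm') big_split_ord /= lerDl.
by apply: sumr_ge0 => i _; exact: rho_ge0.
Qed.

Lemma dist_upto_eq0 m x x' : dist_upto m x x' = 0 <-> forall i, (i < m)%N -> x i = x' i.
Proof.
split=> [/eqP|H]; last by rewrite /dist_upto big1// => i _; apply/X0/H.
rewrite psumr_eq0; last by move=> i _; exact: rho_ge0.
by move=> /allP H i im; apply/X0/eqP/(H (Ordinal im)); rewrite mem_index_enum.
Qed.

Lemma dist_coord_le m x x' i : (i < m)%N -> dX (x i) (x' i) <= dist_upto m x x'.
Proof.
move=> im; rewrite /dist_upto (bigD1 (Ordinal im))//= lerDl.
by apply: sumr_ge0 => j _; exact: rho_ge0.
Qed.

Definition alive (Theta : Type) (h : Theta -> X -> bool) (l : seq bool) : set (nat -> X) :=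
  [set x | exists t, forall i, (i < size l)%N -> h t (x i) = nth false l i].

(** A code holds, for each i, a witness that a pair (t, x i) receives the i-th label. That all these
    pairs have the same t is a closed condition, and returning only the points projects t away. *)
Lemma analytic_alive (Theta : Type) (dT : Theta -> Theta -> R) (h : Theta -> X -> bool)
    (t0 : Theta) (l : seq bool) :
  (forall x y, dT x y = 0 <-> x = y) -> pmetric dT ->
  (forall b, analytic (dist_prod dT dX) [set p | h p.1 p.2 = b]) ->
  analytic (dist_upto (size l)) (alive h l).
Proof.
move=> T0 TP /choice[C] /choice[g] H.
have [tr tC tT] := TP; have [xr xC xT] := XP.
have PP := pmetric_prod TP XP.
have TgeX p q : dX p.2 q.2 <= dist_prod dT dX p q by rewrite lerDr (rho_ge0 TP).
have TgeT p q : dT p.1 q.1 <= dist_prod dT dX p q by rewrite lerDl (rho_ge0 XP).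
pose m := size l; pose b i := nth false l i.
pose f (i n : nat) : nat := pickle (i, n).
pose G (i : nat) (z : nat -> nat) := g (b i) (z \o f i).
exists [set z : nat -> nat | forall i, (i < m)%N -> C (b i) (z \o f i) /\ (G i z).1 = (G 0%N z).1].
exists (fun (z : nat -> nat) i => (G i z).2); split.
- move=> z Hz.
  have Ci i : (i < m)%N -> C (b i) (z \o f i).
    move=> im; have [cl _ _] := H (b i); apply: cl => k.
    have [K HK] := agree_reindex (f i) k.
    have [z' /(_ i im)[Cz' _] zz'] := Hz K.
    by exists (z' \o f i) => //; apply: HK.
  move=> i im; split; first exact: Ci.
  apply/T0/(rho_eq0 TP) => e e0.
  have e3 : 0 < e / 2 by rewrite divr_gt0.
  have m0 : (0 < m)%N by exact: leq_ltn_trans im.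
  have [_ ci _] := H (b i); have [_ c0 _] := H (b 0%N).
  have [k1 Hk1] := ci _ (Ci _ im) _ e3.
  have [k2 Hk2] := c0 _ (Ci _ m0) _ e3.
  have [K1 HK1] := agree_reindex (f i) k1.
  have [K2 HK2] := agree_reindex (f 0%N) k2.
  have [z' Cz' zz'] := Hz (maxn K1 K2).
  have [C1 C2] := Cz' i im; have [C3 _] := Cz' 0%N m0.
  have h1 := Hk1 _ C1 (HK1 _ _ (agreeW (leq_maxl _ _) zz')).
  have h2 := Hk2 _ C3 (HK2 _ _ (agreeW (leq_maxr _ _) zz')).
  have h3 := tT (G i z).1 (G i z').1 (G 0%N z).1.
  rewrite {2}C2 (tC (G 0%N z').1) in h3.
  have h4 := TgeT (G i z) (G i z'); have h5 := TgeT (G 0%N z) (G 0%N z').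
  rewrite /G in h3 h4 h5 *; lra.
- move=> z Cz e e0.
  have e2 : 0 < e / m.+1%:R by rewrite divr_gt0.
  have /choice[K HK] : forall i : 'I_m, exists k, forall z', C (b i) (z' \o f i) ->
      agree k z z' -> dX (G i z).2 (G i z').2 < e / m.+1%:R.
    move=> i; have [_ c _] := H (b i); have [k Hk] := c _ (Cz i (ltn_ord i)).1 _ e2.
    have [K HK] := agree_reindex (f i) k; exists K => z' Cz' zz'.
    by apply: le_lt_trans (TgeX _ _) _; apply: Hk => //; exact: HK.
  exists (\max_i K i) => z' Cz' zz'.
  apply: (@le_lt_trans _ _ (\sum_(i < m) e / m.+1%:R)).
    apply: ler_sum => i _; apply/ltW/HK; first exact: (Cz' i (ltn_ord i)).1.
    by apply: agreeW zz'; exact: leq_bigmax.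
  rewrite sumr_const card_ord -[X in X *+ _]mulr1 -mulrnAr -mulrA (mulrC _^-1).
  rewrite -[ltRHS]mulr1 ltr_pM2l// ltr_pdivrMr// mul1r.
  by rewrite ltr_nat.
- move=> x; split=> [[t Ht]|[z Cz /dist_upto_eq0 gz]].
    have /choice[u Hu] : forall i, exists z, (i < m)%N -> C (b i) z /\ g (b i) z = (t, x i).
      move=> i; have [im|] := ltnP i m; last by exists id.
      have [_ _ Hi] := H (b i); have [z Cz gz] := (Hi (t, x i)).1 (Ht i im).
      exists z => _; split=> //; move: gz; rewrite /dist_prod /=.
      have := rho_ge0 TP (g (b i) z).1 t; have := rho_ge0 XP (g (b i) z).2 (x i) => h1 h2 h3.
      have /T0 E1 : dT (g (b i) z).1 t = 0 by lra.
      have /X0 E2 : dX (g (b i) z).2 (x i) = 0 by lra.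
      by rewrite -E1 -E2; case: (g _ _).
    pose z j := if @unpickle (nat * nat)%type j is Some p then u p.1 p.2 else 0%N.
    have zf i : z \o f i = u i by apply: funext => n; rewrite /z /f /= pickleK.
    exists z; last by apply/dist_upto_eq0 => i im; rewrite /G zf (Hu i im).2.
    move=> i im; have m0 : (0 < m)%N by exact: leq_ltn_trans im.
    by rewrite /G !zf (Hu _ im).2 (Hu _ m0).2; split=> //; exact: (Hu i im).1.
  (* For the empty list the code yields no parameter, and [t0] serves. *)
  have [m0|m0] := posnP m.
    by exists t0 => i; rewrite -/m m0.
  exists (G 0%N z).1 => i im; have [Ci <-] := Cz i im; rewrite -gz//.
  by have [_ _ Hi] := H (b i); apply/Hi; exists (z \o f i) => //; case: PP.
Qed.

End Alive.

End Bianalytic.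

(** * The game and the Kunen-Martin argument *)

(** The number of points, and of labels, on a path of d levels. *)
Fixpoint tri (d : nat) : nat := if d is d'.+1 then (tri d' + d)%N else 0%N.

Lemma leq_tri d d' : (d <= d')%N -> (tri d <= tri d')%N.
Proof. by elim: d' => [|d' IH]; [rewrite leqn0 => /eqP ->|rewrite leq_eqVlt => /predU1P[-> //|/IH] /=; lia]. Qed.

Definition proper_node (y : seq (seq bool)) :=
  forall k, (k < size y)%N -> size (nth [::] y k) = k.+1.

Lemma proper_rcons u e : proper_node (rcons u e) <-> proper_node u /\ size e = (size u).+1.
Proof.
split=> [H|[H He] k]; last first.
  rewrite size_rcons nth_rcons ltnS leq_eqVlt => /predU1P[->|ku]; first by rewrite ltnn eqxx.
  by rewrite ku H.
split=> [k ku|].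
  by have := H k; rewrite size_rcons nth_rcons ku => ->//; exact: ltnW.
by have := H (size u); rewrite size_rcons nth_rcons ltnn eqxx => ->.
Qed.

Lemma size_flatten_proper y : proper_node y -> size (flatten y) = tri (size y).
Proof.
elim/last_ind: y => // u e IH /proper_rcons[Hu He].
by rewrite flatten_rcons size_cat IH// size_rcons He.
Qed.

Definition node_code (y : seq (seq bool)) (i : nat) : nat := CodeSeq.code (i :: map pickle y).

Lemma size_le_code s : (size s <= CodeSeq.code s)%N.
Proof.
elim: s => // n s IH /=; apply: leq_ltn_trans IH _.
set m := CodeSeq.code s.
have h : (0 < 2 ^ n)%N by rewrite expn_gt0.
by apply: (@leq_trans (1 * m.*2.+1)); [lia|rewrite leq_mul2r h orbT].
Qed.

(** Digits belonging to nodes of depth d + 1 are stored beyond position d + 1, so adding a level to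
    a tree does not change the first d entries of its code. *)
Lemma size_lt_node_code y i : (size y < node_code y i)%N.
Proof. by apply: leq_trans (size_le_code _); rewrite /= size_map. Qed.

Section Game.
Variables (R : realType) (X Theta : Type) (x0 : X) (dX : X -> X -> R) (h : Theta -> X -> bool).
Hypothesis XP : pmetric dX.
Hypothesis X0 : forall x y, dX x y = 0 <-> x = y.
Variables (C : seq bool -> set (nat -> nat)) (g : seq bool -> (nat -> nat) -> nat -> X).
Hypothesis C_closed : forall l, baire_closed (C l).
Hypothesis g_cont : forall l, cont_on (dist_upto dX (size l)) (C l) (g l).
Hypothesis alive_proj : forall l x,
  alive h l x <-> exists2 z, C l z & dist_upto dX (size l) (g l z) x = 0.

Definition node_part (zz : nat -> nat) y : nat -> nat := zz \o node_code y.

(** The witness at y determines all points on the path to y, so a point of the tree is coded once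
    for every node below it. The equalities in [tree_ok] make these copies consistent. *)
Definition node_pt zz y : nat -> X := g (flatten y) (node_part zz y).

(* zz codes one witness of non-emptiness for every node of depth at most d of a VCL tree. *)
Definition tree_ok (d : nat) (zz : nat -> nat) : Prop :=
  [/\ forall y, proper_node y -> (size y <= d)%N -> C (flatten y) (node_part zz y),
      forall u e e' i, proper_node (rcons u e) -> proper_node (rcons u e') -> (size u < d)%N ->
        (i < tri (size u).+1)%N -> node_pt zz (rcons u e) i = node_pt zz (rcons u e') i
    & forall u e i, proper_node (rcons u e) -> (size u < d)%N ->
        (i < tri (size u))%N -> node_pt zz (rcons u e) i = node_pt zz u i].

(** The full code zz may change from one step to the next; only the finite prefixes are nested. This
    puts the relation on the countable type of integer lists. *)
Definition prec (w' w : seq nat) : Prop :=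
  exists zz, [/\ tree_ok (size w') zz, w' = mkseq zz (size w'), w = mkseq zz (size w)
    & size w' = (size w).+1].

Definition alive_list (l : seq (X * bool)) : Prop :=
  exists t, all (fun p => h t p.1 == p.2) l.

(** When [prec] is well founded this is a recursion along it: the adversary, having reached l, can
    answer every descent from w. It compares the game value of l with the rank of w without naming
    either. *)
Inductive active (w : seq nat) (l : seq (X * bool)) : Prop :=
  Active : alive_list l ->
    (forall w', prec w' w -> exists2 xi : seq X, size xi = (size w').+1 &
       forall e, size e = (size w').+1 -> active w' (l ++ zip xi e)) -> active w l.

Definition pre_active (w : seq nat) (l : seq (X * bool)) : Prop :=
  exists2 xi : seq X, size xi = (size w).+1 &
       forall e, size e = (size w).+1 -> active w (l ++ zip xi e).

Lemma activeE w l : active w l <-> alive_list l /\ forall w', prec w' w -> pre_active w' l.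
Proof. by split=> [[]|[]]. Qed.

Lemma node_pt_limit zz (a : nat -> nat -> nat) y1 y2 i :
  (forall k, exists n, agree k zz (a n) /\ [/\ C (flatten y1) (node_part (a n) y1),
     C (flatten y2) (node_part (a n) y2) & node_pt (a n) y1 i = node_pt (a n) y2 i]) ->
  C (flatten y1) (node_part zz y1) -> C (flatten y2) (node_part zz y2) ->
  (i < size (flatten y1))%N -> (i < size (flatten y2))%N ->
  node_pt zz y1 i = node_pt zz y2 i.
Proof.
move=> H C1 C2 i1 i2; apply/X0/(rho_eq0 XP) => e e0.
have [xr xC xT] := XP.
have e3 : 0 < e / 2 by rewrite divr_gt0.
have [k1 Hk1] := g_cont C1 e3; have [k2 Hk2] := g_cont C2 e3.
have [K1 HK1] := agree_reindex (node_code y1) k1.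
have [K2 HK2] := agree_reindex (node_code y2) k2.
have [n [za [C1' C2' E]]] := H (maxn K1 K2).
have h1 := Hk1 _ C1' (HK1 _ _ (agreeW (leq_maxl _ _) za)).
have h2 := Hk2 _ C2' (HK2 _ _ (agreeW (leq_maxr _ _) za)).
have h3 := le_lt_trans (dist_coord_le XP _ _ i1) h1.
have h4 := le_lt_trans (dist_coord_le XP _ _ i2) h2.
have := xT (node_pt zz y1 i) (node_pt (a n) y1 i) (node_pt zz y2 i).
rewrite {2}E (xC (node_pt (a n) y2 i)); move: h3 h4.
rewrite -/(node_pt zz y1) -/(node_pt zz y2) -/(node_pt (a n) y1) -/(node_pt (a n) y2); lra.
Qed.

(** Every clause is a closed condition on the code: membership in the closed sets [C], or equality
    of points depending continuously on the code. *)
Lemma tree_ok_limit zz (a : nat -> nat -> nat) :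
  (forall k, exists n, agree k zz (a n) /\ tree_ok k (a n)) -> forall d, tree_ok d zz.
Proof.
move=> H d.
have CC y : proper_node y -> C (flatten y) (node_part zz y).
  move=> py; apply: C_closed => k.
  have [K HK] := agree_reindex (node_code y) k.
  have [n [za [Ca _ _]]] := H (maxn K (size y)).
  exists (node_part (a n) y); first by apply: Ca => //; exact: leq_maxr.
  by apply: HK; apply: agreeW za; exact: leq_maxl.
split=> [y py _|u e e' i pe pe' _ ilt|u e i pe _ ilt]; first exact: CC.
- apply: (@node_pt_limit zz a) => [k||||]; try exact: CC; last 2 first.
    by rewrite size_flatten_proper// size_rcons.
    by rewrite size_flatten_proper// size_rcons.
  have [n [za [Ca ta _]]] := H (maxn k (size u).+1).
  exists n; split; first by apply: agreeW za; exact: leq_maxl.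
  by split; [apply: Ca; rewrite ?size_rcons ?leq_maxr|apply: Ca; rewrite ?size_rcons ?leq_maxr
    |apply: ta; rewrite ?leq_maxr].
- have [pu se] := (proper_rcons _ _).1 pe.
  apply: (@node_pt_limit zz a) => [k||||]; try exact: CC; last 2 first.
    by rewrite size_flatten_proper// size_rcons; apply: leq_trans ilt _; exact: leq_tri.
    by rewrite size_flatten_proper.
  have [n [za [Ca _ ta]]] := H (maxn k (size u).+1).
  exists n; split; first by apply: agreeW za; exact: leq_maxl.
  by split; [apply: Ca; rewrite ?size_rcons ?leq_maxr|apply: Ca; rewrite ?leq_max// (leqnSn _) orbT
    |apply: ta; rewrite ?leq_maxr].
Qed.

Lemma tree_ok_VCL zz : (forall d, tree_ok d zz) -> has_infinite_VCL_tree (range h).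
Proof.
move=> H.
(* The points at u are the last level stored at a child of u. All children store the same points;
   the child labelled false throughout is taken. *)
exists (fun u i => node_pt zz (rcons u (nseq (size u).+1 false)) (tri (size u) + i)) => n y Hy.
have py m : (m <= n.+1)%N -> proper_node (mkseq y m).
  by move=> mn k; rewrite size_mkseq => km; rewrite nth_mkseq// Hy// -ltnS; exact: leq_trans mn.
have key m : (m <= n.+1)%N -> forall k i, (k < m)%N -> (i <= k)%N ->
    node_pt zz (mkseq y m) (tri k + i) =
      node_pt zz (rcons (mkseq y k) (nseq (size (mkseq y k)).+1 false)) (tri (size (mkseq y k)) + i)
    /\ nth false (flatten (mkseq y m)) (tri k + i) = nth false (y k) i.
  elim: m => // m IH mn k i km ik.
  have E : mkseq y m.+1 = rcons (mkseq y m) (y m) by exact: mkseqS.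
  have pm := py _ mn; rewrite E in pm *.
  have [_ t2 t3] := H m.+1.
  have pm' := py m (ltnW mn).
  have sm := size_flatten_proper pm'; rewrite size_mkseq in sm.
  rewrite flatten_rcons nth_cat sm.
  move: km; rewrite ltnS leq_eqVlt => /predU1P[E'|km].
    rewrite E' in ik *; rewrite size_mkseq; split; last first.
      by rewrite ltnNge leq_addr /= addKn.
    apply: t2; [exact: pm| |by rewrite size_mkseq|by rewrite size_mkseq /= ltn_add2l ltnS].
    by apply/proper_rcons; split=> //; rewrite size_nseq size_mkseq.
  have lt : (tri k + i < tri m)%N.
    by apply: leq_trans (leq_tri km); rewrite /= ltn_add2l ltnS.
  have [IH1 IH2] := IH (ltnW mn) k i km ik.
  by rewrite lt IH2 -IH1; split=> //; apply: t3; rewrite ?size_mkseq.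
have [t1 _ _] := H n.+1.
have Cn := t1 _ (py _ (leqnn _)) ltac:(by rewrite size_mkseq).
have [t Ht] : alive h (flatten (mkseq y n.+1)) (node_pt zz (mkseq y n.+1)).
  by apply/alive_proj; eexists; [exact: Cn|have [-> _ _] := pmetric_upto XP (size (flatten (mkseq y n.+1)))].
exists (h t); first by exists t.
move=> k i kn ik; have [<- <-] := key n.+1 (leqnn _) k i kn ik.
apply: Ht; rewrite size_flatten_proper; last exact: py.
rewrite size_mkseq; apply: (@leq_trans (tri k.+1)); last exact: leq_tri.
by rewrite /= ltn_add2l ltnS.
Qed.

(** Along an infinite descent the prefixes grow into one sequence. Each of its prefixes begins the
    code of a tree of that depth, so by closedness the limit codes a tree of every depth. *)
Lemma wf_prec : ~ has_infinite_VCL_tree (range h) -> well_founded prec.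
Proof.
move=> nV w; apply: contrapT => nw; apply: nV.
have step v : ~ Acc prec v -> exists v', prec v' v /\ ~ Acc prec v'.
  move=> nv; apply: contrapT => H; apply: nv; constructor => v' pv'.
  by apply: contrapT => nv'; apply: H; exists v'.
have /choice[f Hf] : forall v, exists v', ~ Acc prec v -> prec v' v /\ ~ Acc prec v'.
  by move=> v; have [/step[v' ?]|?] := pselect (~ Acc prec v); [exists v'|exists v].
pose s n := iter n f w.
have ns n : ~ Acc prec (s n) by elim: n => //= n IH; exact: (Hf _ IH).2.
have ps n : prec (s n.+1) (s n) by exact: (Hf _ (ns n)).1.
have ss n : size (s n) = (size w + n)%N.
  by elim: n => [|n IH]; rewrite ?addn0//; have [zz [_ _ _ ->]] := ps n; rewrite IH addnS.
(* The list [s i.+1] has more than i entries, and all later lists extend it. *)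
pose zz i := nth 0%N (s i.+1) i.
have snth n i : (i < size (s n))%N -> forall k, nth 0%N (s (n + k)%N) i = nth 0%N (s n) i.
  move=> iz; elim=> [|k <-]; first by rewrite addn0.
  rewrite addnS; have [a [_ -> E _]] := ps (n + k)%N.
  rewrite [in RHS]E !nth_mkseq//; rewrite !ss in iz *; lia.
have zs n i : (i < size (s n))%N -> zz i = nth 0%N (s n) i.
  move=> iz; rewrite /zz -(snth _ _ iz i.+1) (addnC n) snth//; rewrite ss. lia.
have /choice[a Ha] := ps.
apply: (@tree_ok_VCL zz); apply: (@tree_ok_limit _ a) => k; exists k.
have [ta E1 E2 E3] := Ha k; split.
  move=> i ik; have iz : (i < size (s k))%N by rewrite ss; lia.
  by rewrite (zs _ _ iz) E2 nth_mkseq.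
have kle : (k <= size (s k.+1))%N by rewrite ss; lia.
have [t1 t2 t3] := ta; split.
- by move=> y py yk; apply: t1 => //; apply: leq_trans kle.
- by move=> u e e' i pe pe' uk; apply: t2 => //; apply: leq_trans kle.
- by move=> u e i pe uk; apply: t3 => //; apply: leq_trans kle.
Qed.

Definition path_list zz y : seq (X * bool) :=
  zip (mkseq (node_pt zz y) (size (flatten y))) (flatten y).

Lemma nth_alive_list (l : seq (X * bool)) :
  alive_list l -> alive h (unzip2 l) (nth x0 (unzip1 l)).
Proof.
move=> [t /(all_nthP (x0, false)) Ht]; exists t => i; rewrite size_map => il.
by have := Ht i il; rewrite (nth_map (x0, false))// (nth_map (x0, false))// => /eqP.
Qed.

(* The Kunen-Martin argument: a prefix w of the code of a tree bounds the rank of one of its leaves. *)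
Lemma not_all_leaves_pre_active : well_founded prec -> forall w zz,
  tree_ok (size w) zz -> w = mkseq zz (size w) ->
  ~ (forall y, proper_node y -> size y = size w -> pre_active w (path_list zz y)).
Proof.
move=> wf; elim/(well_founded_ind wf) => w IH zz tok Ew Hall.
set d := size w in tok Ew.
have [t1 t2 t3] := tok.
have /choice[xi Hxi] : forall y, exists xi : seq X, proper_node y -> size y = d ->
    size xi = d.+1 /\ forall e, size e = d.+1 -> active w (path_list zz y ++ zip xi e).
  move=> y; have [[py sy]|ny] := pselect (proper_node y /\ size y = d).
    by have [xi ? ?] := Hall y py sy; exists xi.
  by exists [::] => py sy; case: ny.
(* Any answer e to the points [xi u] leaves an active, hence alive, list. Its witness becomes the
   code of the child [rcons u e]; the points it gives do not depend on e. *)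
have /choice[new Hnew] : forall y', exists z, forall u e, y' = rcons u e -> proper_node y' ->
    size u = d -> C (flatten y') z /\
      mkseq (g (flatten y') z) (tri d.+1) = mkseq (node_pt zz u) (tri d) ++ xi u.
  elim/last_ind => [|u e _].
    by exists id => u e /(congr1 size); rewrite size_rcons.
  have [[/proper_rcons[pu se] su]|ny] := pselect (proper_node (rcons u e) /\ size u = d); last first.
    by exists id => u' e' /rcons_inj[<- _] p s; case: ny.
  have [sxi Hact] := Hxi u pu su.
  have [al _] := Hact e ltac:(by rewrite se su).
  have sfu : size (flatten u) = tri d by rewrite size_flatten_proper// su.
  have := nth_alive_list al.
  have -> : unzip2 (path_list zz u ++ zip (xi u) e) = flatten (rcons u e).
    rewrite flatten_rcons /unzip2 map_cat -!/(unzip2 _) /path_list !unzip2_zip//.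
      by rewrite sxi se su.
    by rewrite size_mkseq.
  have -> : unzip1 (path_list zz u ++ zip (xi u) e) = mkseq (node_pt zz u) (tri d) ++ xi u.
    rewrite /unzip1 map_cat -!/(unzip1 _) /path_list sfu !unzip1_zip//.
      by rewrite sxi se su.
    by rewrite size_mkseq sfu.
  move=> /alive_proj[z Cz /(dist_upto_eq0 XP X0) gz].
  exists z => u' e' /rcons_inj[<- _] p s; split=> //.
  have sz : size (mkseq (node_pt zz u) (tri d) ++ xi u) = tri d.+1.
    by rewrite size_cat size_mkseq sxi.
  apply: (@eq_from_nth _ x0); rewrite size_mkseq// => i id'.
  rewrite nth_mkseq//; apply: gz.
  by rewrite size_flatten_proper// size_rcons su.
(* The new witnesses are stored at the nodes of depth d + 1, and zz is kept elsewhere; the test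
   [node_code y i == j] discards integers that do not encode such a node. *)
pose zz' j := if CodeSeq.decode j is i :: q then
  let y := pmap (@unpickle (seq bool)) q in
  if (size y == d.+1) && (node_code y i == j) then new y i else zz j else zz j.
have part y : node_part zz' y = if size y == d.+1 then new y else node_part zz y.
  apply: funext => i; rewrite /node_part /zz' /= {1}/node_code CodeSeq.codeK.
  by rewrite (map_pK pickleK) eqxx andbT; case: ifP.
have ag : agree d zz zz'.
  move=> j jd; rewrite /zz'; case: CodeSeq.decode => // i q /=; case: ifP => // /andP[/eqP sy /eqP cy].
  by have := size_lt_node_code (pmap (@unpickle (seq bool)) q) i; rewrite sy cy; lia.
have pt y : node_pt zz' y = if size y == d.+1 then g (flatten y) (new y) else node_pt zz y.
  by rewrite /node_pt part; case: ifP.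
have tok' : tree_ok d.+1 zz'.
  split.
  - move=> y py; rewrite leq_eqVlt part => /predU1P[sy|sy].
      rewrite sy eqxx; elim/last_ind: y py sy => // u e _ pe /eqP; rewrite size_rcons eqSS => /eqP su.
      by have [] := Hnew _ u e erefl pe su.
    by rewrite (ltn_eqF sy); exact: t1.
  - move=> u e e' i pe pe'; rewrite ltnS leq_eqVlt !pt !size_rcons eqSS => /predU1P[su|su] ilt.
      rewrite su eqxx in ilt *.
      have [_ E1] := Hnew _ u e erefl pe su; have [_ E2] := Hnew _ u e' erefl pe' su.
      have := congr1 (nth x0 ^~ i) (etrans E1 (esym E2)).
      by rewrite /= !nth_mkseq.
    by rewrite (ltn_eqF su); exact: t2.
  - move=> u e i pe; rewrite ltnS leq_eqVlt !pt !size_rcons eqSS => /predU1P[su|su] ilt.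
      rewrite su eqxx (ltn_eqF (ltnSn d)) in ilt *.
      have [_ E1] := Hnew _ u e erefl pe su.
      have := congr1 (nth x0 ^~ i) E1; rewrite /= nth_mkseq; last by rewrite /=; lia.
      by rewrite nth_cat size_mkseq ilt nth_mkseq.
    by rewrite (ltn_eqF su) (ltn_eqF (ltnW su : (size u < d.+1)%N)); exact: t3.
pose w' := mkseq zz' d.+1.
have pw : prec w' w.
  exists zz'; rewrite /w' size_mkseq -/d; split=> //.
  rewrite {1}Ew; apply: (@eq_from_nth _ 0%N); rewrite !size_mkseq// => i id'.
  by rewrite !nth_mkseq// ag.
(* Activity at w gives pre-activity at each predecessor, so all leaves of the extended tree are
   pre-active at w', which the induction hypothesis excludes. *)
apply: (IH w' pw zz'); rewrite /w' ?size_mkseq// => y py sy.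
elim/last_ind: y py sy => // u e _ pe /eqP; rewrite size_rcons eqSS => /eqP su.
have [pu se] := (proper_rcons _ _).1 pe.
have [sxi Hact] := Hxi u pu su.
have [_ E1] := Hnew _ u e erefl pe su.
have -> : path_list zz' (rcons u e) = path_list zz u ++ zip (xi u) e.
  rewrite /path_list size_flatten_proper// size_rcons su pt size_rcons su eqxx E1.
  by rewrite flatten_rcons size_flatten_proper// su zip_cat// size_mkseq size_flatten_proper// su.
have [_ Ha] := Hact e ltac:(by rewrite se su).
exact: Ha.
Qed.

(** Starts the invariant of the learner: the root is the only leaf of a tree of depth 0. *)
Lemma not_pre_active_root (t0 : Theta) : well_founded prec -> ~ pre_active [::] [::].
Proof.
move=> wf.
have /alive_proj[z Cz _] : alive h [::] (fun=> x0) by exists t0.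
pose zz j := if CodeSeq.decode j is i :: _ then z i else 0%N.
have part : node_part zz [::] = z.
  by apply: funext => i; rewrite /node_part /zz /= CodeSeq.codeK.
move=> H; apply: (@not_all_leaves_pre_active wf [::] zz) => //; last first.
  by move=> y _ /size0nil ->.
by split=> // y _; rewrite leqn0 => /nilP ->; rewrite part.
Qed.

End Game.

(** * Universal measurability *)

Section AnalyticActive.
Variables (R : realType) (X Theta : Type) (x0 : X) (dX : X -> X -> R) (h : Theta -> X -> bool).
Hypothesis XP : pmetric dX.
Hypothesis X0 : forall x y, dX x y = 0 <-> x = y.
Hypothesis alive_an : forall l, analytic (dist_upto dX (size l)) (alive h l).
Variables (C : seq bool -> set (nat -> nat)) (g : seq bool -> (nat -> nat) -> nat -> X).
Hypothesis wf_pr : well_founded (prec C g).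

(** Labels are kept discrete: analyticity is proved in the points alone, for each of the countably
    many label lists. *)
Definition labelled (x : nat -> X) (l : seq bool) := zip (mkseq x (size l)) l.

Lemma alive_listP x l : alive_list h (labelled x l) <-> alive h l x.
Proof.
rewrite /labelled; split=> -[t H]; exists t.
  move=> i il; move/(all_nthP (x0, false)): H => /(_ i).
  rewrite size_zip size_mkseq minnn => /(_ il).
  by rewrite nth_zip ?size_mkseq// nth_mkseq// => /eqP.
apply/(all_nthP (x0, false)) => i; rewrite size_zip size_mkseq minnn => il.
by rewrite nth_zip ?size_mkseq// nth_mkseq//; apply/eqP/H.
Qed.
Lemma labelled_cat x x' l e xi :
  (forall i, (i < size l)%N -> x' i = x i) ->
  (forall i, (i < size e)%N -> x' (size l + i)%N = nth x0 xi i) -> size xi = size e ->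
  labelled x l ++ zip xi e = labelled x' (l ++ e).
Proof.
move=> H1 H2 s; rewrite /labelled -zip_cat ?size_mkseq//; congr zip.
apply: (@eq_from_nth _ x0); first by rewrite size_cat !size_mkseq size_cat s.
rewrite size_cat size_mkseq => i il; rewrite nth_mkseq ?size_cat -?s// nth_cat size_mkseq.
case: ltnP => h1; first by rewrite nth_mkseq// H1.
by rewrite -H2 ?subnKC//; rewrite -s; lia.
Qed.

Lemma analytic_pre_active w l :
  (forall l, analytic (dist_upto dX (size l)) [set x | active h C g w (labelled x l)]) ->
  analytic (dist_upto dX (size l)) [set x | pre_active h C g w (labelled x l)].
Proof.
move=> act.
pose k := (size w).+1.
(* Replacing lists of the wrong length by a default lets e range over the whole countable type
   [seq bool]. *)
pose norm (e : seq bool) := if size e == k then e else nseq k false.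
have snorm e : size (norm e) = k.
  by rewrite /norm; case: eqP => // _; rewrite size_nseq.
pose S := [set x | forall e : seq bool, active h C g w (labelled x (l ++ norm e))].
have anS : analytic (dist_upto dX (size l + k)) S.
  apply: (analytic_bigcap (pmetric_upto XP _) [::] (S := fun e => [set x | active h C g w (labelled x (l ++ norm e))])) => e.
  by have := act (l ++ norm e); rewrite size_cat snorm.
have := @analytic_saturate _ _ (dist_upto dX (size l)) _ _ (pmetric_upto XP _) (pmetric_upto XP _)
  (fun x y => dist_upto_le XP x y (leq_addr k (size l))) anS.
congr (analytic _ _); apply/seteqP; split=> x /=.
  move=> [x' Sx' /(dist_upto_eq0 XP X0) E].
  exists (mkseq (fun i => x' (size l + i)%N) k); first by rewrite size_mkseq.
  move=> e se; rewrite (@labelled_cat x x')//; last by rewrite size_mkseq se.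
    by have := Sx' e; rewrite /norm se eqxx.
  by move=> i ie; rewrite nth_mkseq//; rewrite se in ie.
move=> [xi sxi Hxi].
pose x' i := if (i < size l)%N then x i else nth x0 xi (i - size l).
exists x' => [e|]; last first.
  by apply/(dist_upto_eq0 XP X0) => i il; rewrite /x' il.
rewrite -(@labelled_cat x x' l (norm e) xi).
- exact/Hxi/snorm.
- by move=> i il; rewrite /x' il.
- by move=> i il; rewrite /x' ltnNge leq_addr /= addKn.
- by rewrite snorm.
Qed.

(** The predecessors of w form a countable set, so the recursion step is a countable intersection of
    projections. Indices that are not predecessors contribute the aliveness condition again, which
    changes nothing. *)
Lemma analytic_active w l :
  analytic (dist_upto dX (size l)) [set x | active h C g w (labelled x l)].
Proof.
elim/(well_founded_ind wf_pr): w l => w IH l.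
pose S (o : option (seq nat)) := [set x | if o is Some w' then
  (if pselect (prec C g w' w) then pre_active h C g w' (labelled x l) else alive h l x)
  else alive h l x].
have := @analytic_bigcap _ _ _ (pmetric_upto XP (size l)) _ None S.
have -> : [set y | forall i, S i y] = [set x | active h C g w (labelled x l)].
  apply/seteqP; split=> x /=.
    move=> H; apply/activeE; split; first by apply/alive_listP; exact: (H None).
    by move=> w' pw'; have := H (Some w'); rewrite /S /=; case: pselect.
  move=> /activeE[a b] [w'|]; rewrite /S /=; last exact/alive_listP.
  by case: pselect => pw' /=; [exact: b|exact/alive_listP].
apply=> -[w'|]; last exact: alive_an.
rewrite /S; case: pselect => pw' /=; last exact: alive_an.
by apply: analytic_pre_active; exact: IH.
Qed.

End AnalyticActive.

(** * The Souslin operation preserves universal measurability *)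

Section Souslin.
Context (R : realType) d (T : measurableType d).

Definition souslin (F : seq nat -> set T) : set T :=
  [set t | exists z, forall k, F (mkseq z k) t].

Lemma measurable_exists (I : countType) (A : I -> set T) :
  (forall i, measurable (A i)) -> measurable [set t | exists i, A i t].
Proof.
move=> mA.
have -> : [set t | exists i, A i t] = \bigcup_n (if @unpickle I n is Some i then A i else set0).
  apply/seteqP; split=> [t [i Ai]|t [n _]].
    by exists (pickle i) => //; rewrite pickleK.
  by case: unpickle => // i Ai; exists i.
by apply: bigcupT_measurable => n; case: unpickle.
Qed.

Lemma measurable_forall (I : countType) (A : I -> set T) :
  (forall i, measurable (A i)) -> measurable [set t | forall i, A i t].
Proof.
move=> mA.
have -> : [set t | forall i, A i t] = ~` [set t | exists i, (~` A i) t].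
  apply/seteqP; split=> [t H [i]|t H i]; first by apply; exact: H.
  by apply: contrapT => nA; apply: H; exists i.
by apply/measurableC/measurable_exists => i; exact/measurableC.
Qed.

Lemma measurable_cst_prop (Q : Prop) : measurable [set _ : T | Q].
Proof.
have [q|nq] := pselect Q.
  by rewrite (_ : [set _ | Q] = setT)//; apply/seteqP; split.
by rewrite (_ : [set _ | Q] = set0)//; apply/seteqP; split.
Qed.

Variable P : probability T R.
Local Open Scope ereal_scope.

Lemma exists_hull (E : set T) : exists B, [/\ measurable B, E `<=` B
  & forall B', measurable B' -> E `<=` B' -> P B <= P B'].
Proof.
pose V := [set P B | B in [set B | measurable B /\ E `<=` B]].
have V0 : V !=set0 by exists (P setT), setT.
have lb0 : 0 <= ereal_inf V by apply: le_ereal_inf_tmp => _ [B _ <-].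
have fin : ereal_inf V \is a fin_num.
  rewrite ge0_fin_numE//; apply: (@le_lt_trans _ _ (P setT)).
    by apply: ereal_inf_lbound; exists setT.
  by rewrite probability_setT ltry.
have /choice[B HB] : forall n, exists B, [/\ measurable B, E `<=` B & P B <= ereal_inf V + (eps R n)%:E].
  move=> n; have [_ [B [mB EB] <-] lt] := lb_ereal_inf_adherent (eps_gt0 R n) fin.
  by exists B; split=> //; exact: ltW.
have mI : measurable (\bigcap_n B n) by apply: bigcapT_measurable => n; have [] := HB n.
have EI : E `<=` \bigcap_n B n by move=> t Et n _; have [_ + _] := HB n; apply.
exists (\bigcap_n B n); split=> // B' mB' EB'.
apply: (@le_trans _ _ (ereal_inf V)); last by apply: ereal_inf_lbound; exists B'.
apply/lee_addgt0Pr => e e0; have [n Hn] := exists_eps e0.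
have [mB _ le] := HB n.
apply: (@le_trans _ _ (P (B n))).
  by apply: le_measure; rewrite ?inE//; exact: bigcap_inf.
by apply: (le_trans le); rewrite leeD2l// lee_fin ltW.
Qed.

Definition hull E := sval (cid (exists_hull E)).

Lemma measurable_hull E : measurable (hull E).
Proof. by rewrite /hull; case: cid => B []. Qed.

Lemma sub_hull E : E `<=` hull E.
Proof. by rewrite /hull; case: cid => B []. Qed.

Lemma hull_min E B : measurable B -> E `<=` B -> P (hull E) <= P B.
Proof. by rewrite /hull; case: cid => ? [? ? H] /=; exact: H. Qed.

(** Outer measure is continuous along increasing unions: the intersections of all later hulls
    increase, still contain the sets, and have no larger measure than the hulls. *)
Lemma hull_continuous (E : nat -> set T) (e : R) : (0 < e)%R ->
  (forall n, E n `<=` E n.+1) -> exists n, P (hull (\bigcup_n E n)) <= P (hull (E n)) + e%:E.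
Proof.
move=> e0 ndE.
have ndE' m n : (m <= n)%N -> E m `<=` E n.
  by elim: n => [|n IH]; [rewrite leqn0 => /eqP ->|rewrite leq_eqVlt => /predU1P[->//|/IH H]; exact: subset_trans H (ndE n)].
pose B n := \bigcap_k hull (E (n + k)%N).
have mB n : measurable (B n) by apply: bigcapT_measurable => k; exact: measurable_hull.
have ndB : nondecreasing_seq B.
  move=> m n mn; apply/subsetPset => t Bt k _.
  by have := Bt (n - m + k)%N I; rewrite addnA subnKC.
have EB n : E n `<=` B n by move=> t Et k _; apply/sub_hull/(ndE' n) => //; exact: leq_addr.
have mU : measurable (\bigcup_n B n) by exact: bigcupT_measurable.
have le : P (hull (\bigcup_n E n)) <= P (\bigcup_n B n).
  by apply: hull_min => //; apply: subset_bigcup => n _; exact: EB.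
have cv := nondecreasing_cvg_mu (mu := P) mB mU ndB.
have fin A : measurable A -> P A \is a fin_num by move=> ?; exact: fin_num_measure.
apply: contrapT => nE.
have lt n : P (B n) <= P (hull (\bigcup_n E n)) - e%:E.
  rewrite leeBrDr//; apply: ltW; rewrite ltNge; apply/negP => H; apply: nE; exists n.
  apply: (le_trans H); rewrite leeD2r//; apply: le_measure; rewrite ?inE//; first exact: measurable_hull.
  by move=> t /(_ 0%N I); rewrite addn0.
have : P (\bigcup_n B n) <= P (hull (\bigcup_n E n)) - e%:E.
  rewrite -(cvg_lim (@ereal_hausdorff R) cv); apply: lime_le; last exact: nearW.
  by apply/cvg_ex; eexists; exact: cv.
move=> /(le_trans le); rewrite leNgt => /negP; apply.
by rewrite lteBlDr// lteDl ?lte_fin// fin//; exact: measurable_hull.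
Qed.

Variable F : seq nat -> set T.
Hypothesis mF : forall s, measurable (F s).

Let S (b : seq nat) := [set t | exists z, (forall i, (i < size b)%N -> (z i <= nth 0 b i)%N)
  /\ forall k, F (mkseq z k) t].

(** A measurable set containing [S b]: it asks only for a finite branch below the bounds b, not for
    an infinite one. *)
Let K (b : seq nat) := [set t | exists s : seq nat, (size s = size b /\
  forall i, (i < size b)%N -> (nth 0 s i <= nth 0 b i)%N) /\ forall j, (j <= size b)%N -> F (take j s) t].

Let mK b : measurable (K b).
Proof.
apply: measurable_exists => s; apply: measurableI; first exact: measurable_cst_prop.
apply: (@measurable_forall _ (fun j => [set t | (j <= size b)%N -> F (take j s) t])) => j.
have [jb|jb] := boolP (j <= size b)%N.
  by rewrite (_ : [set t | _] = F (take j s))//; apply/seteqP; split=> t //=; apply.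
by rewrite (_ : [set t | _] = setT)//; apply/seteqP; split.
Qed.

Let SK b : S b `<=` K b.
Proof.
move=> t [z [zb zF]]; exists (mkseq z (size b)); split.
  by rewrite size_mkseq; split=> // i ib; rewrite nth_mkseq//; exact: zb.
by move=> j jb; rewrite /mkseq -map_take take_iota (minn_idPl jb); exact: zF.
Qed.

(** Bounded entries make the tree of admissible finite branches finitely branching, so arbitrarily
    long branches yield an infinite one. *)
Let konig (b : nat -> nat) : \bigcap_k K (mkseq b k) `<=` souslin F.
Proof.
move=> t Kt.
pose ext s k := exists s', [/\ size s' = k, take (size s) s' = s,
  forall i, (i < k)%N -> (nth 0 s' i <= b i)%N & forall j, (j <= k)%N -> F (take j s') t].
pose good s := forall k, (size s <= k)%N -> ext s k.
have ext_le s k k' : (size s <= k)%N -> (k <= k')%N -> ext s k' -> ext s k.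
  move=> sk kk' [s' [e1 e2 e3 e4]]; exists (take k s'); split.
  - by rewrite size_takel// e1.
  - by rewrite take_takel.
  - by move=> i ik; rewrite nth_take//; apply: e3; exact: leq_trans kk'.
  - by move=> j jk; rewrite take_takel//; apply: e4; exact: leq_trans kk'.
have good0 : good [::].
  move=> k _; have [s [[]]] := Kt k I; rewrite size_mkseq => e1 e2 e3.
  exists s; split=> //; first by rewrite take0.
  by move=> i ik; have := e2 i ik; rewrite nth_mkseq.
have step s : good s -> exists v, good (rcons s v).
  move=> gs; apply: contrapT => nv.
  have /choice[kv Hkv] : forall v, exists k, (size (rcons s v) <= k)%N /\ ~ ext (rcons s v) k.
    move=> v; apply: contrapT => nk; apply: nv; exists v => k sk.
    by apply: contrapT => ne; apply: nk; exists k.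
  have [M HM] := bounded_on_initial kv (b (size s)).+1.
  have [s' [e1 e2 e3 e4]] := gs (maxn M (size s).+1) ltac:(by rewrite leq_max leqnSn orbT).
  have ss' : (size s < size s')%N by rewrite e1 leq_max leqnn orbT.
  set v := nth 0%N s' (size s).
  have vb : (v < (b (size s)).+1)%N by rewrite ltnS; apply: e3; rewrite -e1.
  have [h1 h2] := Hkv v; apply: h2.
  apply: (@ext_le _ _ (maxn M (size s).+1)) => //.
    by rewrite leq_max (ltnW (HM _ vb)).
  exists s'; split=> //.
  by rewrite size_rcons (take_nth 0%N)// e2.
have /choice[nx Hnx] : forall s, exists v, good s -> good (rcons s v).
  by move=> s; have [/step[v ?]|?] := pselect (good s); [exists v|exists 0%N].
pose s k := iter k (fun s => rcons s (nx s)) [::].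
have gs k : good (s k) by elim: k => //= k; exact: Hnx.
exists (fun i => nx (s i)) => k.
have -> : mkseq (fun i => nx (s i)) k = s k.
  by elim: k => // k IH; rewrite mkseqS IH.
have ssz : size (s k) = k by elim: k => //= k IH; rewrite size_rcons IH.
have [s' [e1 e2 e3 e4]] := gs k k ltac:(by rewrite ssz).
by rewrite -e2 ssz; apply: e4.
Qed.

Lemma souslin_inner (e : R) : (0 < e)%R -> exists B, [/\ measurable B, B `<=` souslin F
  & P (hull (souslin F)) <= P B + e%:E].
Proof.
move=> e0.
(* The bound on the k-th entry is chosen so large that at most e / 2^(k+1) of outer measure is lost;
   the total loss is at most e. *)
have /choice[nx Hnx] : forall p : seq nat * nat, exists n : nat,
    P (hull (S p.1)) <= P (hull (S (rcons p.1 n))) + (e / 2 ^+ p.2.+1)%:E.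
  move=> [b k] /=.
  have -> : S b = \bigcup_n S (rcons b n).
    apply/seteqP; split=> [t [z [zb zF]]|t [n _ [z [zb zF]]]].
      exists (z (size b)) => //; exists z; split=> // i.
      rewrite size_rcons ltnS leq_eqVlt nth_rcons => /predU1P[->|ib]; first by rewrite ltnn eqxx.
      by rewrite ib; exact: zb.
    exists z; split=> // i ib; have := zb i; rewrite size_rcons nth_rcons ib; apply.
    exact: ltnW.
  apply: (hull_continuous (E := fun n => S (rcons b n))).
    by rewrite divr_gt0// exprn_gt0.
  move=> n t [z [zb zF]]; exists z; split=> // i; have := zb i.
  rewrite !size_rcons !nth_rcons => + ib => /(_ ib).
  by case: ltnP => //; case: eqP => // _ _ /leqW.
pose s k := iteri k (fun k s => rcons s (nx (s, k))) [::].
have sE k : s k = mkseq (fun k => nx (s k, k)) k.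
  by elim: k => // k IH; rewrite mkseqS -IH.
pose L := \bigcap_k K (s k).
have mL : measurable L by apply: bigcapT_measurable.
exists L; split=> //.
  rewrite /L; under eq_bigcapr do rewrite sE.
  exact: konig.
have fin A : measurable A -> P A \is a fin_num by move=> ?; exact: fin_num_measure.
have bound k : P (hull (souslin F)) + (e / 2 ^+ k)%:E <= P (K (s k)) + e%:E.
  suff : P (hull (souslin F)) + (e / 2 ^+ k)%:E <= P (hull (S (s k))) + e%:E.
    move=> /le_trans; apply; rewrite leeD2r//; apply: hull_min => //.
  elim: k => [|k IH].
    rewrite expr0 divr1 leeD2r//; apply: hull_min; first exact: measurable_hull.
    by move=> t [z zF]; apply: sub_hull; exists z.
  have := Hnx (s k, k); rewrite /= -/(s k.+1) => h1.
  have h2 := le_trans IH (leeD2r e%:E h1).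
  have E : (e / 2 ^+ k = e / 2 ^+ k.+1 + e / 2 ^+ k.+1)%R.
    by rewrite -mulrDl -mulr2n exprS -[(e *+ 2)%R]mulr_natl -mulf_div divff// mul1r.
  by move: h2; rewrite E EFinD addeA [X in _ <= X]addeAC leeD2rE.
have niK : nonincreasing_seq (fun k => K (s k)).
  apply/nonincreasing_seqP => k; apply/subsetPset => t [q [[sq qb] qF]].
  have ss : size (s k.+1) = (size (s k)).+1 by rewrite /= size_rcons.
  exists (take (size (s k)) q); split.
    rewrite size_takel ?sq ?ss//; split=> // i ik; rewrite nth_take//.
    by have := qb i; rewrite ss /= nth_rcons ik; apply; exact: ltnW.
  by move=> j jk; rewrite take_takel//; apply: qF; rewrite ss; exact: leqW.
have cv := nonincreasing_cvg_mu (mu := P) _ (fun k => mK (s k)) mL niK.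
have {}cv := cv ltac:(by rewrite ltey_eq fin).
rewrite -leeBlDr// /L -(cvg_lim (@ereal_hausdorff R) cv).
apply: lime_ge; first by apply/cvg_ex; eexists; exact: cv.
apply: nearW => k; rewrite leeBlDr//; apply: le_trans (bound k).
by rewrite leeDl// lee_fin divr_ge0// ?exprn_ge0// ltW.
Qed.

Lemma univ_measurable_souslin_at : exists B1 B2 : set T,
  [/\ measurable B1, measurable B2, B1 `<=` souslin F, souslin F `<=` B2 & P (B2 `\` B1) = 0].
Proof.
have /choice[B HB] : forall n, exists B, [/\ measurable B, B `<=` souslin F
  & P (hull (souslin F)) <= P B + (eps R n)%:E].
  by move=> n; exact/souslin_inner/eps_gt0.
have mU : measurable (\bigcup_n B n) by apply: bigcupT_measurable => n; have [] := HB n.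
have sU : \bigcup_n B n `<=` souslin F by apply: bigcup_sub => n _; have [] := HB n.
exists (\bigcup_n B n), (hull (souslin F)); split=> //; [exact: measurable_hull|exact: sub_hull|].
have fin A : measurable A -> P A \is a fin_num by move=> ?; exact: fin_num_measure.
have -> : P (hull (souslin F) `\` \bigcup_n B n) = P (hull (souslin F)) - P (\bigcup_n B n).
  rewrite measureD//; [|exact: measurable_hull|by rewrite ltey_eq fin//; exact: measurable_hull].
  by rewrite setIidr//; exact: subset_trans (@sub_hull _).
suff -> : P (hull (souslin F)) = P (\bigcup_n B n) by rewrite subee// fin.
apply/eqP; rewrite eq_le; apply/andP; split; last first.
  by apply: le_measure; rewrite ?inE//; [exact: measurable_hull|exact: subset_trans (@sub_hull _)].
apply/lee_addgt0Pr => e e0; have [n Hn] := exists_eps e0.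
have [mB _ le] := HB n.
apply: (le_trans le); apply: leeD; last by rewrite lee_fin ltW.
by apply: le_measure; rewrite ?inE//; exact: bigcup_sup.
Qed.

End Souslin.

Section UnivMeasurable.
Variable R : realType.

Lemma univ_measurable_borel d (T : measurableType d) (A : set T) :
  measurable A -> univ_measurable_set R A.
Proof. by move=> mA P; exists A, A; split=> //; rewrite setDv measure0. Qed.

Lemma sigma_algebra_univ_measurable d (T : measurableType d) :
  sigma_algebra setT (@univ_measurable_set R d T).
Proof.
split; first exact/univ_measurable_borel/measurable0.
- move=> A mA P; have [B1 [B2 [m1 m2 s1 s2 e]]] := mA P.
  exists (~` B2), (~` B1); rewrite setTD; split; try exact: measurableC; try exact: subsetC.
  by rewrite setDE setCK setIC -setDE.
- move=> A mA P; have /choice[B1 /choice[B2 H]] := fun n => mA n P.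
  exists (\bigcup_n B1 n), (\bigcup_n B2 n); split.
  + by apply: bigcupT_measurable => n; have [] := H n.
  + by apply: bigcupT_measurable => n; have [] := H n.
  + by apply: subset_bigcup => n _; have [] := H n.
  + by apply: subset_bigcup => n _; have [] := H n.
  have mD n : measurable (B2 n `\` B1 n) by have [? ? _ _ _] := H n; exact: measurableD.
  have [N [mN N0 sN]] := negligible_bigcup (fun n => (negligibleP P (mD n)).2 (let: And5 _ _ _ _ e := H n in e)).
  apply: (subset_measure0 _ mN _ N0).
    by apply: measurableD; apply: bigcupT_measurable => n; have [] := H n.
  move=> t [[n _ B2t] nB1]; apply: sN; exists n => //; split=> // B1t; apply: nB1; by exists n.
Qed.

Lemma univ_measurable_preimage d d' (T : measurableType d) (T' : measurableType d')
    (f : T -> T') (A : set T') :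
  measurable_fun setT f -> univ_measurable_set R A -> univ_measurable_set R (f @^-1` A).
Proof.
move=> mf mA P.
have mpre B : measurable B -> measurable (f @^-1` B).
  by move=> mB; rewrite -[_ @^-1` _]setTI; exact: mf.
pose f' : {mfun T >-> T'} := HB.pack f (isMeasurableFun.Build _ _ _ _ f mf).
have [B1 [B2 [m1 m2 s1 s2 e]]] := mA (distribution P f').
exists (f @^-1` B1), (f @^-1` B2); split.
- exact: mpre.
- exact: mpre.
- by move=> t /s1.
- by move=> t /s2.
- exact: e.
Qed.
End UnivMeasurable.

(** * The sigma-algebra on lists of samples; analytic sets are measurable there *)

Section ListMeasurable.
Variables (R : realType) (X : ptopologicalType).

Definition sample := (borel X * bool)%type.

Definition sample0 : sample := (point, false).

(* Lists are given the sigma-algebra of the sets whose trace on the lists of each length is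
   universally measurable, so that the library's measurable functions on them are the universally
   measurable ones. *)
Definition usample (R : realType) := seq sample.

Definition list_univ_measurable (A : set (usample R)) :=
  forall n, univ_measurable_set R [set t : n.-tuple (borel X * bool)%type | A (tval t)].

Let um0 : list_univ_measurable set0.
Proof. by move=> n; have [H _ _] := sigma_algebra_univ_measurable R (n.-tuple (borel X * bool)%type). Qed.

Let umC A : list_univ_measurable A -> list_univ_measurable (~` A).
Proof.
move=> mA n; have [_ H _] := sigma_algebra_univ_measurable R (n.-tuple (borel X * bool)%type).
by have := H _ (mA n); rewrite setTD.
Qed.

Let umU (F : (set (usample R))^nat) :
  (forall i, list_univ_measurable (F i)) -> list_univ_measurable (\bigcup_i F i).
Proof.
move=> mF n; have [_ _ H] := sigma_algebra_univ_measurable R (n.-tuple (borel X * bool)%type).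
by have := H _ (fun i => mF i n); congr univ_measurable_set.
Qed.

Fact usample_display : measure_display. Proof. exact: (default_measure_display). Qed.

HB.instance Definition _ := Choice.on (usample R).
HB.instance Definition _ := isPointed.Build (usample R) [::].
HB.instance Definition _ := @isMeasurable.Build usample_display (usample R)
  list_univ_measurable um0 umC umU.

End ListMeasurable.

Section ListMeasurableTheory.
Variables (R : realType) (X : ptopologicalType).
Local Notation Z := (sample X).
Local Notation U := (usample X R).
Local Notation z0 := (sample0 X).

Lemma measurable_usampleE (A : set U) : measurable A = list_univ_measurable A.
Proof. by []. Qed.

Lemma univ_measurable_list d (T : measurableType d) (psi : T -> seq Z) m (A : set U) :
  (forall t, size (psi t) = m) ->
  (forall i, (i < m)%N -> measurable_fun setT (fun t => nth z0 (psi t) i)) ->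
  measurable A -> univ_measurable_set R (psi @^-1` A).
Proof.
move=> sz mpsi mA.
pose f t := [tuple nth z0 (psi t) i | i < m].
have fE t : tval (f t) = psi t.
  apply: (@eq_from_nth _ z0); first by rewrite size_tuple sz.
  rewrite size_tuple => i im; rewrite -[i]/(nat_of_ord (Ordinal im)) -tnth_nth.
  by rewrite tnth_mktuple.
have mf : measurable_fun setT f.
  apply/measurable_fun_tnthP => i.
  rewrite (_ : _ \o f = fun t => nth z0 (psi t) i); first exact: mpsi.
  by apply: funext => t /=; rewrite tnth_mktuple.
have -> : psi @^-1` A = f @^-1` [set t : m.-tuple Z | A (tval t)].
  by apply/seteqP; split=> t /=; rewrite fE.
exact: (univ_measurable_preimage mf (mA m)).
Qed.

(* The length of the image only depends on the length of the list, e.g. for [take], [drop], [mask]. *)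
Definition list_map (phi : seq Z -> seq Z) := forall n, exists m,
  (forall s, size s = n -> size (phi s) = m) /\
  forall i, (i < m)%N -> measurable_fun setT (fun t : n.-tuple Z => nth z0 (phi t) i).

Lemma measurable_list_map (phi : U -> U) : list_map phi -> measurable_fun setT phi.
Proof.
move=> Hphi _ A mA; rewrite setTI measurable_usampleE => n; have [m [sz mphi]] := Hphi n.
apply: (@univ_measurable_list _ _ (fun t : n.-tuple Z => phi t) m) => // t.
by apply: sz; rewrite size_tuple.
Qed.

Lemma measurable_nth n i : (i < n)%N -> measurable_fun setT (fun t : n.-tuple Z => nth z0 t i).
Proof.
move=> ilt; rewrite (_ : (fun _ => _) = (@tnth _ _ ^~ (Ordinal ilt))); first exact: measurable_tnth.
by apply: funext => t; rewrite (tnth_nth z0).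
Qed.

Variables (dX : X -> X -> R) (d : nat -> X).
Hypothesis XPm : polish_metric dX d.
Hypothesis openX : forall A : set X, open A <->
  (forall x, A x -> exists2 e : R, 0 < e & forall y, dX x y < e -> A y).

Lemma measurable_ball n i c (e : R) : (i < n)%N ->
  measurable [set t : n.-tuple Z | dX (nth z0 t i).1 c < e].
Proof.
move=> ilt; have [_ rC rT] := pm_pm XPm.
have mf : measurable_fun setT (fun t : n.-tuple Z => (nth z0 t i).1).
  exact: (measurableT_comp (@measurable_fst _ _ _ _) (measurable_nth ilt)).
rewrite -[X in measurable X]setTI; apply: (mf _ [set x : borel X | dX x c < e]) => //.
apply: sub_sigma_algebra; apply/openX => x /= xc; exists (e - dX x c); first by rewrite subr_gt0.
by move=> y xy /=; have := rT y x c; rewrite (rC y x); lra.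
Qed.

(** [F s] is the closure of the image of the codes extending s, written with dense points to be
    visibly Borel. If t lies in F along z, then z is in the closed set C, and its image is t by
    continuity. *)
Lemma univ_measurable_analytic m (S : set (nat -> X)) : analytic (dist_upto dX m) S ->
  univ_measurable_set R [set t : m.-tuple Z | S (fun i => (nth z0 t i).1)].
Proof.
move=> [C [g [clC cg HS]]] P.
have [rr rC rT] := pm_pm XPm.
pose F (s : seq nat) := [set t : m.-tuple Z | forall k : nat, exists c : seq nat,
  (exists z, [/\ C z, agree (size s) (nth 0%N s) z
     & forall i, (i < m)%N -> dX (g z i) (d (nth 0%N c i)) < eps R k]) /\
  forall i, (i < m)%N -> dX (nth z0 t i).1 (d (nth 0%N c i)) < eps R k].
have mF s : measurable (F s).
  apply: measurable_forall => k; apply: measurable_exists => c.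
  apply: measurableI; first exact: measurable_cst_prop.
  apply: (@measurable_forall _ _ _ (fun i => [set t : m.-tuple Z | (i < m)%N ->
    dX (nth z0 t i).1 (d (nth 0%N c i)) < eps R k])) => i.
  have [im|im] := boolP (i < m)%N.
    rewrite (_ : [set t | _] = [set t : m.-tuple Z | dX (nth z0 t i).1 (d (nth 0%N c i)) < eps R k]).
      exact: measurable_ball.
    by apply/seteqP; split=> t //=; apply.
  by rewrite (_ : [set t | _] = setT)//; apply/seteqP; split.
suff -> : [set t : m.-tuple Z | S (fun i => (nth z0 t i).1)] = souslin F.
  exact: univ_measurable_souslin_at.
apply/seteqP; split=> t.
  move=> /HS[z Cz gz]; exists z => k k'.
  have /choice[c Hc] : forall i, exists n : nat, dX (nth z0 t i).1 (d n) < eps R k'.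
    by move=> i; have [n] := pm_dense XPm (nth z0 t i).1 (eps_gt0 R k'); exists n; rewrite rC.
  exists (mkseq c m); split; last by move=> i im; rewrite nth_mkseq.
  exists z; split=> //; first by move=> i; rewrite size_mkseq => ik; rewrite nth_mkseq.
  move=> i im; rewrite nth_mkseq//.
  by rewrite ((dist_upto_eq0 (pm_pm XPm) (pm_eq0 XPm) _ _ _).1 gz i im).
move=> [z Hz].
have near k k' : exists z', [/\ C z', agree k z z' & forall i, (i < m)%N ->
    dX (g z' i) (nth z0 t i).1 < eps R k' + eps R k'].
  have [c [[z' [Cz' az' Hz']] Hc]] := Hz k k'; exists z'; split=> //.
    by move=> i ik; rewrite -az' ?size_mkseq// nth_mkseq.
  move=> i im; have h1 := Hz' i im; have h2 := Hc i im.
  by have := rT (g z' i) (d (nth 0%N c i)) (nth z0 t i).1; rewrite (rC (d _)); lra.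
have Cz : C z by apply: clC => k; have [z' [? ? _]] := near k 0%N; exists z'.
apply/HS; exists z => //; apply/(dist_upto_eq0 (pm_pm XPm) (pm_eq0 XPm)) => i im.
apply/(pm_eq0 XPm)/(rho_eq0 (pm_pm XPm)) => e e0.
have e2 : 0 < e / 3 by rewrite divr_gt0.
have [k Hk] := cg z Cz _ e2; have [k' Hk'] := exists_eps e2.
have [z' [Cz' az' Hz']] := near k k'.
have h1 := le_lt_trans (dist_coord_le (pm_pm XPm) _ _ im) (Hk _ Cz' az').
have h2 := Hz' i im.
by have := rT (g z i) (g z' i) (nth z0 t i).1; lra.
Qed.

Lemma measurable_analytic_list (Q : seq Z -> Prop) :
  (forall l : seq bool, analytic (dist_upto dX (size l)) [set x | Q (@labelled X x l)]) ->
  measurable [set s : U | Q s].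
Proof.
move=> HQ.
have -> : [set s : U | Q s] = [set s : U | exists l : seq bool,
    [set s : U | unzip2 s = l /\ Q (@labelled X (fun i => (nth z0 s i).1) l)] s].
  have E (s : U) : @labelled X (fun i => (nth z0 s i).1) (unzip2 s) = s.
    apply: (@eq_from_nth _ z0); rewrite size_zip size_mkseq size_map minnn// => i il.
    rewrite nth_zip ?size_mkseq ?size_map// nth_mkseq ?size_map// (nth_map z0)//.
    by case: (nth _ _ _).
  apply/seteqP; split=> s /=; first by move=> Qs; exists (unzip2 s); rewrite E.
  by move=> [_ [<-]]; rewrite E.
apply: measurable_exists => l; rewrite measurable_usampleE => n.
have [E|nl] := eqVneq n (size l); last first.
  rewrite (_ : [set t : n.-tuple _ | _] = set0); first exact/univ_measurable_borel/measurable0.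
  by apply/seteqP; split=> t //= -[El _]; move: nl; rewrite -El size_map size_tuple eqxx.
rewrite E => {n E}; set n := size l.
have mA : measurable [set t : n.-tuple Z | unzip2 t = l].
  have -> : [set t : n.-tuple Z | unzip2 t = l] =
      [set t : n.-tuple Z | forall i : 'I_n, (tnth t i).2 = nth false l i].
    apply/seteqP; split=> t /=.
      by move=> <- i; rewrite (nth_map z0) ?size_tuple// -tnth_nth.
    move=> H; apply: (@eq_from_nth _ false); rewrite size_map size_tuple// => i il.
    by rewrite (nth_map z0) ?size_tuple// -(H (Ordinal il)) (tnth_nth z0).
  apply: (@measurable_forall _ _ _ (fun i : 'I_n => [set t : n.-tuple Z | (tnth t i).2 = nth false l i])) => i.
  have mf : measurable_fun setT (fun t : n.-tuple Z => (tnth t i).2).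
    exact: (measurableT_comp (@measurable_snd _ _ _ _) (@measurable_tnth _ _ _ i)).
  by rewrite -[X in measurable X]setTI; exact: (mf _ [set nth false l i]).
move=> P.
have [A1 [A2 [? ? s1 s2 eA]]] := univ_measurable_borel mA P.
have [B1 [B2 [? ? s3 s4 eB]]] := univ_measurable_analytic (HQ l) P.
exists (A1 `&` B1), (A2 `&` B2); split; try exact: measurableI.
- by move=> t [/s1 ? /s3 ?].
- by move=> t [/s2 ? /s4 ?].
apply: (subset_measure0 (B := (A2 `\` A1) `|` (B2 `\` B1))).
- by apply: measurableD; exact: measurableI.
- by apply: measurableU; exact: measurableD.
- move=> t [[a2 b2] n12]; have [a1|?] := pselect (A1 t); last by left.
  by right; split=> // b1; apply: n12.
- apply/eqP; rewrite eq_le measure_ge0 andbT.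
  apply: (le_trans (measureU2 _ _ _)); try exact: measurableD.
  by change ((P (A2 `\` A1) + P (B2 `\` B1) <= 0)%E); rewrite eA eB adde0.
Qed.

End ListMeasurableTheory.

(** * Integration of universally measurable functions *)

Section NonnegIntegral.
Context (R : realType) d (T : measurableType d).
Local Open Scope ereal_scope.

Import HBNNSimple.

(** For an arbitrary nonnegative function the integral is the supremum over the simple functions
    below it, which makes it monotone. *)
Lemma le_integral_nonneg (mu : {measure set T -> \bar R}) (f g : T -> \bar R) :
  (forall x, 0 <= f x) -> (forall x, f x <= g x) -> \int[mu]_x f x <= \int[mu]_x g x.
Proof.
move=> f0 fg; rewrite !ge0_integralTE//; last by move=> x; exact: le_trans (fg x).
apply: ereal_sup_le => _ [h hf <-]; exists h => // x.
exact: le_trans (hf x) (fg x).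
Qed.

(* Measurable for the completion; g can always be cut down to lie below f. *)
Definition almost_borel (P : probability T R) (f : T -> \bar R) := exists (g : T -> \bar R) (N : set T),
  [/\ measurable_fun setT g, forall x, 0 <= g x <= f x, measurable N, P N = 0
    & forall x, ~ N x -> f x = g x].

Lemma almost_borelP (P : probability T R) (f g : T -> \bar R) N :
  (forall x, 0 <= f x) -> measurable_fun setT g -> measurable N -> P N = 0 ->
  (forall x, ~ N x -> f x = g x) -> almost_borel P f.
Proof.
move=> f0 mg mN N0 fg; exists (g \_ (~` N)), N; split=> //.
- apply/(measurable_restrictT _ _).1; first exact: measurableC.
  exact: measurable_funS mg.
- move=> x; rewrite patchE; case: ifPn; last by rewrite lexx f0.
  by rewrite inE /= => Nx; rewrite -fg// f0 lexx.
- by move=> x Nx; rewrite patchE mem_set//; exact: fg.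
Qed.

(** The function f is arbitrary on N. It is squeezed between modifications of g with values 0 and
    +oo on N, which are measurable and have the integral of g. *)
Lemma ae_integral (P : probability T R) (f g : T -> \bar R) N :
  (forall x, 0 <= f x) -> (forall x, 0 <= g x) -> measurable_fun setT g -> measurable N -> P N = 0 ->
  (forall x, ~ N x -> f x = g x) -> \int[P]_x f x = \int[P]_x g x.
Proof.
move=> f0 g0 mg mN N0 fg.
pose lo := g \_ (~` N); pose hi x := if x \in N then +oo else g x.
have mlo : measurable_fun setT lo.
  apply/(measurable_restrictT _ _).1; first exact: measurableC.
  exact: measurable_funS mg.
have mhi : measurable_fun setT hi.
  apply: measurable_fun_ifT => //; apply: (measurable_fun_bool true).
  rewrite setTI (_ : _ @^-1` _ = N)//; apply/seteqP; split=> x /=; [exact: set_mem|exact: mem_set].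
have lo0 x : 0 <= lo x by rewrite /lo patchE; case: ifP.
have hi0 x : 0 <= hi x by rewrite /hi; case: ifP.
have E h : (forall x, 0 <= h x) -> measurable_fun setT h -> (forall x, ~ N x -> h x = g x) ->
    \int[P]_x h x = \int[P]_x g x.
  move=> h0 mh hg; apply: ge0_ae_eq_integral => //; exists N; split=> // x /= nx.
  by apply: contrapT => Nx; apply: nx => _; exact: hg.
apply/eqP; rewrite eq_le; apply/andP; split.
- rewrite -(E hi)//; last by move=> x Nx; rewrite /hi memNset.
  apply: le_integral_nonneg => // x; rewrite /hi; case: ifPn; first by rewrite leey.
  by rewrite notin_setE => /fg ->.
- rewrite -(E lo)//; last by move=> x Nx; rewrite /lo patchE mem_set.
  apply: le_integral_nonneg => // x; rewrite /lo patchE; case: ifPn => //.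
  by rewrite inE => /= /fg ->.
Qed.

Lemma univ_measurable_almost_borel (f : T -> \bar R) (Y : set (\bar R)) :
  (forall P, almost_borel P f) -> measurable Y -> univ_measurable_set R (f @^-1` Y).
Proof.
move=> H mY P; have [g [N [mg g0 mN N0 fg]]] := H P.
have mgY : measurable (g @^-1` Y) by rewrite -[X in measurable X]setTI; exact: mg.
exists (g @^-1` Y `\` N), (g @^-1` Y `|` N); split.
- exact: measurableD.
- exact: measurableU.
- by move=> x [gx Nx] /=; rewrite fg.
- move=> x /= fx; have [|Nx] := pselect (N x); first by right.
  by left; rewrite /= -fg.
apply: (subset_measure0 _ mN _ N0); first by apply: measurableD; [exact: measurableU|exact: measurableD].
by move=> x [[gx|//] nx]; apply: contrapT => Nx; apply: nx.
Qed.

Lemma almost_borel_univ_measurable (P : probability T R) (f : T -> \bar R) :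
  (forall x, 0 <= f x) ->
  (forall Y : set (\bar R), measurable Y -> univ_measurable_set R (f @^-1` Y)) -> almost_borel P f.
Proof.
move=> f0 mf.
have /choice[B1 /choice[B2 HB]] : forall q : rat, exists B1 B2, [/\ measurable B1, measurable B2,
   B1 `<=` [set x | (ratr q)%:E < f x], [set x | (ratr q)%:E < f x] `<=` B2 & P (B2 `\` B1) = 0].
  move=> q; have mY : measurable [set y : \bar R | (ratr q)%:E < y].
    rewrite (_ : mkset _ = `](ratr q : R)%:E, +oo[%classic); first exact: emeasurable_itv.
    by apply/seteqP; split=> x /=; rewrite in_itv /= andbT.
  exact: (mf _ mY P).
(* On the inner approximation [B1 q] of the set f > q, the value q is a lower bound for f. Off the
   null gaps between [B1 q] and [B2 q], the supremum over all rationals recovers f. *)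
pose G n x : \bar R := if @unpickle rat n is Some q then
  (if (x \in B1 q) && (0 <= q)%R then (ratr q)%:E else 0) else 0.
have mG n : measurable_fun setT (G n).
  rewrite /G; case: unpickle => [q|]; last exact: measurable_cst.
  apply: measurable_fun_ifT => //; apply: measurable_and => //.
  apply: (measurable_fun_bool true); rewrite setTI (_ : _ @^-1` _ = B1 q)//; first by have [] := HB q.
  by apply/seteqP; split=> x /=; [exact: set_mem|exact: mem_set].
pose N := \bigcup_n (if @unpickle rat n is Some q then B2 q `\` B1 q else set0).
have mN' n : measurable (if @unpickle rat n is Some q then B2 q `\` B1 q else set0).
  by case: unpickle => // q; have [? ? _ _ _] := HB q; exact: measurableD.
have mN : measurable N by exact: bigcupT_measurable.
have N0 : P N = 0.
  apply/(negligibleP P mN)/negligible_bigcup => n; apply/(negligibleP P (mN' n)).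
  by case: unpickle => [q|]; [have [] := HB q|rewrite measure0].
apply: (@almost_borelP P f (fun x => ereal_sup [set G n x | n in setT]) N) => //.
  have := measurable_fun_esups mG 0%N; congr measurable_fun; apply: funext => x.
  by rewrite /esups /sdrop; congr ereal_sup; apply/seteqP; split=> y [n _ <-]; exists n.
move=> x Nx.
have B12 q : B2 q x -> B1 q x.
  by move=> b2; apply: contrapT => b1; apply: Nx; exists (pickle q); [exact: I|rewrite pickleK].
apply/eqP; rewrite eq_le; apply/andP; split; last first.
  apply: ge_ereal_sup => _ [n _ <-]; rewrite /G; case: unpickle => // q.
  by case: ifP => // /andP[]; rewrite inE => b1 _; have [_ _ + _ _] := HB q => /(_ _ b1) /ltW.
rewrite leNgt; apply/negP => lt.
have sup0 : 0 <= ereal_sup [set G n x | n in setT].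
  apply: (@le_trans _ _ (G 0%N x)); last by apply: ereal_sup_ubound; exists 0%N.
  by rewrite /G; case: unpickle => // q; case: ifP => // /andP[_ q0]; rewrite lee_fin ler0q.
have [q /andP[q1 q2]] : exists q : rat, ereal_sup [set G n x | n in setT] < (ratr q)%:E < f x.
  case: (ereal_sup _) sup0 lt => [a||] a0 lt; [|by rewrite ltNge leey in lt|by rewrite leeNy_eq in a0].
  have [b /andP[ab bf]] : exists b : R, (a < b)%R && (b%:E < f x).
    case: (f x) lt => [c|_|]; [|by exists (a + 1)%R; rewrite ltrDl ltr01 ltry|by rewrite ltNge leNye].
    by rewrite lte_fin => ac; exists ((a + c) / 2)%R; rewrite lte_fin; apply/andP; split; lra.
  have [q] := rat_in_itvoo ab; rewrite in_itv /= => /andP[aq qb].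
  by exists q; rewrite lte_fin aq; apply: lt_trans bf; rewrite lte_fin.
have q0 := le_lt_trans sup0 q1.
move: q1; rewrite ltNge => /negP; apply; apply: ereal_sup_ubound; exists (pickle q) => //.
rewrite /G pickleK ifT//; apply/andP; split.
  by rewrite inE; apply: B12; have [_ _ _ + _] := HB q; apply.
by move: q0; rewrite lte_fin ltr0q => /ltW.
Qed.

End NonnegIntegral.

Section AlmostBorelIntegral.
Context (R : realType) d (T : measurableType d) (P : probability T R).
Local Open Scope ereal_scope.

Lemma almost_borel_integralD (f1 f2 : T -> \bar R) : almost_borel P f1 -> almost_borel P f2 ->
  \int[P]_x (f1 x + f2 x) = \int[P]_x f1 x + \int[P]_x f2 x.
Proof.
move=> [g1 [N1 [mg1 g10 mN1 P1 E1]]] [g2 [N2 [mg2 g20 mN2 P2 E2]]].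
have g1p x : 0 <= g1 x by have /andP[] := g10 x.
have g2p x : 0 <= g2 x by have /andP[] := g20 x.
have f1p x : 0 <= f1 x by have /andP[] := g10 x; exact: le_trans.
have f2p x : 0 <= f2 x by have /andP[] := g20 x; exact: le_trans.
rewrite (ae_integral f1p g1p mg1 mN1 P1 E1) (ae_integral f2p g2p mg2 mN2 P2 E2).
rewrite -ge0_integralD//; apply: (@ae_integral _ _ _ _ _ _ (N1 `|` N2)).
- by move=> x; exact: adde_ge0.
- by move=> x; exact: adde_ge0.
- exact: emeasurable_funD.
- exact: measurableU.
- exact: null_set_setU.
- by move=> x Nx; rewrite E1 ?E2// => H; apply: Nx; [right|left].
Qed.


Lemma almost_borel_integralZl (k : \bar R) (f : T -> \bar R) : 0 <= k -> almost_borel P f ->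
  \int[P]_x (k * f x) = k * \int[P]_x f x.
Proof.
move=> k0 [g [N [mg g0 mN PN E]]].
have gp x : 0 <= g x by have /andP[] := g0 x.
have fp x : 0 <= f x by have /andP[] := g0 x; exact: le_trans.
rewrite (ae_integral fp gp mg mN PN E) -ge0_integralZl//; apply: (ae_integral _ _ _ mN PN).
- by move=> x; exact: mule_ge0.
- by move=> x; exact: mule_ge0.
- exact: measurable_funeM.
- by move=> x Nx; rewrite E.
Qed.

Lemma measurable_ereal_sup_seq (g : nat -> T -> \bar R) : (forall n, measurable_fun setT (g n)) ->
  measurable_fun setT (fun x => ereal_sup (range (g^~ x))).
Proof.
move=> mg; have := measurable_fun_esups mg 0%N; congr measurable_fun; apply: funext => x.
by rewrite /esups /sdrop; congr ereal_sup; apply/seteqP; split=> y [n _ <-]; exists n.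
Qed.

Lemma ge0_ereal_sup_seq (u : nat -> \bar R) : (forall n, 0 <= u n) -> 0 <= ereal_sup (range u).
Proof. by move=> u0; apply: (le_trans (u0 0%N)); apply: ereal_sup_ubound; exists 0%N. Qed.

Lemma limn_ereal_sup (u : nat -> \bar R) : (forall m n, (m <= n)%N -> u m <= u n) ->
  limn u = ereal_sup (range u).
Proof. by move=> ndu; apply: (cvg_lim (@ereal_hausdorff R)); exact: ereal_nondecreasing_cvgn. Qed.

Lemma almost_borel_monotone_convergence (f : nat -> T -> \bar R) :
  (forall n, almost_borel P (f n)) -> (forall x m n, (m <= n)%N -> f m x <= f n x) ->
  \int[P]_x ereal_sup (range (f^~ x)) = ereal_sup (range (fun n => \int[P]_x f n x)).
Proof.
move=> /choice[g /choice[N H]] nd.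
have gp n x : 0 <= g n x by have [_ /(_ x)/andP[]] := H n.
have fp n x : 0 <= f n x by have [_ /(_ x)/andP[]] := H n; move=> /le_trans h /h.
pose M := \bigcup_n N n.
have mNn n : measurable (N n) by have [] := H n.
have mM : measurable M by exact: bigcupT_measurable.
have M0 : P M = 0.
  apply/(negligibleP P mM)/negligible_bigcup => n; apply/(negligibleP P (mNn n)).
  by have [] := H n.
pose g' n := g n \_ (~` M).
have mg' n : measurable_fun setT (g' n).
  apply/(measurable_restrictT _ _).1; first exact: measurableC.
  by have [mg _ _ _ _] := H n; exact: measurable_funS mg.
have g'p n x : 0 <= g' n x by rewrite /g' patchE; case: ifP.
have g'E n x : ~ M x -> f n x = g' n x.
  move=> Mx; rewrite /g' patchE mem_set//; have [_ _ _ _] := H n; apply => Nx.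
  by apply: Mx; exists n.
have nd' x m n : (m <= n)%N -> g' m x <= g' n x.
  move=> mn; have [Mx|Mx] := pselect (M x); last by rewrite -!g'E// nd.
  by rewrite /g' !patchE memNset// => /(_ Mx).
rewrite (@ae_integral _ _ _ P _ (fun x => ereal_sup (range (g'^~ x))) M)//.
- have -> : (fun n => \int[P]_x f n x) = (fun n => \int[P]_x g' n x).
    by apply: funext => n; apply: (ae_integral _ _ _ mM M0) => // x; exact: g'E.
  rewrite -limn_ereal_sup; last first.
    by move=> m n mn; apply: le_integral_nonneg => // x; exact: nd'.
  rewrite -monotone_convergence//; last by move=> x _ m n; exact: nd'.
  by apply: eq_integral => x _; rewrite limn_ereal_sup// => m n; exact: nd'.
- by move=> x; exact: ge0_ereal_sup_seq.
- by move=> x; exact: ge0_ereal_sup_seq.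
- exact: measurable_ereal_sup_seq.
- move=> x Mx; congr ereal_sup; apply/seteqP; split=> y [n _ <-]; exists n => //; first by rewrite -g'E.
  exact: g'E.
Qed.

End AlmostBorelIntegral.


Lemma integral0_null (R : realType) d (T : measurableType d) (P : probability T R) (u : T -> \bar R) :
  measurable_fun setT u -> (forall x, 0 <= u x)%E -> (\int[P]_x u x = 0)%E ->
  measurable [set x | u x != 0%E] /\ P [set x | u x != 0%E] = 0%E.
Proof.
move=> mu u0 I0.
have mS : measurable [set x | u x != 0%E].
  rewrite (_ : mkset _ = u @^-1` (~` [set 0%E])); last by apply/seteqP; split=> x /= /eqP.
  by rewrite -[X in measurable X]setTI; apply: mu => //; apply: measurableC; exact: emeasurable_set1.
split=> //.
have /(ae_eq_integral_abs P measurableT mu) [N [mN N0 sN]] : (\int[P]_x `|u x| = 0)%E.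
  by rewrite -[RHS]I0; apply: eq_integral => x _; rewrite gee0_abs.
apply: (subset_measure0 mS mN _ N0) => x /= ux; apply: sN => /= H.
by move: ux; rewrite H// eqxx.
Qed.

Section AlmostBorelTonelli.
Context (R : realType) d1 d2 (T1 : measurableType d1) (T2 : measurableType d2)
  (P1 : probability T1 R) (P2 : probability T2 R).
Local Open Scope ereal_scope.

Lemma null_sections (N : set (T1 * T2)) : measurable N -> (P1 \x P2)%E N = 0 ->
  (exists N1, [/\ measurable N1, P1 N1 = 0 & forall x, ~ N1 x -> P2 (xsection N x) = 0]) /\
  (exists N2, [/\ measurable N2, P2 N2 = 0 & forall y, ~ N2 y -> P1 (ysection N y) = 0]).
Proof.
move=> mN N0; split.
  have [m z] := integral0_null (measurable_fun_xsection P2 mN) (fun x => measure_ge0 _ _) N0.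
  by eexists; split; [exact: m|exact: z|move=> x /negP/negPn/eqP].
have I0 : \int[P2]_y P1 (ysection N y) = 0.
  rewrite -[RHS]N0.
  have mi : measurable_fun setT (fun p : T1 * T2 => (\1_N p)%:E : \bar R).
    exact/measurable_EFinP/measurable_indic.
  have i0 (p : T1 * T2) : 0 <= ((\1_N p)%:E : \bar R) by rewrite lee_fin.
  have E := fubini_tonelli (m1 := P1) (m2 := P2) _ mi i0.
  rewrite /product_measure1; transitivity (\int[P2]_y \int[P1]_x ((\1_N (x, y))%:E : \bar R)).
    apply: eq_integral => y _.
    transitivity (\int[P1]_x ((\1_(ysection N y) x)%:E : \bar R)).
      by rewrite integral_indic ?setIT//; exact: measurable_ysection.
    by apply: eq_integral => x _; rewrite !indicE mem_ysection.
  transitivity (\int[P1]_x \int[P2]_y ((\1_N (x, y))%:E : \bar R)); first exact/esym/E.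
  apply: eq_integral => x _.
  transitivity (\int[P2]_y ((\1_(xsection N x) y)%:E : \bar R)); last first.
    by rewrite integral_indic ?setIT//; exact: measurable_xsection.
  by apply: eq_integral => y _; rewrite !indicE mem_xsection.
have [m z] := integral0_null (measurable_fun_ysection P1 mN) (fun x => measure_ge0 _ _) I0.
by eexists; split; [exact: m|exact: z|move=> x /negP/negPn/eqP].
Qed.

Variable f : T1 * T2 -> \bar R.
Hypothesis abf : almost_borel (P1 \x P2)%E f.

(** Almost every section of N is null, in either variable; there the inner integrals of f are those
    of its Borel minorant g, to which Tonelli applies. *)
Lemma almost_borel_tonelli :
  almost_borel P1 (fun x => \int[P2]_y f (x, y)) /\
  \int[P1]_x \int[P2]_y f (x, y) = \int[P2]_y \int[P1]_x f (x, y).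
Proof.
have [g [N [mg g0 mN N0 E]]] := abf.
have gp p : 0 <= g p by have /andP[] := g0 p.
have fp p : 0 <= f p by have /andP[] := g0 p; exact: le_trans.
have [[N1 [mN1 PN1 H1]] [N2 [mN2 PN2 H2]]] := null_sections mN N0.
have E1 x : ~ N1 x -> \int[P2]_y f (x, y) = \int[P2]_y g (x, y).
  move=> /H1 N1x; apply: (@ae_integral _ _ _ P2 _ _ (xsection N x)) => //.
  - exact: measurableT_comp.
  - exact: measurable_xsection.
  - by move=> y ny; apply: E => Nxy; apply: ny; rewrite /xsection /= inE.
have E2 y : ~ N2 y -> \int[P1]_x f (x, y) = \int[P1]_x g (x, y).
  move=> /H2 N2y; apply: (@ae_integral _ _ _ P1 _ _ (ysection N y)) => //.
  - exact: measurableT_comp.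
  - exact: measurable_ysection.
  - by move=> x nx; apply: E => Nxy; apply: nx; rewrite /ysection /= inE.
have mF : measurable_fun setT (fun x => \int[P2]_y g (x, y)).
  exact: (measurable_fun_fubini_tonelli_F (m2 := P2) g mg gp).
have mG : measurable_fun setT (fun y => \int[P1]_x g (x, y)).
  exact: (measurable_fun_fubini_tonelli_G (m1 := P1) g mg gp).
split.
  by apply: (almost_borelP _ mF mN1 PN1 E1) => x; exact: integral_ge0.
rewrite (ae_integral _ _ mF mN1 PN1 E1); try by move=> x; exact: integral_ge0.
rewrite (fubini_tonelli (m1 := P1) (m2 := P2) g mg gp).
by rewrite (ae_integral _ _ mG mN2 PN2 E2)//; move=> x; exact: integral_ge0.
Qed.

End AlmostBorelTonelli.

(** * List-valued maps with measurable coordinates *)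

Section Coords.
Variable X : ptopologicalType.
Local Notation Z := (sample X).
Local Notation z0 := (sample0 X).

Definition coords d (T : measurableType d) (psi : T -> seq Z) (m : nat) :=
  (forall t, size (psi t) = m) /\
  forall i, (i < m)%N -> measurable_fun setT (fun t => nth z0 (psi t) i).

Lemma list_mapP (phi : seq Z -> seq Z) :
  list_map phi <-> forall n, exists m, coords (fun t : n.-tuple Z => phi (tval t)) m.
Proof.
split=> H n; have [m [sz co]] := H n; exists m; split=> //.
  by move=> t; apply: sz; rewrite size_tuple.
by move=> s sn; have := sz (@Tuple n _ s (introT eqP sn)).
Qed.

Lemma coords_tuple n : coords (fun t : n.-tuple Z => tval t) n.
Proof. by split=> [t|i ilt]; [rewrite size_tuple|exact: measurable_nth]. Qed.

Section CoordsT.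
Context d (T : measurableType d).

Lemma coords_nil : coords (fun _ : T => [::]) 0.
Proof. by []. Qed.

Lemma coords_cons (f : T -> Z) psi m : measurable_fun setT f -> coords psi m ->
  coords (fun t => f t :: psi t) m.+1.
Proof.
move=> mf [sz co]; split=> [t|[_|i] /=]; [by rewrite /= sz|exact: mf|exact: co].
Qed.

Lemma coords_const s : coords (fun _ : T => s) (size s).
Proof. by split=> // i _; exact: measurable_cst. Qed.

Lemma coords_cat psi1 psi2 m1 m2 : coords psi1 m1 -> coords psi2 m2 ->
  coords (fun t : T => psi1 t ++ psi2 t) (m1 + m2).
Proof.
move=> [s1 c1] [s2 c2]; split=> [t|i ilt]; first by rewrite size_cat s1 s2.
have [im|im] := ltnP i m1.
  rewrite (_ : (fun t => _) = (fun t => nth z0 (psi1 t) i)); first exact: c1.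
  by apply: funext => t; rewrite nth_cat s1 im.
rewrite (_ : (fun t => _) = (fun t => nth z0 (psi2 t) (i - m1))); first by apply: c2; lia.
by apply: funext => t; rewrite nth_cat s1 ltnNge im.
Qed.

Lemma coords_comp phi psi m : list_map phi -> coords psi m ->
  exists m', coords (fun t : T => phi (psi t)) m'.
Proof.
move=> /list_mapP/(_ m)[m' [sz' co']] [sz co]; exists m'.
pose f t := [tuple nth z0 (psi t) i | i < m].
have fE t : tval (f t) = psi t.
  apply: (@eq_from_nth _ z0); first by rewrite size_tuple sz.
  rewrite size_tuple => i im; rewrite -[i]/(nat_of_ord (Ordinal im)) -tnth_nth.
  by rewrite tnth_mktuple.
have mf : measurable_fun setT f.
  apply/measurable_fun_tnthP => i.
  rewrite (_ : _ \o f = fun t => nth z0 (psi t) i); first exact: co.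
  by apply: funext => t /=; rewrite tnth_mktuple.
split=> [t|i ilt]; first by rewrite -fE.
rewrite (_ : (fun t => _) = (fun u : m.-tuple Z => nth z0 (phi u) i) \o f).
  by apply: measurableT_comp => //; exact: co'.
by apply: funext => t /=; rewrite fE.
Qed.

End CoordsT.

Lemma list_map_id : list_map (fun s : seq Z => s).
Proof. by apply/list_mapP => n; exists n; exact: coords_tuple. Qed.

Lemma list_map_const (s : seq Z) : list_map (fun=> s).
Proof. by apply/list_mapP => n; exists (size s); exact: coords_const. Qed.

Lemma list_map_cat (phi1 phi2 : seq Z -> seq Z) : list_map phi1 -> list_map phi2 ->
  list_map (fun s => phi1 s ++ phi2 s).
Proof.
move=> /list_mapP h1 /list_mapP h2; apply/list_mapP => n.
by have [m1 c1] := h1 n; have [m2 c2] := h2 n; exists (m1 + m2)%N; exact: coords_cat.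
Qed.

Lemma list_map_comp (phi1 phi2 : seq Z -> seq Z) : list_map phi1 -> list_map phi2 ->
  list_map (fun s => phi1 (phi2 s)).
Proof.
move=> h1 /list_mapP h2; apply/list_mapP => n.
by have [m c] := h2 n; exact: coords_comp c.
Qed.

Lemma list_map_mask b : list_map (mask b : seq Z -> seq Z).
Proof.
apply/list_mapP => n; exists (size (mask b (iota 0 n))).
have E (t : n.-tuple Z) : mask b t = map (nth z0 t) (mask b (iota 0 n)).
  rewrite map_mask; congr mask; rewrite -[LHS](mkseq_nth z0) /mkseq; congr map.
  by rewrite size_tuple.
split=> [t|i ilt]; first by rewrite E size_map.
set j := nth 0%N (mask b (iota 0 n)) i.
have jn : (j < n)%N.
  by have := mask_subseq b (iota 0 n) => /mem_subseq/(_ j (mem_nth _ ilt)); rewrite mem_iota.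
rewrite (_ : (fun t => _) = fun t : n.-tuple Z => nth z0 t j); first exact: measurable_nth.
by apply: funext => t; rewrite E (nth_map 0%N).
Qed.

Lemma list_map_take k : list_map (take k : seq Z -> seq Z).
Proof.
rewrite (_ : take k = mask (nseq k true)); first exact: list_map_mask.
apply: funext => s; elim: k s => [|k IH] [|x s] //=; by rewrite IH.
Qed.

Lemma list_map_drop k : list_map (drop k : seq Z -> seq Z).
Proof.
apply/list_mapP => n; exists (n - k)%N; split=> [t|i ilt]; first by rewrite size_drop size_tuple.
rewrite (_ : (fun t => _) = fun t : n.-tuple Z => nth z0 t (k + i)); first by apply: measurable_nth; lia.
by apply: funext => t; rewrite nth_drop.
Qed.

End Coords.

(** * Expectations over i.i.d. lists *)

Section UnivFun.
Variables (R : realType) (X : ptopologicalType).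
Local Notation Z := (sample X).
Local Notation U := (usample X R).
Local Open Scope ereal_scope.

Definition umf (F : U -> \bar R) := measurable_fun setT F /\ forall l, 0 <= F l.

Lemma umf_comp F phi : umf F -> list_map phi -> umf (fun l => F (phi l)).
Proof.
move=> [mF F0] Hphi; split=> [|l]; last exact: F0.
exact: (measurableT_comp mF (measurable_list_map Hphi)).
Qed.

Lemma umfD F G : umf F -> umf G -> umf (fun l => F l + G l).
Proof. by move=> [? F0] [? G0]; split=> [|l]; [exact: emeasurable_funD|exact: adde_ge0]. Qed.

Lemma umfZ k F : 0 <= k -> umf F -> umf (fun l => k * F l).
Proof. by move=> k0 [? F0]; split=> [|l]; [exact: measurable_funeM|exact: mule_ge0]. Qed.

Lemma umf_cst k : 0 <= k -> umf (fun=> k).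
Proof. by move=> k0; split=> //; exact: measurable_cst. Qed.

Lemma umf_sum (I : Type) (s : seq I) (F : I -> U -> \bar R) : (forall i, umf (F i)) ->
  umf (fun l => \sum_(i <- s) F i l).
Proof.
move=> mF; elim: s => [|i s IH].
  by rewrite (_ : (fun l => _) = fun=> 0); [exact: umf_cst|apply: funext => l; rewrite big_nil].
rewrite (_ : (fun l => _) = fun l => F i l + \sum_(j <- s) F j l); first exact: umfD.
by apply: funext => l; rewrite big_cons.
Qed.

Lemma umf_indic (A : set U) : measurable A -> umf (fun l => (\1_A l)%:E).
Proof.
move=> mA; split=> [|l]; last by rewrite lee_fin.
exact/measurable_EFinP/measurable_indic.
Qed.

Lemma umf_sup (F : nat -> U -> \bar R) : (forall n, umf (F n)) ->
  umf (fun l => ereal_sup (range (F^~ l))).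
Proof.
move=> mF; split; first by apply: measurable_ereal_sup_seq => n; have [] := mF n.
by move=> l; apply: ge0_ereal_sup_seq => n; have [] := mF n.
Qed.

Lemma umf_almost_borel d (T : measurableType d) (Q : probability T R) F psi m :
  umf F -> coords psi m -> almost_borel Q (fun t : T => F (psi t)).
Proof.
move=> [mF F0] [sz co]; apply: almost_borel_univ_measurable => // Y mY.
apply: (@univ_measurable_list R X _ _ psi m (F @^-1` Y)) => //.
by rewrite -[X in measurable X]setTI; exact: mF.
Qed.

Variable P : probability (borel X * bool)%type R.

Lemma measurable_pair_rcons n : coords (fun p : n.-tuple Z * Z => rcons p.1 p.2) n.+1.
Proof.
rewrite -addn1 (_ : (fun p => _) = fun p : n.-tuple Z * Z => p.1 ++ [:: p.2]); last first.
  by apply: funext => p; rewrite cats1.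
apply: coords_cat; last first.
  by apply: coords_cons; [exact: measurable_snd|exact: coords_nil].
split=> [p|i ilt]; first by rewrite size_tuple.
exact: (measurableT_comp (measurable_nth ilt) (@measurable_fst _ _ _ _)).
Qed.

(** Universal measurability is tested against an arbitrary law Q on n-tuples, and Tonelli for the
    product of Q and P settles each test. *)
Lemma umf_integral F : umf F -> umf (fun l => \int[P]_z F (rcons l z)).
Proof.
move=> uF; split=> [|l]; last by apply: integral_ge0 => z _; case: uF.
move=> _ Y mY; rewrite setTI measurable_usampleE => n.
apply: univ_measurable_almost_borel (mY) => Q.
have [] // := @almost_borel_tonelli _ _ _ _ _ Q P (fun p : n.-tuple Z * Z => F (rcons p.1 p.2)).
exact: umf_almost_borel uF (measurable_pair_rcons n).
Qed.

Fixpoint EL (n : nat) (F : U -> \bar R) : \bar R :=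
  if n is n'.+1 then \int[P]_z EL n' (fun l => F (z :: l)) else F [::].

Lemma iid_expectE n F : iid_expect P (fun t : n.-tuple (borel X * bool)%type => F (tval t)) = EL n F.
Proof. by elim: n F => //= n IH F; apply: eq_integral => z _; rewrite -IH. Qed.

Lemma EL_ge0 n F : (forall l, 0 <= F l) -> 0 <= EL n F.
Proof. by elim: n F => [|n IH] F F0 //=; apply: integral_ge0 => z _; exact: IH. Qed.

Lemma EL_le n F G : (forall l, 0 <= F l) -> (forall l, size l = n -> F l <= G l) -> EL n F <= EL n G.
Proof.
elim: n F G => [|n IH] F G F0 FG /=; first exact: FG.
apply: le_integral_nonneg => z; first exact: EL_ge0.
by apply: IH => // l ln; apply: FG; rewrite /= ln.
Qed.

Lemma EL_ext n F G : (forall l, size l = n -> F l = G l) -> EL n F = EL n G.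
Proof.
elim: n F G => [|n IH] F G FG /=; first exact: FG.
by apply: eq_integral => z _; apply: IH => l ln; apply: FG; rewrite /= ln.
Qed.

Lemma EL_cat m n F : EL (m + n) F = EL m (fun l => EL n (fun u => F (l ++ u))).
Proof. by elim: m F => // m IH F /=; apply: eq_integral => z _; rewrite IH. Qed.

Lemma umf_EL n F : umf F -> umf (fun l => EL n (fun u => F (l ++ u))).
Proof.
elim: n F => [|n IH] F uF /=.
  by rewrite (_ : (fun l => _) = F)//; apply: funext => l; rewrite cats0.
have := umf_integral (IH F uF); congr umf; apply: funext => l.
by apply: eq_integral => z _; apply: EL_ext => u _; rewrite cat_rcons.
Qed.

Lemma umf_cons z F : umf F -> umf (fun l => F (z :: l)).
Proof.
move=> uF; apply: (umf_comp (phi := fun l => [:: z] ++ l) uF).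
by apply: list_map_cat; [exact: list_map_const|exact: list_map_id].
Qed.

Lemma EL_almost_borel n F : umf F -> almost_borel P (fun z => EL n (fun l => F (z :: l))).
Proof.
move=> uF; apply: (umf_almost_borel P (psi := fun z => [:: z]) (m := 1) (umf_EL n uF)).
exact: (coords_cons (f := id) _ (coords_nil _ _)).
Qed.

Lemma ELD n F G : umf F -> umf G -> EL n (fun l => F l + G l) = EL n F + EL n G.
Proof.
elim: n F G => // n IH F G uF uG /=.
rewrite -almost_borel_integralD; [|exact: EL_almost_borel..].
by apply: eq_integral => z _; rewrite IH//; exact: umf_cons.
Qed.

Lemma ELZ n k F : 0 <= k -> umf F -> EL n (fun l => k * F l) = k * EL n F.
Proof.
move=> k0; elim: n F => // n IH F uF /=.
rewrite -almost_borel_integralZl//; last exact: EL_almost_borel.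
by apply: eq_integral => z _; rewrite IH//; exact: umf_cons.
Qed.

Lemma EL_cst n k : EL n (fun=> k) = k.
Proof.
elim: n => // n IH /=; under eq_integral do rewrite IH.
by rewrite integral_cst// [X in _ * X]probability_setT mule1.
Qed.

Lemma EL_sum n (I : Type) (s : seq I) (F : I -> U -> \bar R) : (forall i, umf (F i)) ->
  EL n (fun l => \sum_(i <- s) F i l) = \sum_(i <- s) EL n (F i).
Proof.
move=> uF; elim: s => [|i s IH].
  by rewrite big_nil -[RHS](EL_cst n); apply: EL_ext => l _; rewrite big_nil.
rewrite big_cons -IH -ELD//; last exact: umf_sum.
by apply: EL_ext => l _; rewrite big_cons.
Qed.

Lemma EL_monotone_convergence n (F : nat -> U -> \bar R) : (forall k, umf (F k)) ->
  (forall l i j, (i <= j)%N -> F i l <= F j l) ->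
  EL n (fun l => ereal_sup (range (F^~ l))) = ereal_sup (range (fun k => EL n (F k))).
Proof.
elim: n F => // n IH F uF nd /=.
rewrite -almost_borel_monotone_convergence; last 2 first.
- by move=> k; exact: EL_almost_borel.
- by move=> z i j ij; apply: EL_le => [l|l _]; [case: (uF i)|exact: nd].
apply: eq_integral => z _; rewrite (IH (fun k l => F k (z :: l)))//.
  by move=> k; exact: umf_cons.
by move=> l i j; exact: nd.
Qed.

(** The iterated integral comes without null sets on lists. Instead the multiples k F increase to
    +oo wherever F > 0, and monotone convergence bounds G. *)
Lemma EL_eq0 n F G : umf F -> umf G -> EL n F = 0 ->
  (forall l, size l = n -> F l = 0 -> G l = 0) -> EL n G = 0.
Proof.
move=> uF uG F0 FG; apply/eqP; rewrite eq_le EL_ge0 ?andbT; last by case: uG.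
pose H k l := (k%:R)%:E * F l.
have uH k : umf (H k) by apply: umfZ => //; rewrite lee_fin.
apply: (@le_trans _ _ (EL n (fun l => ereal_sup (range (H^~ l))))).
  apply: EL_le => [l|l ln]; first by case: uG.
  have [Fl|Fl] := eqVneq (F l) 0.
    by rewrite FG//; apply: ge0_ereal_sup_seq => k; exact: (uH k).2.
  have Fp : 0 < F l by rewrite lt_neqAle eq_sym Fl /=; exact: uF.2.
  suff -> : ereal_sup (range (H^~ l)) = +oo by rewrite leey.
  apply/eqP; rewrite -leye_eq leNgt; apply/negP => lt.
  set S := ereal_sup _ in lt.
  have SH k : H k l <= S by apply: ereal_sup_ubound; exists k.
  have S0 : 0 <= S by apply: le_trans (SH 0%N); exact: (uH 0%N).2.
  have Sf : S \is a fin_num by rewrite ge0_fin_numE.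
  have F1 : F l <= S by have := SH 1%N; rewrite /H mul1e.
  have Ff : F l \is a fin_num by rewrite ge0_fin_numE ?(le_lt_trans F1)// ltW.
  have f0 : (0 < fine (F l))%R by rewrite fine_gt0// Fp -ge0_fin_numE// ltW.
  have := SH (Num.trunc (fine S / fine (F l))).+1; rewrite /H -(fineK Ff) -(fineK Sf) lee_fin leNgt.
  by rewrite -ltr_pdivrMr// truncnS_gt.
rewrite EL_monotone_convergence//.
  apply: ge_ereal_sup => _ [k _ <-]; rewrite ELZ ?F0 ?mule0//.
by move=> l i j ij; apply: lee_wpmul2r; [case: uF|rewrite lee_fin ler_nat].
Qed.

Lemma EL_mask b F : EL (size b) (fun l => F (mask b l)) = EL (count id b) F.
Proof.
elim: b F => // -[] b IH F /=; first by apply: eq_integral => z _; rewrite -IH.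
rewrite add0n; under eq_integral do rewrite IH.
exact: (EL_cst 1 (EL (count id b) F)).
Qed.

Lemma EL_take m n F : EL (m + n) (fun l => F (take m l)) = EL m F.
Proof.
rewrite EL_cat; apply: EL_ext => l lm.
by rewrite -[RHS](EL_cst n); apply: EL_ext => u _; rewrite take_size_cat.
Qed.

Lemma EL_drop m n F : EL (m + n) (fun l => F (drop m l)) = EL n F.
Proof.
rewrite EL_cat -[RHS](EL_cst m); apply: EL_ext => l lm.
by apply: EL_ext => u _; rewrite drop_size_cat.
Qed.

(** Exchangeability reduces to one transposition: Tonelli swaps the integrations over the first two
    samples, and induction does the rest. *)
Lemma EL_insert0 n F : umf F -> EL n (fun l => \int[P]_z F (z :: l)) = EL n.+1 F.
Proof.
elim: n F => // n IH F uF.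
pose sw (l : seq Z) := take 1 (drop 1 l) ++ take 1 l ++ drop 2 l.
have lsw : list_map sw.
  apply: list_map_cat; first by apply: list_map_comp; [exact: list_map_take|exact: list_map_drop].
  by apply: list_map_cat; [exact: list_map_take|exact: list_map_drop].
have uG z1 : umf (fun l => F (sw (z1 :: l))).
  exact: umf_cons (umf_comp uF lsw).
transitivity (\int[P]_z1 \int[P]_z EL n (fun l => F [:: z, z1 & l])).
  apply: eq_integral => z1 _; transitivity (EL n.+1 (fun l => F (sw (z1 :: l)))).
    rewrite -(IH (fun l => F (sw (z1 :: l))))//; apply: EL_ext => l _.
    by apply: eq_integral => z _; rewrite /sw /= take0 drop0.
  by apply: eq_integral => z _; apply: EL_ext => l _; rewrite /sw /= take0 drop0.
have ab : almost_borel (P \x P)%E (fun p : Z * Z => EL n (fun l => F ([:: p.2; p.1] ++ l))).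
  apply: (umf_almost_borel (P \x P)%E (psi := fun p : Z * Z => [:: p.2; p.1]) (m := 2) (umf_EL n uF)).
  apply: coords_cons; first exact: measurable_snd.
  exact: (coords_cons (measurable_fst) (coords_nil _ _)).
by have [_ /= E] := almost_borel_tonelli ab.
Qed.

Lemma EL_insert i n F : (i <= n)%N -> umf F ->
  EL n (fun l => \int[P]_z F (take i l ++ z :: drop i l)) = EL n.+1 F.
Proof.
elim: i n F => [|i IH] n F ilen uF.
  by rewrite -EL_insert0//; apply: EL_ext => l _; rewrite take0 drop0.
case: n ilen => // n ilen; apply: eq_integral => z1 _.
exact: (IH n (fun l => F (z1 :: l)) ilen (umf_cons z1 uF)).
Qed.

End UnivFun.

(** * Playing the game against random data *)

Section UnivCases.
Variables (R : realType) (X : ptopologicalType).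
Local Notation Z := (sample X).
Local Notation U := (usample X R).
Local Open Scope ereal_scope.

Lemma measurable_size (Q : nat -> Prop) : measurable [set l : U | Q (size l)].
Proof.
rewrite measurable_usampleE => n; apply: univ_measurable_borel.
have [q|nq] := pselect (Q n).
  by rewrite (_ : mkset _ = setT)//; apply/seteqP; split=> t //= _; rewrite size_tuple.
by rewrite (_ : mkset _ = set0)//; apply/seteqP; split=> t //=; rewrite size_tuple.
Qed.

Lemma umf_case (K : countType) (c : U -> K) (F : K -> U -> \bar R) :
  (forall k, measurable [set l | c l = k]) -> (forall k, umf (F k)) -> umf (fun l => F (c l) l).
Proof.
move=> mc uF; split=> [|l]; last exact: (uF _).2.
move=> _ Y mY; rewrite setTI.
rewrite (_ : _ @^-1` _ = [set l | exists k, ([set l | c l = k] `&` F k @^-1` Y) l]); last first.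
  by apply/seteqP; split=> l /=; [move=> H; exists (c l)|move=> [k [<-]]].
apply: measurable_exists => k; apply: measurableI; first exact: mc.
by rewrite -[X in measurable X]setTI; exact: (uF k).1.
Qed.

Lemma umf_case_size (F : nat -> U -> \bar R) : (forall n, umf (F n)) -> umf (fun l => F (size l) l).
Proof. by move=> uF; apply: (umf_case (c := size)) => // k; exact: (measurable_size (fun n => n = k)). Qed.

Lemma umf_if (A : set U) (F G : U -> \bar R) : measurable A -> umf F -> umf G ->
  umf (fun l => if `[< A l >] then F l else G l).
Proof.
move=> mA uF uG; apply: (umf_case (c := fun l => `[< A l >]) (F := fun (b : bool) l => if b then F l else G l)); last by case.
case; first by rewrite (_ : mkset _ = A)//; apply/seteqP; split=> l /=; [move/asboolP|move=> ?; apply/asboolP].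
rewrite (_ : mkset _ = ~` A); first exact: measurableC.
by apply/seteqP; split=> l /=; [move/asboolPn|move=> ?; apply/asboolPn].
Qed.

Lemma measurable_preimage_list (A : set U) phi : measurable A -> list_map phi -> measurable [set l : U | A (phi l)].
Proof.
move=> mA Hphi; by have := measurable_list_map Hphi measurableT mA; rewrite setTI.
Qed.

Lemma umf_inf (F : nat -> U -> \bar R) : (forall n, umf (F n)) ->
  umf (fun l => ereal_inf (range (F^~ l))).
Proof.
move=> mF; split.
  have := measurable_fun_einfs (fun n => (mF n).1) 0%N; congr measurable_fun; apply: funext => x.
  by rewrite /einfs /sdrop; congr ereal_inf; apply/seteqP; split=> y [n _ <-]; exists n.
by move=> l; apply: le_ereal_inf_tmp => _ [n _ <-]; exact: (mF n).2.
Qed.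

Lemma umf_indicP (Q : U -> Prop) : measurable [set l | Q l] -> umf (fun l => (`[< Q l >]%:R : R)%:E).
Proof.
move=> /umf_indic; congr umf; apply: funext => l; by rewrite indicE; congr (_%:R%:E)%R.
Qed.

End UnivCases.

(** * The play as a function of the sample, and the law of its final state *)

Section Run.
Variables (R : realType) (X : ptopologicalType).
Local Notation Z := (sample X).
Local Notation U := (usample X R).
Variables (alv : U -> Prop) (A B : seq nat -> U -> Prop) (pr : seq nat -> seq nat -> Prop).
Hypothesis A_alv : forall w l, A w l <-> alv l /\ forall w', pr w' w -> B w' l.
Hypothesis m_alv : measurable [set l | alv l].
Hypothesis mA : forall w, measurable [set l | A w l].
Hypothesis mB : forall w, measurable [set l | B w l].
Hypothesis wf_pr : well_founded pr.
Local Open Scope ereal_scope.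

Let cand w l (w' : seq nat) := pr w' w /\ ~ B w' l.

Let candn w l n := `[< if @pickle_inv (seq nat) n is Some w' then cand w l w' else False >].

(* The first state w' below w from which the adversary has lost at position l. *)
Definition next (w : seq nat) (l : U) : option (seq nat) :=
  if pselect (exists n, candn w l n) is left H then pickle_inv (ex_minn H) else None.

Lemma next_Some w l w' : next w l = Some w' -> pr w' w /\ ~ B w' l.
Proof.
rewrite /next; case: pselect => // H; case: ex_minnP => n /asboolP + _ E.
by rewrite E.
Qed.

Lemma next_None w l : next w l = None -> A w l \/ ~ alv l.
Proof.
rewrite /next; case: pselect => [H|H _].
  by case: ex_minnP => n /asboolP + _ E; rewrite E.
have [al|?] := pselect (alv l); [left|by right].
apply/A_alv; split=> // w' pw'; apply: contrapT => nB; apply: H; exists (pickle w').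
by apply/asboolP; rewrite pickleK_inv.
Qed.

Lemma measurable_next w o : measurable [set l | next w l = o].
Proof.
have mc n : measurable [set l : U | candn w l n].
  rewrite /candn; case E: pickle_inv => [w'|]; last first.
    by rewrite (_ : mkset _ = set0)//; apply/seteqP; split=> l //= /asboolP.
  rewrite (_ : mkset _ = [set _ | pr w' w] `&` ~` [set l | B w' l]).
    by apply: measurableI; [exact: measurable_cst_prop|exact: measurableC].
  by apply/seteqP; split=> l /=; [move/asboolP|move=> ?; apply/asboolP].
have m1 w' : measurable [set l | next w l = Some w'].
  rewrite (_ : mkset _ = [set l : U | candn w l (pickle w')] `&`
     [set l : U | forall n, [set l : U | (n < pickle w')%N -> ~~ candn w l n] l]).
    apply: measurableI => //.
    apply: (@measurable_forall _ _ _ (fun n => [set l : U | (n < pickle w')%N -> ~~ candn w l n])) => n.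
    have [lt|ge] := boolP (n < pickle w')%N; last first.
      by rewrite (_ : mkset _ = setT)//; apply/seteqP; split.
    rewrite (_ : mkset _ = ~` [set l : U | candn w l n]); first exact: measurableC.
    by apply/seteqP; split=> l /=; [move=> /(_ isT)/negP|move=> /negP].
  apply/seteqP; split=> l /=.
    rewrite /next; case: pselect => // H; case: ex_minnP => n cn mn E.
    have nE : n = pickle w'.
      by have := @pickle_invK (seq nat) n; rewrite /= E.
    by split; [rewrite -nE|move=> k kw; apply/negP => /mn; rewrite leqNgt nE kw].
  move=> [cn mn]; rewrite /next; case: pselect => [H|H]; last by case: H; exists (pickle w').
  case: ex_minnP => n cn' mn'.
  suff -> : n = pickle w' by rewrite pickleK_inv.
  apply/eqP; rewrite eqn_leq mn' //= leqNgt; apply/negP => /mn.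
  by rewrite cn'.
case: o => [w'|]; first exact: m1.
rewrite (_ : mkset _ = ~` [set l | exists w', [set l | next w l = Some w'] l]).
  by apply/measurableC/measurable_exists.
apply/seteqP; split=> l /=; first by move=> -> [w'].
by case E: next => [w'|//] H; case: H; exists w'.
Qed.

(** Here n is fuel; the length of u suffices since every block is non-empty. A block that triggers
    no move is forgotten, so v holds only the blocks that did. *)
Fixpoint run (n : nat) (v : U) (w : seq nat) (u : U) : U * seq nat :=
  if n is n'.+1 then
    if (size u < (size w).+1)%N then (v, w) else
    let u1 := take (size w).+1 u in let u2 := drop (size w).+1 u in
    if next w (v ++ u1) is Some w' then run n' (v ++ u1) w' u2 else run n' v w u2
  else (v, w).

Lemma run_fuel n v w u : (size u <= n)%N -> run n v w u = run (size u) v w u.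
Proof.
suff H m : forall n n' v w u, (size u <= m)%N -> (m <= n)%N -> (m <= n')%N -> run n v w u = run n' v w u.
  by move=> un; apply: (H (size u)).
elim: m => [|m IH] {}n n' {}v {}w {}u um mn mn'.
  by move: um; rewrite leqn0 => /eqP u0; case: n n' mn mn' => [|n] [|n'] _ _ //=; rewrite u0.
case: n mn => // n mn; case: n' mn' => // n' mn' /=.
have sd : (size (drop (size w).+1 u) <= m)%N by rewrite size_drop; lia.
by case: ltnP => // _; case: next => [w'|]; apply: IH.
Qed.

Lemma run_inv n v w u : ~ B w v -> ~ B (run n v w u).2 (run n v w u).1.
Proof.
elim: n v w u => // n IH v w u nB /=; case: ltnP => // _.
by case E: next => [w'|]; apply: IH => //; have [] := next_Some E.
Qed.

(* [run] reads a block of length [j]; what follows the block is passed on to [phi] behind the final position. *)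
Lemma umf_run (phi : nat -> seq nat -> U -> \bar R) n i j w : (forall m w, umf (phi m w)) ->
  umf (fun l => let s := run n (take i l) w (take j (drop i l)) in
                phi (size s.1) s.2 (s.1 ++ drop (i + j) l)).
Proof.
move=> uphi; elim: n i j w => [|n IH] i j w /=.
  have u0 m : umf (fun l => phi m w (take i l ++ drop (i + j) l)).
    apply: (umf_comp (uphi m w)); apply: list_map_cat; [exact: list_map_take|exact: list_map_drop].
  have := umf_case_size (fun m => u0 (minn i m)); congr umf; apply: funext => l.
  by rewrite size_take_min.
set k := (size w).+1.
have u0 : umf (fun l => phi (size (take i l)) w (take i l ++ drop (i + j) l)).
  have u0 m : umf (fun l => phi m w (take i l ++ drop (i + j) l)).
    apply: (umf_comp (uphi m w)); apply: list_map_cat; [exact: list_map_take|exact: list_map_drop].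
  have := umf_case_size (fun m => u0 (minn i m)); congr umf; apply: funext => l.
  by rewrite size_take_min.
pose G i j w l := let s := run n (take i l) w (take j (drop i l)) in
  phi (size s.1) s.2 (s.1 ++ drop (i + j) l).
pose F (o : option (seq nat)) (l : U) := if o is Some w' then G (i + k)%N (j - k)%N w' l
  else G i (j - k)%N w (take i l ++ drop (i + k) l).
have uF o : umf (F o).
  case: o => [w'|]; first exact: IH.
  apply: (umf_comp (IH i (j - k)%N w)); apply: list_map_cat; first exact: list_map_take.
  exact: list_map_drop.
have u1 : umf (fun l => F (next w (take (i + k) l)) l).
  apply: (umf_case (c := fun l => next w (take (i + k) l))) => // o.
  exact: (measurable_preimage_list (measurable_next w o) (list_map_take _ _)).
have := umf_if (measurable_size (fun m => (minn j (m - i) < k)%N)) u0 u1.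
congr umf; apply: funext => l; rewrite (size_take_min j) size_drop.
case: asboolP => /= h; first by rewrite h.
have {}h : (k <= minn j (size l - i))%N by rewrite leqNgt; apply/negP.
have kj : (k <= j)%N by apply: leq_trans h _; exact: geq_minl.
have kl : (k <= size l - i)%N by apply: leq_trans h _; exact: geq_minr.
have E1 : take i l ++ take k (take j (drop i l)) = take (i + k) l.
  by rewrite take_takel// takeD.
have E2 : drop k (take j (drop i l)) = take (j - k) (drop (i + k) l).
  by rewrite (addnC i) -drop_drop [RHS]take_drop subnK.
rewrite ltnNge h /= E1 E2 /F /G; case: next => [w'|].
  by rewrite -addnA subnKC.
have si : size (take i l) = i by rewrite size_takel//; lia.
rewrite take_size_cat// drop_size_cat// drop_cat si ltnNge leq_addr /= addKn drop_drop.
by rewrite (addnC i k) addnA subnK// (addnC j).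
Qed.

Variable P : probability (borel X * bool)%type R.
Local Notation EL := (EL P).

Lemma umf_EL_run (phi : seq nat -> U -> \bar R) r w : (forall w, umf (phi w)) ->
  umf (fun v => EL r (fun u => let s := run r v w u in phi s.2 s.1)).
Proof.
move=> uphi.
have uphi' m w' : umf (fun l => phi w' (take m l)).
  by apply: (umf_comp (uphi w')); exact: list_map_take.
have := umf_case_size (fun i => umf_EL P r (umf_run r i r w uphi')).
congr umf; apply: funext => v; apply: EL_ext => u ur.
by rewrite take_size_cat// drop_size_cat// take_oversize ?ur// take_size_cat.
Qed.

Definition ind (Q : Prop) : \bar R := (`[< Q >]%:R : R)%:E.

Lemma ind_ge0 Q : 0 <= ind Q. Proof. by rewrite lee_fin. Qed.

Lemma ind_le1 Q : ind Q <= 1. Proof. by rewrite lee_fin; case: asboolP. Qed.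

Lemma ind1 (Q : Prop) : Q -> ind Q = 1. Proof. by move=> q; rewrite /ind asboolT. Qed.

Lemma ind0 (Q : Prop) : ~ Q -> ind Q = 0. Proof. by move=> q; rewrite /ind asboolF. Qed.

(** By [A_alv], failure of [A w] means that the list is dead or that a move is available. From a
    safe position only the second can have positive probability, so play has almost surely
    stopped. *)
Definition final (w : seq nat) (v : U) : Prop := EL (size w).+1 (fun u => ind (~ A w (v ++ u))) = 0.

Definition good K w v := final w v /\ (size w <= K)%N.

Lemma umf_notA w : umf (fun l : U => ind (~ A w l)).
Proof. by apply: umf_indicP; exact: (measurableC (mA w)). Qed.

Lemma measurable_final w : measurable [set v | final w v].
Proof.
have [mf _] := umf_EL P (size w).+1 (umf_notA w).
have := mf measurableT _ (emeasurable_set1 0); rewrite setTI.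
by congr measurable.
Qed.

Lemma umf_good K w : umf (fun v : U => ind (good K w v)).
Proof.
apply: umf_indicP; rewrite (_ : mkset _ = [set v | final w v] `&` [set _ | (size w <= K)%N])//.
by apply: measurableI; [exact: measurable_final|exact: measurable_cst_prop].
Qed.

Definition pgood K r v w : \bar R := EL r (fun u => let s := run r v w u in ind (good K s.2 s.1)).

Lemma umf_pgood K r w : umf (fun v => pgood K r v w).
Proof. exact: (umf_EL_run r w (phi := fun w v => ind (good K w v)) (umf_good K)). Qed.

Lemma pgood_ge0 K r v w : 0 <= pgood K r v w.
Proof. by apply: EL_ge0 => u; exact: ind_ge0. Qed.

Lemma pgood_le1 K r v w : pgood K r v w <= 1.
Proof.
rewrite -[leRHS](EL_cst P r); apply: EL_le => u; first exact: ind_ge0.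
by move=> _; exact: ind_le1.
Qed.

Lemma pgood_small K r v w : (r < (size w).+1)%N -> pgood K r v w = ind (good K w v).
Proof.
move=> rw; rewrite /pgood -[RHS](EL_cst P r); apply: EL_ext => u ur.
by case: r rw ur => //= r rw ->; rewrite rw.
Qed.

Lemma pgood_rec K r v w : pgood K ((size w).+1 + r) v w =
  EL (size w).+1 (fun u => if next w (v ++ u) is Some w' then pgood K r (v ++ u) w' else pgood K r v w).
Proof.
rewrite /pgood EL_cat; apply: EL_ext => u uw; set k := (size w).+1.
have E (u' : U) : size u' = r -> run (k + r) v w (u ++ u') =
   if next w (v ++ u) is Some w' then run r (v ++ u) w' u' else run r v w u'.
  move=> ur; rewrite addSn /= size_cat uw ltnNge leq_addr /=.
  rewrite take_size_cat// drop_size_cat//.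
  by case: next => [w'|]; rewrite run_fuel ur// leq_addl.
by case N : next => [w'|]; apply: EL_ext => u' ur; rewrite E ?N.
Qed.

Lemma ind_good_le K K' w v : (K <= K')%N -> ind (good K w v) <= ind (good K' w v).
Proof.
move=> KK'; have [[f sK]|ng] := pselect (good K w v); last by rewrite (ind0 ng) ind_ge0.
by rewrite !ind1//; split=> //; exact: leq_trans KK'.
Qed.

Lemma pgood_le K K' r v w : (K <= K')%N -> pgood K r v w <= pgood K' r v w.
Proof.
by move=> KK'; apply: EL_le => [u|u _]; [exact: ind_ge0|exact: ind_good_le].
Qed.

(* The probability that the play ends in a good state, uniformly over all sample sizes at least K,
   and its limit as K grows. *)
Definition pinf K v w : \bar R := ereal_inf (range (fun r => pgood K (K + r) v w)).
Definition plim v w : \bar R := ereal_sup (range (fun K => pinf K v w)).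

Lemma umf_pinf K w : umf (fun v => pinf K v w).
Proof. by apply: umf_inf => r; exact: umf_pgood. Qed.

Lemma umf_plim w : umf (fun v => plim v w).
Proof. by apply: (umf_sup (F := fun K v => pinf K v w)) => K; exact: umf_pinf. Qed.

Lemma pinf_le_pgood K r v w : (K <= r)%N -> pinf K v w <= pgood K r v w.
Proof. by move=> Kr; apply: ereal_inf_lbound; exists (r - K)%N => //; rewrite subnKC. Qed.

Lemma pinf_le1 K v w : pinf K v w <= 1.
Proof. exact: le_trans (pinf_le_pgood v w (leqnn K)) (pgood_le1 _ _ _ _). Qed.

Lemma pinf_mono K K' v w : (K <= K')%N -> pinf K v w <= pinf K' v w.
Proof.
move=> KK'; apply: le_ereal_inf_tmp => _ [r _ <-]; apply: le_trans (pgood_le _ _ _ KK').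
by apply: pinf_le_pgood; exact: leq_trans (leq_addr _ _).
Qed.

Lemma plim_le1 v w : plim v w <= 1.
Proof. by apply: ge_ereal_sup => _ [K _ <-]; exact: pinf_le1. Qed.

Lemma plim_ge0 v w : 0 <= plim v w. Proof. exact: (umf_plim w).2. Qed.

(** Passes to almost every extension of v by fresh data ([EL_safe]), as the induction over moves
    requires. *)
Definition safe (v : U) : Prop := forall m, EL m (fun u => ind (~ alv (v ++ u))) = 0.

Lemma umf_dead : umf (fun l : U => ind (~ alv l)).
Proof. by apply: umf_indicP; exact: (measurableC m_alv). Qed.

Lemma measurable_safe : measurable [set v : U | safe v].
Proof.
apply: (@measurable_forall _ _ _ (fun m => [set v : U | EL m (fun u => ind (~ alv (v ++ u))) = 0])) => m.
have [mf _] := umf_EL P m umf_dead.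
have := mf measurableT _ (emeasurable_set1 0); rewrite setTI.
by congr measurable.
Qed.

Lemma EL_null_countable n (F : nat -> U -> \bar R) G : (forall m, umf (F m)) -> umf G ->
  (forall m, EL n (F m) = 0) -> (forall l, size l = n -> (forall m, F m l = 0) -> G l = 0) -> EL n G = 0.
Proof.
move=> uF uG F0 FG.
pose S k l := \sum_(m <- iota 0 k) F m l.
have uS k : umf (S k) by apply: umf_sum.
have ndS l i j : (i <= j)%N -> S i l <= S j l.
  move=> ij; rewrite /S -(subnKC ij) iotaD big_cat /= leeDl// sume_ge0// => m _; exact: (uF m).2.
have z : EL n (fun l => ereal_sup (range (S^~ l))) = 0.
  rewrite EL_monotone_convergence//; apply/eqP; rewrite eq_le ge0_ereal_sup_seq ?andbT; last first.
    by move=> k; apply: EL_ge0 => l; exact: (uS k).2.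
  apply: ge_ereal_sup => _ [k _ <-]; rewrite EL_sum//.
  by rewrite big1_seq// => m _; rewrite F0.
apply: (EL_eq0 (umf_sup uS) uG z) => l ln z'; apply: FG => // m.
apply/eqP; rewrite eq_le (uF m).2 andbT -z'.
apply: (@le_trans _ _ (S m.+1 l)); last by apply: ereal_sup_ubound; exists m.+1.
by rewrite /S -addn1 iotaD big_cat /= big_seq1 leeDr// sume_ge0// => j _; exact: (uF j).2.
Qed.

Lemma EL_safe n v : safe v -> EL n (fun u => ind (~ safe (v ++ u))) = 0.
Proof.
move=> sv; have cv : list_map (fun u : seq Z => v ++ u).
  by apply: list_map_cat; [exact: list_map_const|exact: list_map_id].
apply: (@EL_null_countable n (fun m u => EL m (fun u' => ind (~ alv ((v ++ u) ++ u'))))).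
- by move=> m; exact: (umf_comp (umf_EL P m umf_dead) cv).
- by apply: (umf_comp (umf_indicP (Q := fun l => ~ safe l) _) cv); exact: (measurableC measurable_safe).
- move=> m; rewrite -(sv (n + m)%N) EL_cat; apply: EL_ext => u _.
  by apply: EL_ext => u' _; rewrite catA.
- by move=> u _ H; apply: ind0; apply => m; exact: H.
Qed.

Lemma plim_final v w : final w v -> 1 <= plim v w.
Proof.
move=> fin.
have H K : (size w <= K)%N -> forall r, 1 <= pgood K r v w.
  move=> wK; elim/ltn_ind => r IH; have [rw|rw] := ltnP r (size w).+1.
    by rewrite pgood_small// ind1.
  rewrite -(subnKC rw) pgood_rec; set r' := (r - _)%N.
  have r'r : (r' < r)%N by rewrite /r'; lia.
  have vc : list_map (fun u : seq Z => v ++ u).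
    by apply: list_map_cat; [exact: list_map_const|exact: list_map_id].
  have uN : umf (fun u => ind (~ A w (v ++ u))) by exact: (umf_comp (umf_notA w) vc).
  pose G u : \bar R := if next w (v ++ u) is Some w' then pgood K r' (v ++ u) w' else pgood K r' v w.
  have uG : umf G.
    pose F (o : option (seq nat)) (u : U) : \bar R := if o is Some w' then pgood K r' (v ++ u) w' else pgood K r' v w.
    apply: (umf_case (c := fun u => next w (v ++ u)) (F := F)).
      by move=> o; exact: (measurable_preimage_list (measurable_next w o) vc).
    case=> [w'|]; first exact: (umf_comp (umf_pgood K r' w') vc).
    exact/umf_cst/pgood_ge0.
  (* The null event that [A w] fails is added to the bound, where it pays for every block that
     triggers a move. *)
  rewrite -[leRHS]adde0 -[X in _ + X]fin -ELD//.
  rewrite -(EL_cst P (size w).+1 1); apply: EL_le => // u _; rewrite /G.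
  case E: next => [w'|]; last by rewrite (le_trans (IH _ r'r))// leeDl// ind_ge0.
  have [pw nB] := next_Some E.
  rewrite ind1; first by rewrite leeDr// pgood_ge0.
  by move=> /A_alv[_ /(_ w' pw)].
apply: (@le_trans _ _ (pinf (size w) v w)); last by apply: ereal_sup_ubound; exists (size w).
by apply: le_ereal_inf_tmp => _ [r _ <-]; exact: H.
Qed.

(** A renewal argument. A block without a move leaves (v, w) unchanged, so if q is the probability
    of a move, the induction hypothesis gives [plim] at least q + (1 - q) [plim]. Unless w is final,
    q > 0, and then [plim] is at least 1. *)
Lemma plim_ge1 w v : safe v -> 1 <= plim v w.
Proof.
elim/(well_founded_ind wf_pr): w v => w IH v sv.
have [fin|nfin] := pselect (final w v); first exact: plim_final.
set k := (size w).+1.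
have vc : list_map (fun u : seq Z => v ++ u).
  by apply: list_map_cat; [exact: list_map_const|exact: list_map_id].
have ucase (F0 : U -> \bar R) (F1 : seq nat -> U -> \bar R) : umf F0 -> (forall w', umf (F1 w')) ->
   umf (fun u => if next w (v ++ u) is Some w' then F1 w' u else F0 u).
  move=> u0 u1.
  apply: (umf_case (c := fun u => next w (v ++ u)) (F := fun o u => if o is Some w' then F1 w' u else F0 u)).
    by move=> o; exact: (measurable_preimage_list (measurable_next w o) vc).
  by case.
pose E K := EL k (fun u => if next w (v ++ u) is Some w' then pinf K (v ++ u) w' else pinf K v w).
have leE K : E K <= plim v w.
  (* A sample of size k + K + r leaves K + r after its first block, so level k + K here dominates
     level K one block later. *)
  apply: (@le_trans _ _ (pinf (k + K) v w)); last by apply: ereal_sup_ubound; exists (k + K)%N.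
  apply: le_ereal_inf_tmp => _ [r _ <-]; apply: le_trans (pgood_le _ _ _ (leq_addl k K)).
  rewrite -addnA pgood_rec; apply: EL_le => [u|u _].
    by case: next => [w'|]; exact: (umf_pinf _ _).2.
  by case: next => [w'|]; apply: pinf_le_pgood; exact: leq_addr.
have supE : EL k (fun u => if next w (v ++ u) is Some w' then plim (v ++ u) w' else plim v w) <= plim v w.
  have := @EL_monotone_convergence _ _ P k
    (fun K u => if next w (v ++ u) is Some w' then pinf K (v ++ u) w' else pinf K v w).
  have -> : (fun u : U => ereal_sup (range
     ((fun K u => if next w (v ++ u) is Some w' then pinf K (v ++ u) w' else pinf K v w)^~ u))) =
     (fun u => if next w (v ++ u) is Some w' then plim (v ++ u) w' else plim v w).
    by apply: funext => u; case: next.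
  move=> ->.
  - by apply: ge_ereal_sup => _ [K _ <-]; exact: leE.
  - move=> K; apply: ucase; first exact/umf_cst/(umf_pinf K w).2.
    by move=> w'; exact: (umf_comp (umf_pinf K w') vc).
  - by move=> l i j ij; case: next => [w'|]; exact: pinf_mono.
have uD : umf (fun u => ind (~ safe (v ++ u))).
  by apply: (umf_comp (umf_indicP (Q := fun l => ~ safe l) _) vc); exact: (measurableC measurable_safe).
have uN : umf (fun u => ind (next w (v ++ u) <> None)).
  apply: (umf_comp (umf_indicP (Q := fun l => next w l <> None) _) vc).
  exact: (measurableC (measurable_next w None)).
have uN' : umf (fun u => ind (next w (v ++ u) = None)).
  apply: (umf_comp (umf_indicP (Q := fun l => next w l = None) _) vc).
  exact/measurable_next.
set q := EL k (fun u => ind (next w (v ++ u) <> None)).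
set q' := EL k (fun u => ind (next w (v ++ u) = None)).
have qq' : q + q' = 1.
  rewrite -ELD// -[RHS](EL_cst P k); apply: EL_ext => u _.
  have [H|H] := pselect (next w (v ++ u) = None).
    by rewrite ind0 ?ind1 ?add0e.
  by rewrite ind1// ind0// adde0.
have key : q + plim v w * q' <= plim v w.
  apply: le_trans supE.
  rewrite -ELZ ?plim_ge0// -ELD//; last by apply: umfZ; rewrite ?plim_ge0.
  rewrite -[leRHS]adde0 -[X in _ + X](EL_safe k sv) -ELD//; last first.
    apply: ucase; first exact/umf_cst/plim_ge0.
    by move=> w'; exact: (umf_comp (umf_plim w') vc).
  apply: EL_le => [u|u _].
    by apply: adde_ge0; rewrite ?mule_ge0 ?ind_ge0 ?plim_ge0.
  case E0: next => [w'|]; last first.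
    by rewrite ind0// ind1// add0e mule1 leeDl// ind_ge0.
  rewrite ind1// (ind0 (Q := Some w' = None))// mule0 adde0.
  have [su|nsu] := pselect (safe (v ++ u)).
    apply: (@le_trans _ _ (plim (v ++ u) w')); last by rewrite leeDl// ind_ge0.
    by apply: IH => //; have [] := next_Some E0.
  by rewrite ind1// leeDr// plim_ge0.
(* If almost no block offered a move, then, lists being alive almost surely, [A w] would hold almost
   surely and w would be final. *)
have q0 : q != 0.
  apply/eqP => q0; apply: nfin; rewrite /final -/k.
  have z0 : EL k (fun u => ind (next w (v ++ u) <> None) + ind (~ safe (v ++ u))) = 0.
    by rewrite ELD// EL_safe// adde0.
  apply: (EL_eq0 _ _ z0); first exact: umfD.
    exact: (umf_comp (umf_notA w) vc).
  move=> u _ /eqP; rewrite padde_eq0 ?ind_ge0// => /andP[/eqP n0 /eqP s0].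
  apply: ind0; apply.
  have su : safe (v ++ u).
    by apply: contrapT => ns; move: s0; rewrite ind1// => /eqP; rewrite onee_eq0.
  have nx : next w (v ++ u) = None.
    by apply: contrapT => ns; move: n0; rewrite ind1// => /eqP; rewrite onee_eq0.
  have [//|na] := next_None nx; have := su 0%N; rewrite /= cats0 ind1// => /eqP; by rewrite onee_eq0.
have qp : 0 <= q by apply: EL_ge0 => u; exact: ind_ge0.
have q'p : 0 <= q' by apply: EL_ge0 => u; exact: ind_ge0.
have fin x : 0 <= x -> x <= 1 -> exists2 y : R, x = y%:E & (0 <= y)%R.
  case: x => [y| |]; [by rewrite lee_fin; exists y|by move=> _; rewrite leye_eq|by rewrite leeNy_eq].
have [g Eg g0] := fin _ (plim_ge0 v w) (plim_le1 v w).
have [a Ea a0] := fin q qp ltac:(by rewrite -qq' leeDl).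
have [b Eb b0] := fin q' q'p ltac:(by rewrite -qq' leeDr).
move: key qq' q0; rewrite Eg Ea Eb -EFinM -!EFinD !lee_fin => key [ab] an0.
have {}an0 : (0 < a)%R by rewrite lt_neqAle a0 eq_sym andbT; apply: contra_neq an0 => ->.
nra.
Qed.

End Run.

(** * The learner *)

Lemma mask_zip (S T : Type) b (s : seq S) (t : seq T) : size s = size t ->
  mask b (zip s t) = zip (mask b s) (mask b t).
Proof. by elim: b s t => [|[] b IH] [|x s] [|y t] //= [/IH ->]. Qed.

Section Discrete.
Variables (R : realType) (X : ptopologicalType).
Local Notation Z := (sample X).
Local Notation U := (usample X R).
Local Notation z0 := (sample0 X).

Lemma measurable_filter_eq (T : eqType) (p : T -> U -> Prop) (s r : seq T) :
  (forall y, measurable [set l | p y l]) ->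
  measurable [set l | [seq y <- s | `[< p y l >]] = r].
Proof.
move=> mp; elim: s r => [|y s IH] r /=; first exact: measurable_cst_prop.
rewrite (_ : mkset _ = ([set l | p y l] `&` [set l | y :: [seq z <- s | `[< p z l >]] = r]) `|`
   (~` [set l | p y l] `&` [set l | [seq z <- s | `[< p z l >]] = r])).
  apply: measurableU; apply: measurableI => //; last exact: measurableC.
  case: r => [|z r]; first by rewrite (_ : mkset _ = set0)//; apply/seteqP; split.
  rewrite (_ : mkset _ = [set _ | y = z] `&` [set l | [seq z <- s | `[< p z l >]] = r]).
    by apply: measurableI => //; exact: measurable_cst_prop.
  by apply/seteqP; split=> l /=; [move=> [-> ->]|move=> [-> ->]].
apply/seteqP; split=> l /=; case: asboolP => h; [by left|by right|by case=> -[]|by case=> -[]].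
Qed.

Lemma measurable_nth_list (A : set Z) i : measurable A -> measurable [set l : U | A (nth z0 l i)].
Proof.
move=> mA; rewrite measurable_usampleE => n; apply: univ_measurable_borel.
have [ilt|ni] := ltnP i n.
  by have := measurable_nth ilt measurableT mA; rewrite setTI.
rewrite (_ : mkset _ = [set _ | A z0]); first exact: measurable_cst_prop.
by apply/seteqP; split=> t /=; rewrite nth_default// size_tuple.
Qed.

Lemma measurable_label b : measurable [set z : Z | z.2 = b].
Proof.
have ms : measurable_fun setT (@snd (borel X) bool) by exact: measurable_snd.
by have := ms measurableT [set b] I; rewrite setTI.
Qed.

Lemma measurable_labels_eq ys : measurable [set l : U | unzip2 l = ys].
Proof.
rewrite (_ : mkset _ = [set l : U | size l = size ys] `&`
   [set l : U | forall i : 'I_(size ys), [set l : U | [set z : Z | z.2 = nth false ys i] (nth z0 l i)] l]).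
  apply: measurableI; first exact: (measurable_size (fun n => n = size ys)).
  apply: (@measurable_forall _ _ _ (fun i : 'I_(size ys) => [set l : U | [set z : Z | z.2 = nth false ys i] (nth z0 l i)])) => i.
  exact: (measurable_nth_list i (measurable_label _)).
apply/seteqP; split=> l /=.
  move=> <-; rewrite size_map; split=> // i.
  by rewrite (nth_map z0)// -[X in (_ < X)%N](size_map snd).
move=> [sl H]; apply: (@eq_from_nth _ false); rewrite size_map// => i il.
by rewrite (nth_map z0)//; rewrite sl in il; exact: (H (Ordinal il)).
Qed.

Lemma measurable_imply (S1 S2 : set U) : measurable S1 -> measurable S2 ->
  measurable [set l | S1 l -> S2 l].
Proof.
move=> m1 m2; rewrite (_ : mkset _ = ~` S1 `|` S2); first by apply: measurableU => //; exact: measurableC.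
apply/seteqP; split=> l /=; last by case.
by have [s1 /(_ s1)|] := pselect (S1 l); [right|left].
Qed.

Lemma list_map_relabel m y : list_map (fun l : seq Z => zip (unzip1 (drop m l)) y).
Proof.
apply/list_mapP => n; exists (minn (n - m) (size y)); split=> [t|j].
  by rewrite size_zip size_map size_drop size_tuple.
rewrite leq_min => /andP[j1 j2].
rewrite (_ : (fun t => _) = fun t : n.-tuple Z => ((nth z0 t (m + j)).1, nth false y j)).
  apply: measurable_fun_pair => //.
  by apply: (measurableT_comp (@measurable_fst _ _ _ _)); apply: measurable_nth; lia.
apply: funext => t; rewrite nth_zip_cond size_zip size_map size_drop size_tuple leq_min j1 j2 /=.
by rewrite (nth_map z0) ?size_drop ?size_tuple// nth_drop.
Qed.

End Discrete.

(** * Leave-one-out votes at a fixed state *)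

Section Vote.
Variables (R : realType) (X : ptopologicalType).
Local Notation Z := (sample X).
Local Notation U := (usample X R).
Local Notation z0 := (sample0 X).
Variables A B : seq nat -> U -> Prop.
Hypothesis B_A : forall w (v : U), ~ B w v -> forall xi : seq X, size xi = (size w).+1 ->
  exists2 e, size e = (size w).+1 & ~ A w (v ++ zip xi e).
Hypothesis mA : forall w, measurable [set l | A w l].
Variable order : nat -> nat -> seq bitseq -> seq bitseq.
Hypothesis orderP : forall n d vs, uniq vs -> (forall y, y \in vs -> size y = n) ->
  unshattered n (mem vs) d.+1 ->
  forall y, y \in vs ->
    (\sum_(i < n) (loo_vote (order n d vs) i y != nth false y i : nat) <= 2 * d)%N.
Local Open Scope ereal_scope.

Definition masks n k := [seq b <- allb n | count id b == k].

Definition avoids w (v s : U) : Prop :=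
  forall b, b \in masks (size s) (size w).+1 -> A w (v ++ mask b s).

(* The labellings of the points of s that avoid the pattern found at the position (v, w). *)
Definition avoiding w (v : U) (s : seq Z) : seq bitseq :=
  [seq y <- allb (size s) | `[< avoids w v (zip (unzip1 s) y) >]].

Definition vote w (v : U) (i : nat) (s : seq Z) : bool :=
  loo_vote (order (size s) (size w) (avoiding w v s)) i (unzip2 s).

Lemma mem_masks n k b : (b \in masks n k) = (size b == n) && (count id b == k).
Proof. by rewrite mem_filter mem_allb andbC. Qed.

(** Since [B w v] fails, each choice of |w| + 1 points has a labelling that breaks [A w]; avoiding
    labellings omit it. *)
Lemma avoiding_unshattered w v s : ~ B w v ->
  unshattered (size s) (mem (avoiding w v s)) (size w).+1.
Proof.
move=> nB b sb cb.
have sm : size (mask b (unzip1 s)) = (size w).+1 by rewrite size_mask// size_map.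
have [e se nA] := B_A nB sm; exists e => // y sy /=.
rewrite mem_filter => /andP[/asboolP av _] E; apply: nA.
rewrite -E -mask_zip ?size_map//; apply: av.
by rewrite mem_masks size_zip size_map sy minnn sb eqxx cb eqxx.
Qed.

Lemma vote_errors w v s : ~ B w v -> avoids w v s ->
  (\sum_(i < size s) (vote w v i s != nth false (unzip2 s) i : nat) <= 2 * size w)%N.
Proof.
move=> nB av; apply: (orderP (n := size s) (d := size w) (vs := avoiding w v s)).
- exact/filter_uniq/allb_uniq.
- by move=> y; rewrite mem_filter mem_allb => /andP[_ /eqP].
- exact: avoiding_unshattered.
- rewrite mem_filter mem_allb size_map eqxx andbT; apply/asboolP.
  by rewrite zip_unzip.
Qed.

Lemma vote_set_label w v i s t : unzip1 s = unzip1 t ->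
  set_nth false (unzip2 s) i false = set_nth false (unzip2 t) i false ->
  vote w v i s = vote w v i t.
Proof.
move=> E1 E2; have sz : size s = size t by rewrite -(size_map fst) -/(unzip1 s) E1 size_map.
rewrite /vote /avoiding sz E1.
by rewrite -(loo_vote_set _ i _ false) E2 loo_vote_set.
Qed.

(** The vote depends on the list only through discrete data: the number of points, the avoiding
    labellings and the labels. So the choice behind [order] does no harm. *)
Lemma measurable_vote m w i (b : bool) : measurable [set l : U | vote w (take m l) i (drop m l) = b].
Proof.
have mav (y : bitseq) : measurable [set l : U | avoids w (take m l) (zip (unzip1 (drop m l)) y)].
  rewrite (_ : mkset _ = [set l : U | forall b : bitseq,
      [set l : U | [set l : U | b \in masks (minn (size l - m) (size y)) (size w).+1] l ->
         [set l : U | A w (take m l ++ mask b (zip (unzip1 (drop m l)) y))] l] l]).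
    apply: measurable_forall => b'; apply: measurable_imply.
      exact: (measurable_size (fun n => b' \in masks (minn (n - m) (size y)) (size w).+1)).
    apply: (measurable_preimage_list (mA w)); apply: list_map_cat; first exact: list_map_take.
    by apply: list_map_comp; [exact: list_map_mask|exact: list_map_relabel].
  apply/seteqP; split=> l /= H b'; have := H b'; by rewrite size_zip size_map size_drop.
rewrite (_ : mkset _ = [set l : U | exists p : nat * seq bitseq * bitseq,
   [set l : U | ([set l : U | size l - m = p.1.1]%N `&`
      [set l : U | [seq y <- allb p.1.1 | `[< avoids w (take m l) (zip (unzip1 (drop m l)) y) >]] = p.1.2] `&`
      [set l : U | unzip2 (drop m l) = p.2]) l /\
    loo_vote (order p.1.1 (size w) p.1.2) i p.2 = b] l]).
  apply: measurable_exists => p; apply: measurableI; last exact: measurable_cst_prop.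
  apply: measurableI; last first.
    exact: (measurable_preimage_list (@measurable_labels_eq R X p.2) (list_map_drop X m)).
  apply: measurableI; first exact: (measurable_size (fun n => n - m = p.1.1)%N).
  exact: measurable_filter_eq.
apply/seteqP; split=> l /=.
  move=> <-; exists (size (drop m l), avoiding w (take m l) (drop m l), unzip2 (drop m l)) => /=.
  by rewrite /vote /avoiding size_drop.
by move=> [[[N vs] ys] /= [[[<- <-] <-] <-]]; rewrite /vote /avoiding size_drop.
Qed.

End Vote.

(** * The majority over batches and positions, and its expected error *)

Section Learner.
Variables (R : realType) (X : ptopologicalType).
Local Notation Z := (sample X).
Local Notation U := (usample X R).
Local Notation z0 := (sample0 X).
Variables (A B : seq nat -> U -> Prop) (pr : seq nat -> seq nat -> Prop).
Hypothesis B_A : forall w (v : U), ~ B w v -> forall xi : seq X, size xi = (size w).+1 ->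
  exists2 e, size e = (size w).+1 & ~ A w (v ++ zip xi e).
Hypothesis B0 : ~ B [::] [::].
Hypothesis mA : forall w, measurable [set l | A w l].
Hypothesis mB : forall w, measurable [set l | B w l].
Variable order : nat -> nat -> seq bitseq -> seq bitseq.
Hypothesis orderP : forall n d vs, uniq vs -> (forall y, y \in vs -> size y = n) ->
  unshattered n (mem vs) d.+1 ->
  forall y, y \in vs ->
    (\sum_(i < n) (loo_vote (order n d vs) i y != nth false y i : nat) <= 2 * d)%N.
Local Open Scope ereal_scope.

Local Notation vote := (vote A order).
Local Notation run := (run B pr).

Lemma umfM (F G : U -> \bar R) : umf F -> umf G -> umf (fun l => F l * G l).
Proof. by move=> [? F0] [? G0]; split=> [|l]; [exact: emeasurable_funM|exact: mule_ge0]. Qed.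

Definition mistake w (v : U) (i : nat) (s : seq Z) : Prop :=
  vote w v i s <> nth false (unzip2 s) i.

Lemma nth_label (s : seq Z) i : nth false (unzip2 s) i = (nth z0 s i).2.
Proof.
have [h|h] := ltnP i (size s); first by rewrite (nth_map z0).
by rewrite !nth_default// size_map.
Qed.

Lemma measurable_mistake m w i : measurable [set l : U | mistake w (take m l) i (drop m l)].
Proof.
have H b : measurable ([set l : U | vote w (take m l) i (drop m l) = b] `&`
    [set l : U | [set l : U | [set z : Z | z.2 = ~~ b] (nth z0 l i)] (drop m l)]).
  apply: measurableI; first exact: measurable_vote.
  exact: (measurable_preimage_list (measurable_nth_list i (measurable_label _)) (list_map_drop X m)).
rewrite (_ : mkset _ = [set l : U | exists b : bool,
  ([set l : U | vote w (take m l) i (drop m l) = b] `&`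
    [set l : U | [set l : U | [set z : Z | z.2 = ~~ b] (nth z0 l i)] (drop m l)]) l]).
  exact: measurable_exists.
apply/seteqP; split=> l /=; rewrite /mistake nth_label.
  move=> ne; exists (vote w (take m l) i (drop m l)); split=> //.
  by move: ne; case: (vote _ _ _ _); case: (nth _ _ _).2.
by move=> [b [-> ->]]; case: b.
Qed.

Variable P : probability (borel X * bool)%type R.
Local Notation EL := (EL P).
Local Notation good := (good A P).
Local Notation final := (final A P).

Lemma list_map_prefix (v : seq Z) : list_map (fun s : seq Z => v ++ s).
Proof. by apply: list_map_cat; [exact: list_map_const|exact: list_map_id]. Qed.

Lemma umf_mistake w v i : umf (fun s : U => ind R (mistake w v i s)).
Proof.
have := umf_comp (umf_indicP (measurable_mistake (size v) w i)) (list_map_prefix v).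
by congr umf; apply: funext => s; rewrite take_size_cat// drop_size_cat.
Qed.

Lemma sum_ind (I : Type) (s : seq I) (Q : I -> Prop) :
  \sum_(i <- s) ind R (Q i) = ((\sum_(i <- s) `[< Q i >])%N%:R)%:E.
Proof.
elim: s => [|i s IH]; first by rewrite !big_nil.
by rewrite !big_cons IH natrD EFinD.
Qed.

(** Data avoiding the pattern cause at most 2|w| mistakes. Otherwise some mask b exhibits the
    pattern, a null event for each b because a masked i.i.d. list is i.i.d.; there the trivial bound
    N suffices. *)
Lemma expected_mistakes w v N : final w v -> ~ B w v ->
  \sum_(i < N) EL N (fun s => ind R (mistake w v i s)) <= ((2 * size w)%:R)%:E.
Proof.
move=> fin nB.
rewrite -EL_sum; last by move=> i; exact: umf_mistake.
pose bs := masks N (size w).+1.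
have uA b : umf (fun s : U => ind R (~ A w (v ++ mask b s))).
  apply: (umf_comp (umf_notA mA w)); apply: list_map_cat; [exact: list_map_const|exact: list_map_mask].
apply: (@le_trans _ _ (EL N (fun s => ((2 * size w)%:R)%:E +
    \sum_(b <- bs) (N%:R)%:E * ind R (~ A w (v ++ mask b s))))).
  apply: EL_le => [s|s sN]; first by apply: sume_ge0 => i _; exact: ind_ge0.
  have [av|nav] := pselect (avoids A w v s).
    apply: (@le_trans _ _ (((2 * size w)%:R)%:E)); last first.
      by rewrite leeDl// sume_ge0// => b _; rewrite mule_ge0 ?lee_fin ?ind_ge0.
    rewrite sum_ind lee_fin ler_nat; apply: leq_trans (vote_errors B_A orderP nB av).
    rewrite sN; apply: leq_sum => i _; case: asboolP => // h.
    by case: eqP.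
  have [b bs' nA] : exists2 b, b \in bs & ~ A w (v ++ mask b s).
    apply: contrapT => h; apply: nav => b; rewrite sN => bb; apply: contrapT => nA.
    by apply: h; exists b.
  apply: (@le_trans _ _ ((N%:R)%:E)).
    rewrite sum_ind lee_fin ler_nat; apply: (@leq_trans (\sum_(i < N) 1)%N).
      by apply: leq_sum => i _; case: asboolP.
    by rewrite sum_nat_const card_ord muln1.
  apply: (@le_trans _ _ (\sum_(b <- bs) (N%:R)%:E * ind R (~ A w (v ++ mask b s)))); last first.
    by rewrite leeDr// lee_fin.
  rewrite (big_rem b)//= ind1// mule1 leeDl// sume_ge0// => b' _.
  by rewrite mule_ge0 ?lee_fin ?ind_ge0.
have uN b : umf (fun s : U => (N%:R)%:E * ind R (~ A w (v ++ mask b s))).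
  by apply: umfZ => //; rewrite lee_fin.
rewrite ELD; [|by apply: umf_cst; rewrite lee_fin|exact: umf_sum].
rewrite EL_cst EL_sum// big_seq big1 ?adde0// => b.
rewrite mem_masks => /andP[/eqP sb /eqP cb].
rewrite ELZ ?lee_fin// -[X in EL X]sb (EL_mask P b (fun u => ind R (~ A w (v ++ u)))) cb.
by rewrite [EL _ _]fin mule0.
Qed.

Variables (m t N : nat).

(* Moves the last entry of a list of length N+1 to position i. *)
Definition ins (i : nat) (c : seq Z) : seq Z := take i (take N c) ++ drop N c ++ drop i (take N c).

Definition block (j i : nat) (l : seq Z) : seq Z := take t (drop (j * t) l) ++ ins i (drop (m * t) l).

Definition state (l : seq Z) : U * seq nat := run t [::] [::] (take t l).

Definition votes (j i : nat) (l : seq Z) : bool :=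
  let s := state (drop (j * t) l) in vote s.2 s.1 i (ins i (drop (m * t) l)).

(** The order behind a vote is not invariant under permutations of the points, so the mistake bound
    controls the sum over positions and not a given position; hence the vote over all i. *)
Definition predict (l : seq Z) : bool :=
  (m * N.+1 < 2 * \sum_(j < m) \sum_(i < N.+1) votes j i l)%N.

Lemma list_map_ins i : list_map (ins i).
Proof.
apply: list_map_cat; first by apply: list_map_comp; exact: list_map_take.
apply: list_map_cat; first exact: list_map_drop.
by apply: list_map_comp; [exact: list_map_drop|exact: list_map_take].
Qed.

Lemma umf_state (phi : nat -> seq nat -> U -> \bar R) j i : (j < m)%N -> (forall k w, umf (phi k w)) ->
  umf (fun l => if (m * t <= size l)%N then
     (let s := state (drop (j * t) l) in phi (size s.1) s.2 (s.1 ++ ins i (drop (m * t) l))) else 0).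
Proof.
move=> jm uphi.
have lb : list_map (block j i).
  apply: list_map_cat; first by apply: list_map_comp; [exact: list_map_take|exact: list_map_drop].
  by apply: list_map_comp; [exact: list_map_ins|exact: list_map_drop].
have := umf_if (measurable_size (fun n => (m * t <= n)%N)) (umf_comp (umf_run pr mB t 0 t [::] uphi) lb) (umf_cst X (lexx 0)).
congr umf; apply: funext => l; case: asboolP => /= h; last by rewrite ifN//; apply/negP.
rewrite h take0 drop0 add0n /block /state.
have st : size (take t (drop (j * t) l)) = t.
  rewrite size_takel// size_drop leq_subRL.
    by apply: leq_trans h; rewrite addnC -mulSn leq_mul2r jm orbT.
  by apply: leq_trans h; rewrite leq_mul2r (ltnW jm) orbT.
by rewrite take_size_cat// drop_size_cat.
Qed.

Lemma measurable_votes j i (b : bool) : (j < m)%N -> umf (fun l : U =>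
  if (m * t <= size l)%N then ind R (votes j i l = b) else 0).
Proof.
move=> jm.
have := umf_state i jm (fun k w => umf_indicP (measurable_vote mA order k w i b)).
by congr umf; apply: funext => l; rewrite /= take_size_cat// drop_size_cat.
Qed.

Lemma measurable_predict : measurable [set l : U | (m * t <= size l)%N /\ predict l].
Proof.
pose F (l : U) : \bar R := \sum_(j < m) \sum_(i < N.+1)
  (if (m * t <= size l)%N then ind R (votes j i l = true) else 0).
have [mF _] : umf F by apply: umf_sum => j; apply: umf_sum => i; exact: measurable_votes.
rewrite (_ : mkset _ = [set l | (m * t <= size l)%N] `&` F @^-1` [set x | ((m * N.+1)%:R / 2)%:E < x]).
  apply: measurableI; first exact: (measurable_size (fun n => (m * t <= n)%N)).
  have mY : measurable [set x : \bar R | ((m * N.+1)%:R / 2)%:E < x].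
    rewrite (_ : mkset _ = `](((m * N.+1)%:R / 2)%:E : \bar R), +oo[%classic); first exact: emeasurable_itv.
    by apply/seteqP; split=> x /=; rewrite in_itv /= andbT.
  by have := mF measurableT _ mY; rewrite setTI.
have FE (l : U) : (m * t <= size l)%N -> F l = ((\sum_(j < m) \sum_(i < N.+1) votes j i l)%N%:R)%:E.
  move=> h; rewrite /F natr_sum -sumEFin; apply: eq_bigr => j _.
  rewrite h sum_ind; congr (_%:R%:E); apply: eq_bigr => i _.
  by congr nat_of_bool; apply/asboolP/idP.
by apply/seteqP; split=> l /= -[h H]; split=> //; move: H;
  rewrite FE// lte_fin /predict ltr_pdivrMr// -natrM ltr_nat (mulnC 2%N).
Qed.

Definition nbad K (l : U) : nat :=
  \sum_(j < m) `[< ~ good K (state (drop (j * t) l)).2 (state (drop (j * t) l)).1 >].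

Definition good_mistake K j i (l : U) : Prop :=
  let s := state (drop (j * t) l) in good K s.2 s.1 /\ mistake s.2 s.1 i (ins i (drop (m * t) l)).

(** If at least m/4 batches are bad, the first term is at least 1 because 256 = 4^4. Otherwise at
    least half of the m(N+1) votes are wrong and at most a quarter come from bad batches, so good
    batches cast at least a quarter of all votes wrongly. *)
Lemma majority_error K (l : U) y : (0 < m)%N ->
  (forall i, (i < N.+1)%N -> nth false (unzip2 (ins i (drop (m * t) l))) i = y) -> predict l != y ->
  1 <= ((4 ^+ m)^-1 * 256 ^+ nbad K l)%:E +
    (4 / (m * N.+1)%:R)%:E * \sum_(j < m) \sum_(i < N.+1) ind R (good_mistake K j i l).
Proof.
move=> m0 lab err.
set S := (\sum_(j < m) \sum_(i < N.+1) `[< good_mistake K j i l >])%N.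
have SE : \sum_(j < m) \sum_(i < N.+1) ind R (good_mistake K j i l) = (S%:R)%:E.
  by rewrite /S natr_sum -sumEFin; apply: eq_bigr => j _; rewrite sum_ind.
have cnt : (m * N.+1 <= 2 * \sum_(j < m) \sum_(i < N.+1) (votes j i l != y))%N.
  pose a := (\sum_(j < m) \sum_(i < N.+1) votes j i l)%N.
  pose b := (\sum_(j < m) \sum_(i < N.+1) ~~ votes j i l)%N.
  have cM : (a + b = m * N.+1)%N.
    rewrite -big_split /= (eq_bigr (fun=> N.+1)) ?sum_nat_const ?card_ord// => j _.
    rewrite -big_split /= (eq_bigr (fun=> 1%N)) ?sum1_card ?card_ord// => i _.
    by case: (votes _ _ _).
  have -> : (\sum_(j < m) \sum_(i < N.+1) (votes j i l != y) = if y then b else a)%N.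
    by case: (y); apply: eq_bigr => j _; apply: eq_bigr => i _; case: (votes _ _ _).
  move: err; rewrite /predict -/a; clearbody a b.
  by case: (y); case: ltnP => // h _; lia.
have spl : (\sum_(j < m) \sum_(i < N.+1) (votes j i l != y) <= nbad K l * N.+1 + S)%N.
  rewrite /nbad /S big_distrl -big_split /=; apply: leq_sum => j _.
  have [g|ng] := pselect (good K (state (drop (j * t) l)).2 (state (drop (j * t) l)).1).
    apply: (@leq_trans (\sum_(i < N.+1) `[< good_mistake K j i l >])%N); last exact: leq_addl.
    apply: leq_sum => i _; case: asboolP => [_|ngm]; first by case: (_ != _).
    case: eqP => // ne; case: ngm; split=> //; rewrite /mistake.
    by rewrite lab// => E; apply: ne.
  rewrite asboolT// mul1n; apply: (@leq_trans N.+1); last exact: leq_addr.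
  apply: (@leq_trans (\sum_(i < N.+1) 1)%N); last by rewrite sum_nat_const card_ord muln1.
  by apply: leq_sum => i _; case: (_ != _).
rewrite SE -EFinM -EFinD lee_fin.
have M0 : (0 < (m * N.+1)%:R :> R)%R by rewrite ltr0n muln_gt0 m0.
have p4 : (0 < 4 ^+ m :> R)%R by rewrite exprn_gt0.
have [few|many] := ltnP (4 * nbad K l)%N m.
  have M4 : (m * N.+1 <= 4 * S)%N.
    have : (4 * nbad K l * N.+1 <= m * N.+1)%N by rewrite leq_mul2r (ltnW few) orbT.
    move: cnt spl; lia.
  apply: (@le_trans _ _ (4 / (m * N.+1)%:R * S%:R)%R); last first.
    by rewrite lerDr mulr_ge0 ?invr_ge0 ?exprn_ge0// ltW.
  by rewrite mulrAC ler_pdivlMr// mul1r -natrM ler_nat.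
apply: (@le_trans _ _ ((4 ^+ m)^-1 * 256 ^+ nbad K l)%R); last first.
  by rewrite lerDl mulr_ge0// divr_ge0// ltW.
rewrite mulrC ler_pdivlMr// mul1r (_ : 256 = 4 ^+ 4 :> R)%R; last by ring.
by rewrite -exprM ler_weXn2l ?ler1n.
Qed.

Let weight K (l : U) : \bar R := (256 ^+ `[< ~ good K (state l).2 (state l).1 >])%:E.

Lemma measurable_good K w : measurable [set v : U | good K w v].
Proof.
rewrite (_ : mkset _ = [set v | final w v] `&` [set _ | (size w <= K)%N])//.
by apply: measurableI; [exact: measurable_final|exact: measurable_cst_prop].
Qed.

Lemma umf_on_state (Q : seq nat -> U -> Prop) : (forall w, measurable [set v | Q w v]) ->
  umf (fun l : U => ind R (Q (state l).2 (state l).1)).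
Proof.
move=> mQ.
have uphi (k : nat) (w : seq nat) : umf (fun l : U => ind R (Q w (take k l))).
  exact: (umf_comp (umf_indicP (mQ w)) (list_map_take X k)).
have := umf_run pr mB t 0 t [::] uphi; congr umf; apply: funext => l.
by rewrite /= take0 drop0 take_size_cat.
Qed.

Lemma weightE K l : weight K l = 1 + (255%:R)%:E * ind R (~ good K (state l).2 (state l).1).
Proof.
rewrite /weight /ind -EFinM -EFinD; congr _%:E.
by case: asboolP => _; rewrite ?expr1 ?expr0 ?mulr1 ?mulr0 ?addr0//; ring.
Qed.

Lemma umf_weight K : umf (weight K).
Proof.
have p255 : 0 <= (255%:R : R)%:E by rewrite lee_fin.
have := umfD (umf_cst X lee01) (umfZ p255
  (umf_on_state (Q := fun w v => ~ good K w v) (fun w => measurableC (measurable_good K w)))).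
by congr umf; apply: funext => l; rewrite weightE.
Qed.

(** The expectation is 256 - 255 p for p the probability of a good batch; p = 254/255 is where it
    equals 2. *)
Lemma EL_weight K : (254 / 255)%:E <= pgood A B pr P K t [::] [::] -> EL t (weight K) <= 2%:E.
Proof.
move=> pg.
have uG : umf (fun l : U => ind R (good K (state l).2 (state l).1)).
  exact: (umf_on_state (measurable_good K)).
have E : EL t (weight K) + (255%:R)%:E * pgood A B pr P K t [::] [::] = 256%:E.
  rewrite (_ : pgood _ _ _ _ _ _ _ _ = EL t (fun l : U => ind R (good K (state l).2 (state l).1))).
    rewrite -ELZ ?lee_fin// -ELD; [|exact: umf_weight|by apply: umfZ; rewrite ?lee_fin].
    rewrite -[RHS](EL_cst P t); apply: EL_ext => l _; rewrite /weight.
    have [g|ng] := pselect (good K (state l).2 (state l).1).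
      rewrite ind1// asboolF ?expr0; last by apply.
      by rewrite -EFinM -EFinD; congr _%:E; ring.
    by rewrite ind0// asboolT// expr1 mule0 adde0.
  by apply: EL_ext => l lt; rewrite /state take_oversize ?lt.
have := pgood_le1 A B pr P K t [::] [::]; have := pgood_ge0 A B pr P K t [::] [::].
move: E pg; have : 0 <= EL t (weight K) by apply: EL_ge0 => l; exact: (umf_weight K).2.
case: (pgood _ _ _ _ _ _ _ _) => [p| |]; [|by rewrite leye_eq|by rewrite leeNy_eq].
case: (EL _ _) => [e| |]; [|by []|by rewrite leeNy_eq].
rewrite -EFinM -EFinD !lee_fin => e0 [E] pg p0 p1.
have : (254 <= 255 * p)%R by rewrite mulrC -ler_pdivrMr//.
lra.
Qed.

(** The count [nbad] with the number of batches free for induction. *)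
Let nb K p (l : U) : nat :=
  \sum_(j < p) `[< ~ good K (state (drop (j * t) l)).2 (state (drop (j * t) l)).1 >].

Let nbS K p l : (256 ^+ nb K p.+1 l)%:E = weight K l * (256 ^+ nb K p (drop t l))%:E.
Proof.
rewrite /nb big_ord_recl /= mul0n drop0 exprD -EFinM; congr (_ * 256 ^+ _)%:E.
by apply: eq_bigr => j _; rewrite drop_drop /= /bump /= mulSn addnC.
Qed.

Lemma umf_nb K p : umf (fun l : U => (256 ^+ nb K p l)%:E).
Proof.
elim: p => [|p IH].
  rewrite (_ : (fun l => _) = fun=> 1); first exact: umf_cst.
  by apply: funext => l; rewrite /nb big_ord0 expr0.
have := umfM (umf_weight K) (umf_comp IH (list_map_drop X t)).
by congr umf; apply: funext => l; rewrite nbS.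
Qed.

(** Batches are disjoint, so the exponential moment factors into those of single batches. *)
Lemma EL_nb K p r : (254 / 255)%:E <= pgood A B pr P K t [::] [::] ->
  EL (p * t + r) (fun l => (256 ^+ nb K p l)%:E) <= (2 ^+ p)%:E.
Proof.
move=> pg; elim: p => [|p IH].
  rewrite (EL_ext P (G := fun=> 1)) ?EL_cst ?expr0// => l _.
  by rewrite /nb big_ord0 expr0.
rewrite mulSn -addnA EL_cat.
apply: (@le_trans _ _ (EL t (fun l => (2 ^+ p)%:E * weight K l))).
  apply: EL_le => [l|l lt]; first by apply: EL_ge0 => u; exact: (umf_nb K p.+1).2.
  rewrite (EL_ext P (G := fun u : U => weight K l * (256 ^+ nb K p u)%:E)); last first.
    by move=> u _; rewrite nbS drop_size_cat// /weight /state take_size_cat// take_oversize ?lt.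
  rewrite ELZ; [|exact: (umf_weight K).2|exact: umf_nb].
  by rewrite muleC; apply: lee_wpmul2r => //; exact: (umf_weight K).2.
rewrite ELZ; [|by rewrite lee_fin exprn_ge0|exact: umf_weight].
rewrite exprSr EFinM; apply: lee_wpmul2l; first by rewrite lee_fin exprn_ge0.
exact: EL_weight.
Qed.

Lemma EL_ins i (F : U -> \bar R) : (i <= N)%N -> umf F -> EL N.+1 (fun c => F (ins i c)) = EL N.+1 F.
Proof.
move=> iN uF; rewrite -(EL_insert P iN uF) -addn1 EL_cat; apply: EL_ext => l lN /=.
apply: eq_integral => z _; congr F.
by rewrite /ins take_size_cat// drop_size_cat.
Qed.

Lemma umf_good_mistake K j i : (j < m)%N -> umf (fun l : U =>
  if (m * t <= size l)%N then ind R (good_mistake K j i l) else 0).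
Proof.
move=> jm.
have mQ (k : nat) (w : seq nat) : measurable [set l : U | good K w (take k l) /\ mistake w (take k l) i (drop k l)].
  apply: measurableI; last exact: measurable_mistake.
  exact: (measurable_preimage_list (measurable_good K w) (list_map_take X k)).
have := umf_state i jm (fun k w => umf_indicP (mQ k w)).
by congr umf; apply: funext => l; rewrite /= take_size_cat// drop_size_cat.
Qed.

(** Given the batches, the final state is fixed and the remaining points are fresh. Each insertion
    preserves their law, so the sum over positions is the one in [expected_mistakes]. *)
Lemma EL_good_mistake K j : (j < m)%N ->
  EL (m * t + N.+1) (fun l => \sum_(i < N.+1)
     if (m * t <= size l)%N then ind R (good_mistake K j i l) else 0) <= ((2 * K)%:R)%:E.
Proof.
move=> jm; rewrite EL_cat -[leRHS](EL_cst P (m * t)); apply: EL_le => [a|a sa].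
  by apply: EL_ge0 => c; apply: sume_ge0 => i _; exact: (umf_good_mistake K i jm).2.
set s := state (drop (j * t) a).
have E c : state (drop (j * t) (a ++ c)) = s.
  have h : (j * t <= size a)%N by rewrite sa leq_mul2r (ltnW jm) orbT.
  have h' : (t <= size a - j * t)%N.
    by rewrite leq_subRL// sa addnC -mulSn leq_mul2r jm orbT.
  rewrite /s /state drop_cat; congr (run _ _ _ _).
  case: ltnP => jt; first by rewrite takel_cat// size_drop.
  have -> : t = 0%N by lia.
  by rewrite !take0.
have Ed c : drop (m * t) (a ++ c) = c by rewrite drop_size_cat.
have le c : (m * t <= size (a ++ c))%N by rewrite size_cat sa leq_addr.
have [g|ng] := pselect (good K s.2 s.1); last first.
  rewrite (EL_ext P (G := fun=> 0)) ?EL_cst ?lee_fin// => c _.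
  by rewrite big1// => i _; rewrite le ind0// /good_mistake E => -[].
rewrite (EL_ext P (G := fun c : U => \sum_(i < N.+1) ind R (mistake s.2 s.1 i (ins i c)))); last first.
  move=> c _; apply: eq_bigr => i _; rewrite le /good_mistake E Ed.
  have [mi|nmi] := pselect (mistake s.2 s.1 i (ins i c)); first by rewrite !ind1.
  by rewrite !ind0// => -[].
rewrite EL_sum; last by move=> i; apply: umf_comp (umf_mistake _ _ _) (list_map_ins i).
rewrite (eq_bigr (fun i : 'I_N.+1 => EL N.+1 (fun c : U => ind R (mistake s.2 s.1 i c)))); last first.
  by move=> i _; rewrite (EL_ins (F := fun c => ind R (mistake s.2 s.1 i c)))//; [rewrite -ltnS|exact: umf_mistake].
have [fin sK] := g.
apply: (le_trans (expected_mistakes N.+1 fin _)); first exact: run_inv.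
by rewrite lee_fin ler_nat leq_mul2l.
Qed.

Lemma predict_label l x b b' : size l = (m * t + N)%N ->
  predict (rcons l (x, b)) = predict (rcons l (x, b')).
Proof.
move=> sl; rewrite /predict; congr (_ < 2 * _)%N; apply: eq_bigr => j _; apply: eq_bigr => i _.
rewrite /votes; congr nat_of_bool.
have h : (m * t <= size l)%N by rewrite sl leq_addr.
have jt : (j * t + t <= size l)%N.
  by apply: leq_trans h; rewrite addnC -mulSn leq_mul2r ltn_ord orbT.
have Es c : state (drop (j * t) (rcons l c)) = state (drop (j * t) l).
  rewrite /state -cats1 drop_cat; congr (run _ _ _ _).
  case: ltnP => jtl; first by rewrite takel_cat// size_drop leq_subRL// ltnW.
  have -> : t = 0%N.
    by have := leq_trans jt jtl; rewrite -[X in (_ <= X)%N]addn0 leq_add2l leqn0 => /eqP.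
  by rewrite !take0.
have Ei c : ins i (drop (m * t) (rcons l c)) = take i (drop (m * t) l) ++ c :: drop i (drop (m * t) l).
  rewrite drop_rcons// /ins -cats1 take_size_cat ?drop_size_cat// size_drop sl; lia.
have si : size (take i (drop (m * t) l)) = i.
  by rewrite size_takel// size_drop sl addKn -ltnS.
rewrite /= !Es !Ei; apply: vote_set_label.
  by rewrite /unzip1 !map_cat.
rewrite /unzip2 !map_cat /= !set_nthE !size_cat !size_map si /= -addSnnS leq_addr.
rewrite !take_size_cat ?size_map// !drop_cat size_map si ltnNge leqnSn /=.
by rewrite subSnn /= !drop0.
Qed.

(** The first term is 4^-m times the moment bound 2^m; the second is 4 / (m(N+1)) times m batches
    with 2K mistakes each. *)
Theorem expected_predict K : (0 < m)%N -> (254 / 255)%:E <= pgood A B pr P K t [::] [::] ->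
  EL (m * t + N) (fun l => \int[P]_z ind R (predict (rcons l (z.1, false)) != z.2)) <=
    ((2 ^+ m)^-1 + 8 * K%:R / N.+1%:R)%:E.
Proof.
move=> m0 pg.
have M0 : (0 < (m * N.+1)%:R :> R)%R by rewrite ltr0n muln_gt0 m0.
pose F1 (l : U) : \bar R := ((4 ^+ m)^-1)%:E * (256 ^+ nb K m l)%:E.
pose F2 (l : U) : \bar R := (4 / (m * N.+1)%:R)%:E * \sum_(j < m) \sum_(i < N.+1)
   if (m * t <= size l)%N then ind R (good_mistake K j i l) else 0.
have p4 : 0 <= ((4 ^+ m)^-1)%:E :> \bar R by rewrite lee_fin invr_ge0 exprn_ge0.
have pM : 0 <= (4 / (m * N.+1)%:R)%:E :> \bar R by rewrite lee_fin divr_ge0.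
have u1 : umf F1 by apply: umfZ => //; exact: umf_nb.
have u2' : umf (fun l : U => \sum_(j < m) \sum_(i < N.+1)
   if (m * t <= size l)%N then ind R (good_mistake K j i l) else 0).
  by apply: umf_sum => j; apply: umf_sum => i; exact: umf_good_mistake.
have u2 : umf F2 by exact: umfZ.
(* The test point becomes one more i.i.d. sample, the last, with its true label in place of the
   dummy one. *)
apply: (@le_trans _ _ (EL (m * t + N.+1) (fun l => F1 l + F2 l))).
  have -> : (m * t + N.+1 = (m * t + N) + 1)%N by lia.
  rewrite [leRHS]EL_cat; apply: EL_le => [l|l sl].
    by apply: integral_ge0 => z _; exact: ind_ge0.
  apply: le_integral_nonneg => z; first exact: ind_ge0.
  have h : (m * t <= size (l ++ [:: z]))%N by rewrite size_cat sl; lia.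
  have [err|nerr] := pselect (predict (rcons l (z.1, false)) != z.2); last first.
    by rewrite ind0// adde_ge0 ?u1.2 ?u2.2.
  rewrite ind1// /F1 /F2 -EFinM; under eq_bigr do under eq_bigr do rewrite h.
  apply: (@majority_error K (l ++ [:: z]) z.2) => //.
    move=> i iN; rewrite nth_label cats1 drop_rcons; last by rewrite sl leq_addr.
    rewrite /ins -cats1 take_size_cat ?drop_size_cat; try by rewrite size_drop sl addKn.
    rewrite nth_cat size_takel; last by rewrite size_drop sl addKn -ltnS.
    by rewrite ltnn subnn.
  move: err; rewrite cats1; case: z {h} => x y /=.
  by rewrite (predict_label x false y sl).
rewrite ELD// EFinD; apply: leeD.
  rewrite /F1 ELZ//; last exact: umf_nb.
  apply: (@le_trans _ _ (((4 ^+ m)^-1)%:E * (2 ^+ m)%:E)).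
    by apply: lee_wpmul2l => //; exact: EL_nb.
  rewrite -EFinM lee_fin -exprVn -exprMn -exprVn.
  by rewrite (_ : 4^-1 * 2 = 2^-1 :> R)%R//; lra.
rewrite /F2 ELZ// EL_sum; last first.
  by move=> j; apply: umf_sum => i; exact: umf_good_mistake.
apply: (@le_trans _ _ ((4 / (m * N.+1)%:R)%:E * \sum_(j < m) ((2 * K)%:R)%:E)).
  by apply: lee_wpmul2l => //; apply: lee_sum => j _; exact: EL_good_mistake.
rewrite sumEFin -EFinM lee_fin sumr_const card_ord -(mulr_natr _ m) !natrM.
have mm : ((m%:R : R) != 0)%R by rewrite pnatr_eq0 -lt0n.
have NN : ((N.+1%:R : R) != 0)%R by rewrite pnatr_eq0.
rewrite le_eqVlt; apply/orP; left; apply/eqP; move: (m%:R : R)%R (N.+1%:R : R)%R mm NN => x y x0 y0; field; exact/andP.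
Qed.

End Learner.

(** * Realizable samples are almost surely consistent *)

Lemma measurable_section (T X : topologicalType) (G : set (T * X)) t :
  <<s [set S : set (T * X) | exists A B,
           [/\ <<s @open T >> A, <<s @open X >> B & S = A `*` B]] >> G ->
  <<s @open X >> [set x | G (t, x)].
Proof.
have [s0 sC sU] : sigma_algebra setT <<s @open X >> by exact: smallest_sigma_algebra.
have sF : sigma_algebra setT [set G : set (T * X) | <<s @open X >> [set x | G (t, x)]].
  split; first exact: s0.
  - by move=> A mA; exact: (sC _ mA).
  - by move=> F HF; have := sU _ HF; congr (<<s _ >> _); apply/seteqP; split=> x [i _ ?]; exists i.
apply: (smallest_sub sF) => _ [A [B [_ mB ->]]] /=.
have [tA|ntA] := pselect (A t).
  by rewrite (_ : mkset _ = B)//; apply/seteqP; split=> x //= -[].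
by rewrite (_ : mkset _ = set0)//; apply/seteqP; split=> x //= -[].
Qed.

Section Realizable.
Variables (R : realType) (X : ptopologicalType).
Local Notation Z := (sample X).
Local Notation U := (usample X R).
Local Notation z0 := (sample0 X).
Variable P : probability (borel X * bool)%type R.
Variables (Theta : Type) (h : Theta -> X -> bool).
Hypothesis mh : forall t, measurable [set x : borel X | h t x].
Local Open Scope ereal_scope.

Lemma measurable_error t : measurable [set z : Z | h t z.1 != z.2].
Proof.
have m1 : measurable [set z : Z | h t z.1].
  by have := @measurable_fst _ _ (borel X) bool measurableT _ (mh t); rewrite setTI.
rewrite (_ : mkset _ = ([set z : Z | h t z.1] `&` [set z : Z | z.2 = false]) `|`
   (~` [set z : Z | h t z.1] `&` [set z : Z | z.2 = true])).
  by apply: measurableU; apply: measurableI; try exact: measurable_label; [exact: m1|exact: measurableC].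
apply/seteqP; split=> -[x y] /=; first by case: (h t x); case: y => //; [left|right].
by move=> [[-> ->]//|[/negP/negbTE -> ->]].
Qed.

Lemma EL_not_alive m t : EL P m (fun l => ind R (~ alive_list h l)) <= (m%:R)%:E * er P (h t).
Proof.
pose e i (l : U) := ind R ([set z : Z | h t z.1 != z.2] (nth z0 l i)).
have ue i : umf (e i) by apply: umf_indicP; exact: (measurable_nth_list i (measurable_error t)).
apply: (@le_trans _ _ (EL P m (fun l => \sum_(i < m) e i l))).
  apply: EL_le => [l|l lm]; first exact: ind_ge0.
  have [al|nal] := pselect (alive_list h l).
    by rewrite ind0 ?sume_ge0// => i _; exact: ind_ge0.
  have [i im ei] : exists2 i, (i < m)%N & h t (nth z0 l i).1 != (nth z0 l i).2.
    apply: contrapT => H; apply: nal; exists t; apply/(all_nthP z0) => i; rewrite lm => im.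
    by apply: contrapT => /negP ne; apply: H; exists i.
  rewrite (bigD1 (Ordinal im))//= {1}/e (ind1 _ (Q := [set z : Z | _] _))//.
  by rewrite (le_trans (ind_le1 _ _))// leeDl// sume_ge0// => j _; exact: ind_ge0.
rewrite EL_sum//.
have E i : (i < m)%N -> EL P m (e i) = er P (h t).
  move=> im.
  have -> : m = (i + (1 + (m - i.+1)))%N by lia.
  rewrite (EL_ext P (G := fun l : U => e 0%N (drop i l))); last first.
    by move=> l _; rewrite /e nth_drop addn0.
  rewrite (EL_drop P i _ (e 0%N)) (EL_ext P (G := fun l : U => e 0%N (take 1 l))); last first.
    by move=> l _; rewrite /e nth_take.
  rewrite (EL_take P 1 _ (e 0%N)) /= /er; apply: eq_integral => z _.
  rewrite /e /ind /=; congr (_%:R%:E)%R.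
  by congr nat_of_bool; apply/asboolP/idP.
under eq_bigr => i _ do rewrite E//.
have e0 : 0 <= er P (h t) by apply: integral_ge0 => z _; rewrite lee_fin.
rewrite big_const_ord; elim: m {ue E} => [|m IH] /=; first by rewrite mul0e.
rewrite -natr1 EFinD ge0_muleDl ?lee_fin// mul1e addeC.
by apply: leeD.
Qed.

(** The infimum of the errors need not be attained, so a concept is chosen for each m: if lists of
    length m were dead with probability a > 0, an error below a / (m+1) would contradict the union
    bound. *)
Lemma safe_nil : realizable P (range h) -> safe (alive_list h) P [::].
Proof.
move=> real m; apply/eqP; rewrite eq_le EL_ge0 ?andbT; last by move=> l; exact: ind_ge0.
rewrite leNgt; apply/negP; set a := EL _ _ _ => a0.
have a1 : a <= 1.
  by rewrite -[leRHS](EL_cst P m); apply: EL_le => l *; [exact: ind_ge0|exact: ind_le1].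
have af : a \is a fin_num by rewrite ge0_fin_numE ?(le_lt_trans a1) ?ltry// ltW.
have fa0 : (0 < fine a)%R by rewrite fine_gt0// a0 ltey_eq af.
have d0 : 0 < (fine a / m.+1%:R)%:E by rewrite lte_fin divr_gt0.
have [_ [_ [t _ <-] <-] lt] : exists2 y, [set er P g | g in range h] y & y < (fine a / m.+1%:R)%:E.
  by apply: ereal_inf_lt; rewrite real.
have e0 : 0 <= er P (h t) by apply: integral_ge0 => z _; rewrite lee_fin.
have ef : er P (h t) \is a fin_num by rewrite ge0_fin_numE// (lt_trans lt)// ltry.
have := EL_not_alive m t; rewrite -/a; move: lt.
rewrite -(fineK ef) -(fineK af) -EFinM lte_fin lee_fin.
rewrite ltr_pdivlMr// -natr1 => h1 h2.
have : (0 <= fine (er P (h t)))%R by exact: fine_ge0.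
lra.
Qed.

End Realizable.

(** * Choice of the parameters and the final rate *)

Lemma batch_size_tends_to_infinity K :
  exists n0, forall n, (n0 <= n)%N -> (K <= n./2 %/ (trunc_log 2 n).+1)%N.
Proof.
(* With p the binary logarithm of n, 8K is at most p, whence 8K(p+1) <= (p+1)^2 <= 4 * 2^p <= 4n. *)
exists (2 ^ (8 * K))%N => n nn; rewrite leq_divRL//.
set p := trunc_log 2 n.
have n0 : (0 < n)%N by apply: leq_trans nn; rewrite expn_gt0.
have h1 : (2 ^ p <= n)%N by exact: trunc_logP.
have h2 : (8 * K <= p)%N by rewrite /p -(trunc_expnK (8 * K) (ltnSn 1)) leq_trunc_log.
have h3 : (p.+1 * p.+1 <= 4 * 2 ^ p)%N.
  elim: p {h1 h2} => // p IH; case: p IH => // p IH.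
  case: p IH => // p IH; case: p IH => // p IH; rewrite expnS; nia.
have h4 : (n = odd n + n./2.*2)%N by rewrite odd_double_half.
have h5 : (8 * (K * p.+1) <= 4 * n)%N by nia.
have := leq_b1 (odd n); lia.
Qed.

Lemma exists_universal_learner (R : realType) (X : ptopologicalType)
    (Theta : topologicalType) (h : Theta -> X -> bool) (t0 : Theta) :
  polish R X -> polish R Theta ->
  <<s [set S : set (Theta * X) | exists A B,
           [/\ <<s @open Theta >> A, <<s @open X >> B & S = A `*` B]] >>
      [set p : Theta * X | h p.1 p.2] ->
  ~ has_infinite_VCL_tree (range h) ->
  exists L : learner X, learner_univ_measurable R L /\
    forall P : probability (borel X * bool)%type R, realizable P (range h) ->
      exists C : R, 0 < C /\
        forall n : nat, (expected_error P L n.+1 <= (C / n.+1%:R)%:E)%E.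
Proof.
move=> pX pT mh nV.
have [dX [d [XPm openX]]] := polish_metricP point pX.
have [dT [sT [TPm openT]]] := polish_metricP t0 pT.
have XP := pm_pm XPm; have X0 := pm_eq0 XPm.
have bi := bianalytic_product_measurable TPm XPm openT openX mh.
have ab b : analytic (dist_prod dT dX) [set p | h p.1 p.2 = b].
  case: b; first exact: bi.1.
  have := bi.2; congr analytic; apply/seteqP; split=> p /=; first by move/negP/negbTE.
  by move=> ->.
have al_an l : analytic (dist_upto dX (size l)) (alive h l).
  exact: (analytic_alive XP X0 t0 l (pm_eq0 TPm) (pm_pm TPm) ab).
have /choice[C /choice[g Hal]] := al_an.
have Ccl l : baire_closed (C l) by have [] := Hal l.
have gc l : cont_on (dist_upto dX (size l)) (C l) (g l) by have [] := Hal l.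
have alp l x : alive h l x <-> exists2 z, C l z & dist_upto dX (size l) (g l z) x = 0.
  by have [_ _ H] := Hal l; exact: H.
have wf := wf_prec XP X0 Ccl gc alp nV.
pose alv : usample X R -> Prop := alive_list h.
pose A : seq nat -> usample X R -> Prop := active h C g.
pose B : seq nat -> usample X R -> Prop := pre_active h C g.
pose pr := prec C g.
have A_alv w l : A w l <-> alv l /\ forall w', pr w' w -> B w' l by exact: activeE.
have B_A w (v : usample X R) : ~ B w v -> forall xi : seq X, size xi = (size w).+1 ->
    exists2 e, size e = (size w).+1 & ~ A w (v ++ zip xi e).
  move=> nB xi sxi; apply: contrapT => ne; apply: nB; exists xi => // e se.
  by apply: contrapT => nA; apply: ne; exists e.
have B0 : ~ B [::] [::] by exact: (not_pre_active_root point XP X0 alp t0 wf).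
have aA w l := analytic_active (point : X) XP X0 al_an wf w l.
have mA w : measurable [set l | A w l] by exact: (measurable_analytic_list XPm openX (aA w)).
have mB w : measurable [set l | B w l].
  apply: (measurable_analytic_list XPm openX) => l.
  by apply: (analytic_pre_active (point : X) XP X0); exact: aA.
have m_alv : measurable [set l | alv l].
  apply: (measurable_analytic_list XPm openX) => l.
  have := al_an l; congr analytic; apply/seteqP; split=> x /=.
    by move/(alive_listP (point : X)).
  by move/(alive_listP (point : X)).
have [order orderP] := exists_loo_order.
(* The number of batches satisfies 2^m > n, and batches use at most n/2 samples, so N is at least
   n/2. *)
pose m n := (trunc_log 2 n).+1; pose t n := (n./2 %/ m n)%N; pose N n := (n - m n * t n)%N.
have mt n : (m n * t n <= n./2)%N by rewrite mulnC leq_trunc_div.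
have half n : (n./2 <= n)%N by have := odd_double_half n; lia.
pose pred n (l : usample X R) := predict A B pr order (m n) (t n) (N n) l.
(* The label false is a dummy: the prediction does not depend on it, by [predict_label]. *)
exists (fun n s x => pred n (rcons s (x, false))); split.
  move=> n; rewrite /univ_measurable_bool.
  have mp := measurable_predict pr mA mB order (m n) (t n) (N n).
  pose psi (p : n.-tuple (borel X * bool)%type * borel X) : seq (sample X) := p.1 ++ [:: (p.2, false)].
  have cpsi : coords psi (n + 1).
    apply: coords_cat.
      split=> [p|i ilt]; first by rewrite size_tuple.
      exact: (measurableT_comp (measurable_nth ilt) (@measurable_fst _ _ _ _)).
    apply: coords_cons; last exact: coords_nil.
    exact: measurable_fun_pair.
  have := @univ_measurable_list R X _ _ psi (n + 1) _ cpsi.1 cpsi.2 mp.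
  congr univ_measurable_set; apply/seteqP; split=> p /=; rewrite /psi cats1; first by case.
  by move=> H; split=> //; rewrite size_rcons size_tuple; apply: leq_trans (mt n) (leqW (half n)).
move=> P real.
have mh' s : measurable [set x : borel X | h s x] by exact: (measurable_section s mh).
have sf := safe_nil mh' real.
have lim1 := plim_ge1 A_alv m_alv mA mB wf [::] sf.
(* One K bounds the depth of good states and is also the batch length from which the probability
   bound holds. *)
have [K HK] : exists K, ((254 / 255)%:E < pinf A B pr P K [::] [::])%E.
  have : ((254 / 255)%:E < plim A B pr P [::] [::])%E.
    by apply: lt_le_trans lim1; rewrite lte_fin; lra.
  by move=> /ereal_sup_gt[_ [K _ <-] lt]; exists K.
have [n0 Hn0] := batch_size_tends_to_infinity K.
(* The 1 pays for 2^-m, 16K for 8K / (N+1) with N+1 at least n/2, and n0 for the sample sizes below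
   n0, where the error is at most 1. *)
exists (1 + 16 * K%:R + n0%:R); split.
  by rewrite -addrA ltr_pwDl// addr_ge0// mulr_ge0.
move=> n; set n1 := n.+1.
have n1p : (0 < n1%:R :> R) by rewrite ltr0n.
rewrite /expected_error.
pose F (l : usample X R) := er P (fun x => pred n1 (rcons l (x, false))).
rewrite (iid_expectE P n1 F).
have FE l : F l = (\int[P]_z ind R (pred n1 (rcons l (z.1, false)) != z.2))%E.
  by apply: eq_integral => z _; rewrite /ind; congr (_%:R%:E)%R; congr nat_of_bool; apply/idP/asboolP.
have [small|big] := ltnP n1 n0.
  apply: (@le_trans _ _ 1%E).
    rewrite -[leRHS](EL_cst P n1); apply: EL_le => [l|l _].
      by apply: integral_ge0 => z _; rewrite lee_fin.
    rewrite FE -[leRHS](EL_cst P 1) /=; apply: le_integral_nonneg => z; first exact: ind_ge0.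
    exact: ind_le1.
  rewrite lee_fin ler_pdivlMr// mul1r.
  have : (n1%:R <= n0%:R :> R) by rewrite ler_nat ltnW.
  have : 0 <= K%:R :> R by [].
  lra.
have pg : ((254 / 255)%:E <= pgood A B pr P K (t n1) [::] [::])%E.
  apply: (le_trans (ltW HK)); apply: pinf_le_pgood; exact: Hn0.
have nE : n1 = (m n1 * t n1 + N n1)%N.
  by rewrite /N subnKC//; exact: leq_trans (mt n1) (half n1).
have := expected_predict B_A B0 mA mB orderP (t := t n1) (N n1) (isT : (0 < m n1)%N) pg.
rewrite -nE (EL_ext P (G := F)); last by move=> l _; rewrite FE.
move=> /le_trans; apply; rewrite lee_fin.
have h1 : n1%:R <= 2 ^+ m n1 :> R.
  by rewrite -natrX ler_nat ltnW// trunc_log_ltn.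
have h2 : n1%:R <= 2 * (N n1).+1%:R :> R.
  rewrite -natrM ler_nat /N; have := mt n1; have := odd_double_half n1; have := leq_b1 (odd n1); lia.
have h3 : (2 ^+ m n1)^-1 <= n1%:R^-1 :> R by rewrite lef_pV2 ?posrE// exprn_gt0.
have h4 : 8 * K%:R / (N n1).+1%:R <= 16 * K%:R / n1%:R :> R.
  rewrite ler_pdivrMr// mulrAC ler_pdivlMr//.
  have : 0 <= K%:R :> R by [].
  nra.
apply: (le_trans (lerD h3 h4)).
rewrite -[X in X + _]mul1r -mulrDl ler_pM2r ?invr_gt0//.
by rewrite lerDl.
Qed.

Theorem mainTheorem12 (R : realType) (X : ptopologicalType) (H : set (X -> bool)) :
  polish R X -> measurable_class R H -> ~ has_infinite_VCL_tree H ->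
  exists L : learner X, learner_univ_measurable R L /\
    forall P : probability (borel X * bool)%type R, realizable P H ->
      exists C : R, 0 < C /\
        forall n : nat, (expected_error P L n.+1 <= (C / n.+1%:R)%:E)%E.
Proof.
move=> pX [T [pT [h [mh ->]]]] nV.
have [[t0 _]|nT] := pselect (exists t0 : T, True).
  exact: (exists_universal_learner t0 pX pT mh nV).
(* Without parameters the class is empty, the infimum of errors is +oo, and no P is realizable. *)
exists (fun _ _ _ => false); split.
  move=> n; rewrite /univ_measurable_bool (_ : _ @^-1` _ = set0).
    exact/univ_measurable_borel/measurable0.
  by apply/seteqP; split.
move=> P; rewrite /realizable (_ : [set er P g | g in range h] = set0) ?ereal_inf0//.
by apply/seteqP; split=> // x [g [t tT tg] ge]; case: nT; exists t.
Qed.
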